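(* Let $X\subset M\subset U\subset\mathbb{R}^n$, where $U$ is open, $M$ is a closed $\mathcal{C}^p$ submanifold of $U$, and $X$ is the closure of its interior as a subset of $M$. Let $f:X\to\mathbb{R}$. If $\nabla^pf:\tau^p(X)\to\mathbb{R}$, then $f$ is the restriction to $X$ of an element of $\mathcal{C}^p(U)$.
   Context: $\mathcal{P}_p$: real polynomials on $\mathbb{R}^n$ of degree $\le p$; $\mathcal{P}_p^*$ dual; $r=\dim\mathcal{P}_p$. For $\xi\in\mathcal{P}_p^*$, $b\in\mathbb{R}^n$, $|\alpha|\le p$: $\xi_\alpha(b):=\xi(\tfrac1{\alpha!}(x-b)^\alpha)$; $\delta_a(P)=P(a)$. A bundle over $X$ with fibres in $W$ is a subset of $X\times W$ with linear-subspace fibres. For a bundle $E\subset X\times\mathcal{P}_p^*$: $\Delta E=\{(a,b,\xi+\eta):a,b\in X,\xi\in E_a,\eta\in E_b,|a-b|^{p-|\alpha|}|\eta_\alpha(b)|\le1\ \forall|\alpha|\le p\}$, $E'=\{(a,\xi):(a,a,\xi)\in\overline{\Delta E}\}$, $\rho(E)=\{(a,\xi):\xi\in\operatorname{Span}E'_a\}$; $\tau^p(X):=\rho^{2r}(E_0)$ with $E_0=\{(a,\lambda\delta_a)\}$ (iterates constant from $2r$ on). For bundles $\Phi\subset X\times(\mathcal{P}_p^*\times\mathbb{R})$: $\Delta\Phi=\{(a,b,\xi+\eta,\lambda+\mu):(\xi,\lambda)\in\Phi_a,(\eta,\mu)\in\Phi_b,|a-b|^{p-|\alpha|}|\eta_\alpha(b)|\le1\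 \forall|\alpha|\le p\}$, $\Phi'=\{(a,\xi,\lambda):(a,a,\xi,\lambda)\in\overline{\Delta\Phi}\}$, $\rho(\Phi)$ fibrewise span of $\Phi'$; $\nabla^pf:=\rho^{2(r+1)}(\Phi_0)$ with $\Phi_0=\{(a,\lambda\delta_a,\lambda f(a))\}$. ''$\nabla^pf:\tau^p(X)\to\mathbb{R}$'' means each $\xi\in\tau^p_a(X)$ has exactly one $\lambda$ with $(a,\xi,\lambda)\in\nabla^pf$. *)

(* Defs.v *)
From HB Require Import structures.
From mathcomp Require Import all_boot all_order all_algebra.
From mathcomp Require Import mpoly.
From mathcomp Require Import all_classical all_reals all_analysis.
Set Implicit Arguments. Unset Strict Implicit. Unset Printing Implicit Defensive.
Import Order.TTheory GRing.Theory Num.Theory.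
Import numFieldNormedType.Exports.
Local Open Scope classical_set_scope.
Local Open Scope ring_scope.

Section Defs.
Variables (R : realType) (n p : nat).

Local Notation pt := 'rV[R]_n.

Definition eucl (v : pt) : R := Num.sqrt (\sum_(i < n) v 0 i ^+ 2).

Local Notation midx := 'X_{1..n < p.+1}.
Definition mcomp (al : midx) (i : 'I_n) : nat := (bmnm al) i.
Definition mdegb (al : midx) : nat := mdeg (bmnm al).
Definition mfact (al : midx) : R := \prod_(i < n) ((mcomp al i)`!)%:R.

(** r = dim P_p. *)
Definition r : nat := #|{: midx}|.

(** An element xi of the dual P_p^* is represented by its (arbitrary) values
    xi(x^alpha) on the monomial basis of P_p; this is a linear isomorphism
    P_p^* ~ R^r. *)
Definition dual := midx -> R.

Definition dual_app (xi : dual) (P : {mpoly R[n]}) : R :=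
  \sum_(al : midx) P@_(bmnm al) * xi al.

Definition dzero : dual := fun _ => 0.
Definition dadd (xi eta : dual) : dual := fun al => xi al + eta al.
Definition dscale (c : R) (xi : dual) : dual := fun al => c * xi al.

Definition delta (a : pt) : dual :=
  fun al => ('X_[bmnm al] : {mpoly R[n]}).@[fun i => a 0 i].

Definition shifted_mon (al : midx) (b : pt) : {mpoly R[n]} :=
  (mfact al)^-1 *: \prod_(i < n) ('X_i - (b 0 i)%:MP) ^+ mcomp al i.

Definition xi_at (xi : dual) (al : midx) (b : pt) : R :=
  dual_app xi (shifted_mon al b).

(** The "distance" from zeta to zeta' in the finite-dimensional space
    P_p^* is measured coordinatewise (all norms are equivalent). *)
Definition dclose (e : R) (zeta zeta' : dual) : Prop :=
  forall al, `|zeta al - zeta' al| < e.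

Definition dspan (S : set dual) : set dual := fun xi =>
  exists (k : nat) (c : 'I_k -> R) (v : 'I_k -> dual),
    (forall j, S (v j)) /\ forall al, xi al = \sum_(j < k) c j * v j al.

Definition dRspan (S : dual -> R -> Prop) : dual -> R -> Prop := fun xi la =>
  exists (k : nat) (c : 'I_k -> R) (v : 'I_k -> dual) (l : 'I_k -> R),
    (forall j, S (v j) (l j)) /\
    (forall al, xi al = \sum_(j < k) c j * v j al) /\
    la = \sum_(j < k) c j * l j.

(** ---- Bundles E over X with fibres in P_p^* ----
    A bundle is given by the predicate E a xi  <->  (a, xi) \in E. *)
Definition bundle := pt -> dual -> Prop.

Variable X : set pt.

Definition DeltaE (E : bundle) : pt -> pt -> dual -> Prop := fun a b zeta =>
  X a /\ X b /\ exists xi eta, E a xi /\ E b eta /\ zeta = dadd xi eta /\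
    forall al : midx, eucl (a - b) ^+ (p - mdegb al) * `|xi_at eta al b| <= 1.

Definition closure3 (S : pt -> pt -> dual -> Prop) : pt -> pt -> dual -> Prop :=
  fun a b zeta => forall e : R, 0 < e -> exists a' b' zeta',
    S a' b' zeta' /\ eucl (a - a') < e /\ eucl (b - b') < e /\
    dclose e zeta zeta'.

Definition primeE (E : bundle) : bundle := fun a xi =>
  X a /\ closure3 (DeltaE E) a a xi.

Definition rhoE (E : bundle) : bundle := fun a xi =>
  X a /\ dspan (primeE E a) xi.

Definition E0 : bundle := fun a xi =>
  X a /\ exists la : R, xi = dscale la (delta a).

Definition tau : bundle := iter (2 * r) rhoE E0.

Definition bundleR := pt -> dual -> R -> Prop.

Definition DeltaPhi (Phi : bundleR) : pt -> pt -> dual -> R -> Prop :=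
  fun a b zeta nu => X a /\ X b /\
    exists xi la eta mu, Phi a xi la /\ Phi b eta mu /\
      zeta = dadd xi eta /\ nu = la + mu /\
      forall al : midx, eucl (a - b) ^+ (p - mdegb al) * `|xi_at eta al b| <= 1.

Definition closure4 (S : pt -> pt -> dual -> R -> Prop) :
    pt -> pt -> dual -> R -> Prop :=
  fun a b zeta nu => forall e : R, 0 < e -> exists a' b' zeta' nu',
    S a' b' zeta' nu' /\ eucl (a - a') < e /\ eucl (b - b') < e /\
    dclose e zeta zeta' /\ `|nu - nu'| < e.

Definition primePhi (Phi : bundleR) : bundleR := fun a xi la =>
  X a /\ closure4 (DeltaPhi Phi) a a xi la.

Definition rhoPhi (Phi : bundleR) : bundleR := fun a xi la =>
  X a /\ dRspan (primePhi Phi a) xi la.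

Definition Phi0 (f : pt -> R) : bundleR := fun a xi la =>
  X a /\ exists c : R, xi = dscale c (delta a) /\ la = c * f a.

Definition nabla (f : pt -> R) : bundleR := iter (2 * r.+1) rhoPhi (Phi0 f).

Definition nabla_is_function (f : pt -> R) : Prop :=
  forall a xi, tau a xi -> exists! la : R, nabla f a xi la.

End Defs.

Section Cp.
Variables (R : realType) (n : nat).
Local Notation pt := 'rV[R]_n.

Definition evec (i : 'I_n) : pt := delta_mx 0 i.

Fixpoint dpartial (f : pt -> R) (s : seq 'I_n) : pt -> R :=
  match s with
  | [::] => f
  | i :: s' => fun x => derive (dpartial f s') x (evec i)
  end.

Definition Cp (p : nat) (U : set pt) (f : pt -> R) : Prop :=
  forall s : seq 'I_n, (size s <= p)%N ->
    (forall x, U x -> {for x, continuous (dpartial f s)}) /\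
    ((size s < p)%N -> forall (i : 'I_n) x, U x ->
        derivable (dpartial f s) x (evec i)).

Definition Cp_submanifold (p : nat) (U M : set pt) : Prop :=
  M `<=` U /\
  forall a, M a -> exists (V : set pt) (k : nat) (phi psi : pt -> pt),
    open V /\ V a /\ V `<=` U /\ open (phi @` V) /\
    (forall x, V x -> psi (phi x) = x) /\
    (forall j : 'I_n, Cp p V (fun x => phi x 0 j)) /\
    (forall j : 'I_n, Cp p (phi @` V) (fun y => psi y 0 j)) /\
    (forall x, V x -> (M x <-> forall j : 'I_n, (k <= j)%N -> phi x 0 j = 0)).

Definition closed_in (U M : set pt) : Prop :=
  forall x, U x -> closure M x -> M x.

Definition rel_interior (M A : set pt) : set pt := fun x =>
  A x /\ exists e : R, 0 < e /\ forall y, M y -> eucl (y - x) < e -> A y.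

Definition rel_closure (M A : set pt) : set pt := fun x =>
  M x /\ forall e : R, 0 < e -> exists y, A y /\ eucl (y - x) < e.
End Cp.

(* Main.v *)
(** Write a chart of [M] as [psi], from an open set of [R^n] in which [M] is
    the coordinate subspace [R^k].  For a point [y] of the chart and a word [s]
    of coordinate indices, the functional [P |-> D^s (P o psi) (y)] lies in the
    dual of the polynomials of degree at most [p].  At relative interior points
    of [X] each application of [rho] gains one order of differentiation in the
    [k] tangential directions, because [D^(i s)] is a limit of difference
    quotients of [D^s] and the weights |a - b|^(p - |alpha|) allow exactly this;
    one more application reaches all of [X] by density.  Single-valuedness of
    [nabla f] is only used in the form "(a, 0, lambda) in [nabla f] implies
    lambda = 0".  By homogeneity and compactness it supplies a value of
    [nabla f] on each of these functionals, and one further application of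
    [rho], applied to Taylor remainders between two points, says that these
    values form a Whitney field in the chart.  Whitney's extension theorem then
    gives local C^p extensions, which are glued by a rapidly convergent series. *)

Require Import Defs.
From HB Require Import structures.
From mathcomp Require Import all_boot all_order all_algebra.
From mathcomp Require Import mpoly.
From mathcomp Require Import all_classical all_reals all_analysis.
From mathcomp Require Import ring lra zify.
Import Order.TTheory GRing.Theory Num.Theory.
Import numFieldNormedType.Exports.
Local Open Scope classical_set_scope.
Local Open Scope ring_scope.
Set Implicit Arguments.
Unset Strict Implicit.
Unset Printing Implicit Defensive.

(** * Differential calculus with continuous partial derivatives *)

(** Iterated derivatives are indexed by words, not multi-indices: differentiating is consing a
    letter, so Leibniz and Taylor become structural recursions; the price is the symmetry condition
    [word_sym], paid by Schwarz's theorem. A chart controls only the tangential derivatives of [f];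
    words with a normal letter get the value 0, which keeps the field symmetric and lets Whitney's
    theorem be applied in all of R^n. The main difficulty is quantitative: a pair of functionals
    enters [DeltaPhi] only if its weights are at most 1. This is checked by measuring derivatives of
    order j with a factor d^j, d being the distance of the two points in the chart. The same scaled
    bounds serve Whitney's theorem, where d is the mesh of a grid; uniform dyadic grids replace
    Whitney's cubes, so that at every scale at most 4^n cells matter at a point. The iterations of
    [rho] add up to p at relative interior points, p + 1 on X and p + 2 for comparing two points;
    this fits into 2(r + 1) because r > p as soon as n > 0. *)

(** Multiplying the difference quotient by [t] admits [t = 0] and turns statements on derivatives
    into linear inequalities. *)
Lemma is_deriveE (R : realType) (V : normedModType R) (f : V -> R) (x v : V) (l : R) :
  is_derive x v f l <->
  forall e, 0 < e -> exists2 d, 0 < d &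
    forall t, `|t| < d -> `|f (x + t *: v) - f x - t * l| <= e * `|t|.
Proof.
split.
  case=> df fl e e0.
  have cv : (fun h : R => h^-1 *: ((f \o shift x) (h *: v) - f x)) @ 0^' --> l.
    by rewrite -fl; exact: df.
  move/cvgrPdist_lt: cv => /(_ e e0).
  rewrite near_withinE => /nbhs_ballP [d /= d0 H].
  exists d => // t td.
  have [->|t0] := eqVneq t 0.
    by rewrite scale0r addr0 mul0r !subrr normr0 mulr0.
  have := H t; rewrite /ball /= sub0r normrN => /(_ td t0) /ltW h.
  rewrite [x + _]addrC.
  have -> : f (t *: v + x) - f x - t * l =
      - (t * (l - t^-1 * (f (t *: v + x) - f x))).
    by rewrite mulrBr mulrA divff// mul1r; ring.
  by rewrite normrN normrM mulrC ler_wpM2r.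
move=> H.
have cv : (fun h : R => h^-1 *: ((f \o shift x) (h *: v) - f x)) @ 0^' --> l.
  apply/cvgrPdist_le => e e0; rewrite /=.
  have [d d0 Hd] := H e e0.
  rewrite near_withinE; apply/nbhs_ballP; exists d => //= t.
  rewrite /ball /= sub0r normrN => td t0.
  have := Hd t td; rewrite [x + _]addrC => h.
  have tp : 0 < `|t| by rewrite normr_gt0.
  rewrite distrC -(ler_pM2r tp) -normrM  mulrBl [_ *: _]mulrC -mulrA mulVf//.
  by rewrite mulr1 [l * t]mulrC.
apply: DeriveDef; first by apply/cvg_ex; exists l.
exact/cvg_lim.
Qed.

Lemma continuousE (R : realType) (V : normedModType R) (f : V -> R) (x : V) :
  {for x, continuous f} <->
  forall e, 0 < e -> exists2 d, 0 < d & forall y, `|y - x| < d -> `|f y - f x| < e.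
Proof.
split.
  move/cvgrPdist_lt => H e e0; have := H e e0 => /nbhs_ballP [d /= d0 {}H].
  exists d => // y yx; rewrite distrC; apply: H.
  by rewrite -ball_normE /= distrC.
move=> H; apply/cvgrPdist_lt => e e0; have [d d0 Hd] := H e e0.
apply/nbhs_ballP; exists d => //= y; rewrite -ball_normE /= => h.
by rewrite distrC; apply: Hd; rewrite distrC.
Qed.

Lemma is_derive_dirZ (R : realType) (V : normedModType R) (f : V -> R) (x v : V) (l h : R) :
  is_derive x v f l -> is_derive x (h *: v) f (h * l).
Proof.
move=> /is_deriveE H; apply/is_deriveE => e e0.
have hp : 0 < `|h| + 1 by rewrite ltr_wpDl.
have [d d0 Hd] := H (e / (`|h| + 1)) (divr_gt0 e0 hp).
exists (d / (`|h| + 1)); first exact: divr_gt0.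
move=> t td; rewrite scalerA mulrA.
apply: (le_trans (Hd (t * h) _)).
  rewrite normrM; rewrite ltr_pdivlMr// in td.
  apply: le_lt_trans td; rewrite ler_wpM2l// lerDl//.
rewrite normrM mulrAC ler_pdivrMr// -mulrA ler_wpM2l ?(ltW e0)//.
by rewrite ler_wpM2l// lerDl.
Qed.

(** Allowing a reference value [m] gives an approximate linearisation directly, without an auxiliary
    function [f - m t]. *)
Lemma line_mean_value (R : realType) (V : normedModType R) (f : V -> R) (g : R -> R)
    (x v : V) (m M : R) :
  (forall t : R, 0 <= t <= 1 -> is_derive (x + t *: v) v f (g t)) ->
  (forall t : R, 0 <= t <= 1 -> `|g t - m| <= M) -> `|f (x + v) - f x - m| <= M.
Proof.
move=> df gM.
pose u (t : R) := f (x + t *: v).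
have du (t : R) : 0 <= t <= 1 -> is_derive t (1 : R) u (g t).
  move=> /df/is_deriveE H; apply/is_deriveE => e e0; have [d d0 Hd] := H e e0.
  by exists d => // s /Hd; rewrite /u [s *: 1]mulr1 scalerDl addrA.
have [c c01 E] : exists2 c, c \in `]0, 1[%R & u 1 - u 0 = g c * (1 - 0).
  apply: MVT => //.
    by move=> t; rewrite in_itv /= => /andP[/ltW t0 /ltW t1]; apply: du; rewrite t0.
  apply: continuous_in_subspaceT => t; rewrite inE /= in_itv /= => t01.
  have [dt _] := du _ t01.
  by apply: differentiable_continuous; apply/derivable1_diffP.
rewrite /u scale1r scale0r addr0 subr0 mulr1 in E; rewrite E; apply: gM.
by move: c01; rewrite in_itv /= => /andP[/ltW -> /ltW ->].
Qed.

Section Calculus.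
Variables (R : realType) (n : nat).
Local Notation pt := 'rV[R]_n.
Implicit Types (f g : pt -> R) (x y z c : pt) (i j : 'I_n) (s t : seq 'I_n) (U V : set pt).

Lemma coord_le_norm x i : `|x 0 i| <= `|x|.
Proof.
rewrite [`|x|]mx_normrE.
exact: (le_bigmax _ (fun ij : 'I_1 * 'I_n => `|x ij.1 ij.2|) (0, i)).
Qed.

Lemma norm_le_coord x (e : R) : 0 <= e -> (forall i, `|x 0 i| <= e) -> `|x| <= e.
Proof.
move=> e0 H; rewrite [`|x|]mx_normrE; apply/bigmax_leP; split => //.
by move=> [i j] _ /=; rewrite ord1.
Qed.

Lemma norm_lt_coord x (e : R) : 0 < e -> (forall i, `|x 0 i| < e) -> `|x| < e.
Proof.
move=> e0 H; rewrite [`|x|]mx_normrE; apply/bigmax_ltP; split => //.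
by move=> [i j] _ /=; rewrite ord1.
Qed.

Lemma norm_evec i : `|evec R i| = 1.
Proof.
apply/eqP; rewrite eq_le; apply/andP; split.
  by apply: norm_le_coord => // j; rewrite mxE /=; case: (j == i); rewrite ?normr1 ?normr0.
by have := coord_le_norm (evec R i) i; rewrite mxE !eqxx normr1.
Qed.

(* Move from z to y one coordinate at a time: the intermediate points stay in
   the ball because the norm is the sup norm. *)
Lemma strict_diff f (g : 'I_n -> pt -> R) c (rho M : R) (m : 'I_n -> R) :
  (forall i x, `|x - c| < rho -> is_derive x (evec R i) f (g i x)) ->
  (forall i x, `|x - c| < rho -> `|g i x - m i| <= M) ->
  forall y z, `|y - c| < rho -> `|z - c| < rho ->
  `|f y - f z - \sum_i m i * (y 0 i - z 0 i)| <= M * \sum_i `|y 0 i - z 0 i|.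
Proof.
move=> df gM y z yc zc.
have rho0 : 0 < rho by apply: le_lt_trans yc.
pose w k : pt := \row_j (if (j < k)%N then y 0 j else z 0 j).
have wn : w n = y by apply/rowP => j; rewrite mxE ltn_ord.
have w0 : w 0%N = z by apply/rowP => j; rewrite mxE.
have -> : f y - f z = \sum_(i < n) (f (w i.+1) - f (w i)).
  rewrite -(big_mkord predT (fun k => f (w k.+1) - f (w k))).
  by rewrite (telescope_sumr (fun k => f (w k)))// wn w0.
rewrite -sumrB mulr_sumr; apply: le_trans (ler_norm_sum _ _ _) _.
apply: ler_sum => i _.
set h := y 0 i - z 0 i.
have -> : w i.+1 = w i + h *: evec R i.
  apply/rowP => j; rewrite !mxE eqxx /= /h ltnS.
  have [->|ji] := eqVneq j i; first by rewrite leqnn ltnn mulr1; ring.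
  by rewrite mulr0 addr0 ltn_neqAle ji.
have inb (t : R) : 0 <= t <= 1 -> `|w i + t *: (h *: evec R i) - c| < rho.
  move=> /andP[t0 t1]; apply: norm_lt_coord => // j; rewrite !mxE eqxx /=.
  have yj := le_lt_trans (coord_le_norm (y - c) j) yc.
  have zj := le_lt_trans (coord_le_norm (z - c) j) zc.
  rewrite !mxE in yj zj.
  have [ji|ji] := eqVneq j i; last by rewrite !mulr0 addr0; case: ifP.
  rewrite ji ltnn mulr1 /h; rewrite ji in yj zj.
  have -> : z 0 i + t * (y 0 i - z 0 i) - c 0 i =
    t * (y 0 i - c 0 i) + (1 - t) * (z 0 i - c 0 i) by ring.
  apply: le_lt_trans (ler_normD _ _) _; rewrite !normrM (ger0_norm t0).
  rewrite (ger0_norm (_ : 0 <= 1 - t)) ?subr_ge0//.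
  have : t * `|y 0 i - c 0 i| <= t * Num.max `|y 0 i - c 0 i| `|z 0 i - c 0 i|.
    by rewrite ler_wpM2l// le_max lexx.
  have : (1 - t) * `|z 0 i - c 0 i| <= (1 - t) * Num.max `|y 0 i - c 0 i| `|z 0 i - c 0 i|.
    by rewrite ler_wpM2l ?subr_ge0// le_max lexx orbT.
  have : Num.max `|y 0 i - c 0 i| `|z 0 i - c 0 i| < rho by rewrite gt_max yj zj.
  lra.
rewrite [M * _]mulrC [m i * _]mulrC.
apply: (line_mean_value (g := fun t : R => h * g i (w i + t *: (h *: evec R i)))).
  by move=> t t01; apply: is_derive_dirZ; apply: df; exact: inb.
move=> t t01; rewrite -mulrBr normrM ler_wpM2l//; apply: gM; exact: inb.
Qed.

End Calculus.

(** * Families of derivatives indexed by words, and the class C^p *)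

Section Jets.
Variables (R : realType) (n : nat).
Local Notation pt := 'rV[R]_n.
Implicit Types (f g : pt -> R) (x y z c : pt) (i j : 'I_n) (s t : seq 'I_n) (U V : set pt).

Lemma is_derive_translate f x (w v : pt) (l : R) :
  is_derive (x + w) v f l -> is_derive x v (fun y => f (y + w)) l.
Proof.
move=> /is_deriveE H; apply/is_deriveE => e /H [d d0 Hd]; exists d => // t /Hd.
by rewrite [x + w + _]addrAC.
Qed.

(** The mean value inequality is used twice: in direction [i] for the increment of [f] along [j],
    then in direction [j] for [fi]. *)
Lemma second_difference f (fi fji : pt -> R) i j x (h e : R) : 0 < h ->
  (forall y, `|y - x| <= h + h -> is_derive y (evec R i) f (fi y)) ->
  (forall y, `|y - x| <= h + h -> is_derive y (evec R j) fi (fji y)) ->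
  (forall y, `|y - x| <= h + h -> `|fji y - fji x| <= e) ->
  `|f (x + h *: evec R i + h *: evec R j) - f (x + h *: evec R i)
    - (f (x + h *: evec R j) - f x) - h * h * fji x| <= h * h * e.
Proof.
move=> h0 d1 d2 ce.
have nb (a b : R) k l : 0 <= a <= 1 -> 0 <= b <= 1 ->
    `|x + a *: (h *: evec R k) + b *: (h *: evec R l) - x| <= h + h.
  move=> /andP[a0 a1] /andP[b0 b1].
  rewrite -[x + _ + _]addrA addrAC subrr add0r; apply: le_trans (ler_normD _ _) _.
  rewrite !normrZ !norm_evec !mulr1 !ger0_norm ?(ltW h0)//.
  by rewrite lerD// ler_piMl// ltW.
pose F y := f (y + h *: evec R j) - f y.
have FE : f (x + h *: evec R i + h *: evec R j) - f (x + h *: evec R i)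
    - (f (x + h *: evec R j) - f x) - h * h * fji x =
    F (x + h *: evec R i) - F x - h * h * fji x by [].
rewrite FE; apply: (@line_mean_value R pt F
  (fun t : R => h * (fi (x + t *: (h *: evec R i) + h *: evec R j)
     - fi (x + t *: (h *: evec R i)))) x (h *: evec R i) (h * h * fji x) (h * h * e)).
  move=> t t01; apply: is_derive_dirZ; apply: is_deriveB.
    apply: is_derive_translate; apply: d1.
    by have := nb t 1 i j t01; rewrite scale1r; apply; rewrite ler01 lexx.
  apply: d1; have := nb t 0 i j t01; rewrite scale0r addr0; apply.
  by rewrite ler01 lexx.
move=> t t01; rewrite -[h * h * fji x]mulrA -mulrBr normrM (ger0_norm (ltW h0)).
rewrite -[h * h * e]mulrA ler_wpM2l ?(ltW h0)//.
apply: (@line_mean_value R pt fi (fun r : R =>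
   h * fji (x + t *: (h *: evec R i) + r *: (h *: evec R j)))
   (x + t *: (h *: evec R i)) (h *: evec R j) (h * fji x) (h * e)).
  by move=> r r01; apply: is_derive_dirZ; apply: d2; exact: nb.
move=> r r01; rewrite -mulrBr normrM (ger0_norm (ltW h0)).
by rewrite ler_wpM2l ?(ltW h0)//; apply: ce; exact: nb.
Qed.

(** The second difference is symmetric in [i] and [j], so both mixed derivatives approximate the
    same number divided by [h * h]. *)
Lemma schwarz f (fi fj fji fij : pt -> R) i j U x : open U -> U x ->
  (forall y, U y -> is_derive y (evec R i) f (fi y)) ->
  (forall y, U y -> is_derive y (evec R j) f (fj y)) ->
  (forall y, U y -> is_derive y (evec R j) fi (fji y)) ->
  (forall y, U y -> is_derive y (evec R i) fj (fij y)) ->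
  {for x, continuous fji} -> {for x, continuous fij} -> fji x = fij x.
Proof.
move=> oU Ux di dj dji dij /continuousE cji /continuousE cij.
apply/eqP; rewrite -subr_eq0 -normr_le0; apply/ler_addgt0Pr => e e0; rewrite add0r.
have e2 : 0 < e / 2 by lra.
have [a a0 Ha] := cji _ e2; have [b b0 Hb] := cij _ e2.
have /nbhs_ballP [d /= d0 Hd] := open_nbhs_nbhs (conj oU Ux).
pose h := Num.min a (Num.min b d) / 3.
have mp : 0 < Num.min a (Num.min b d) by rewrite !lt_min a0 b0 d0.
have h0 : 0 < h by rewrite divr_gt0.
have H y : `|y - x| <= h + h -> [/\ U y, `|fji y - fji x| <= e/2 & `|fij y - fij x| <= e/2].
  move=> yx.
  have : `|y - x| < Num.min a (Num.min b d).
    by apply: le_lt_trans yx _; rewrite /h; lra.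
  rewrite !lt_min => /and3P[ya yb yd]; split; [|exact: ltW (Ha _ ya)|exact: ltW (Hb _ yb)].
  by apply: Hd; rewrite -ball_normE /= distrC.
have := @second_difference f fi fji i j x h (e / 2) h0
  (fun y k => di y (let: And3 u _ _ := H y k in u))
  (fun y k => dji y (let: And3 u _ _ := H y k in u))
  (fun y k => let: And3 _ u _ := H y k in u).
have := @second_difference f fj fij j i x h (e / 2) h0
  (fun y k => dj y (let: And3 u _ _ := H y k in u))
  (fun y k => dij y (let: And3 u _ _ := H y k in u))
  (fun y k => let: And3 _ _ u := H y k in u).
rewrite [x + h *: evec R j + _]addrAC.
set A := f _; set B := f _; set C := f _; set D := f _ => H1 H2.
have hh : 0 < h * h by rewrite mulr_gt0.
rewrite -(ler_pM2l hh) -{1}(ger0_norm (ltW hh)) -normrM.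
have -> : h * h * (fji x - fij x) = (A - B - (C - D) - h * h * fij x) -
   (A - C - (B - D) - h * h * fji x) by ring.
by apply: le_trans (ler_normB _ _) _; lra.
Qed.

(* [G s] plays the role of the iterated derivative along the word [s], whose
   head is the last direction differentiated. *)
Definition jet p U (G : seq 'I_n -> pt -> R) :=
  forall s, (size s <= p)%N ->
    (forall x, U x -> {for x, continuous (G s)}) /\
    ((size s < p)%N -> forall i x, U x -> is_derive x (evec R i) (G s) (G (i :: s) x)).

Lemma dpartial_eq_on f g U s : open U -> (forall x, U x -> f x = g x) ->
  forall x, U x -> dpartial f s x = dpartial g s x.
Proof.
move=> oU fg; elim: s => [|i s IH] //= x Ux.
apply: near_eq_derive; near=> y; apply: IH; near: y.
exact: (open_nbhs_nbhs (conj oU Ux)).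
Unshelve. all: by end_near. Qed.

Lemma dpartial_cat f s t : dpartial f (s ++ t) = dpartial (dpartial f t) s.
Proof. by elim: s => //= i s ->. Qed.

Lemma dpartial_rcons f s i : dpartial f (rcons s i) = dpartial (dpartial f [:: i]) s.
Proof. by rewrite -cats1 dpartial_cat. Qed.

Lemma continuous_eq_on f g U x : open U -> U x -> (forall y, U y -> f y = g y) ->
  {for x, continuous f} -> {for x, continuous g}.
Proof.
move=> oU Ux fg cf.
have nU : \near x, U x := open_nbhs_nbhs (conj oU Ux).
rewrite /prop_for /continuous_at -(fg _ Ux).
apply: cvg_trans cf; apply: (@near_eq_cvg _ _ (nbhs x) (nbhs_filter x)).
by apply: filterS nU => y Uy; rewrite fg.
Qed.

Lemma is_derive_eq_on f g U x (v : pt) (l : R) : open U -> U x ->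
  (forall y, U y -> f y = g y) -> is_derive x v f l -> is_derive x v g l.
Proof.
move=> oU Ux fg; apply: near_eq_is_derive.
near=> y; apply: fg; near: y.
exact: (open_nbhs_nbhs (conj oU Ux)).
Unshelve. all: by end_near. Qed.

(** This makes candidates sufficient: to compute derivatives of a function, it is enough to guess a
    family [G] and verify one differentiation step. *)
Lemma jet_dpartial p U G s : open U -> jet p U G -> (size s <= p)%N ->
  forall x, U x -> dpartial (G [::]) s x = G s x.
Proof.
move=> oU jG; elim: s => [|i s IH] //= sp x Ux.
have [_ /(_ sp i x Ux)] := jG s (ltnW sp).
move/(@is_derive_eq_on _ (dpartial (G [::]) s) U) => /(_ oU Ux).
by case=> [y Uy|_ <-//]; rewrite IH// ltnW.
Qed.

Lemma Cp_jet p U f : Cp p U f -> jet p U (dpartial f).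
Proof.
move=> H s sp; have [H1 H2] := H s sp; split => // sp' i x Ux.
by apply: DeriveDef => //; apply: H2.
Qed.

Lemma jet_Cp p U G f : open U -> jet p U G -> (forall x, U x -> f x = G [::] x) -> Cp p U f.
Proof.
move=> oU jG fG s sp.
have E x : U x -> G s x = dpartial f s x.
  move=> Ux; rewrite -(jet_dpartial oU jG)//; symmetry.
  exact: (dpartial_eq_on _ oU fG Ux).
have [H1 H2] := jG s sp; split => [x Ux|sp' i x Ux].
  exact: (continuous_eq_on oU Ux E (H1 x Ux)).
by have [] := is_derive_eq_on oU Ux E (H2 sp' i x Ux).
Qed.

Lemma Cp_eq p U f g : open U -> (forall x, U x -> f x = g x) -> Cp p U f -> Cp p U g.
Proof.
move=> oU fg /Cp_jet cf; apply: (jet_Cp oU cf) => x Ux; rewrite -fg //.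
Qed.

Lemma Cp_sub p q U V f : (q <= p)%N -> V `<=` U -> Cp p U f -> Cp q V f.
Proof.
move=> qp VU cf s sq; have [H1 H2] := cf s (leq_trans sq qp).
split=> [x /VU/H1//|sq' i x /VU]; apply: H2; exact: leq_trans qp.
Qed.

Lemma Cp_local p U f : open U ->
  (forall x, U x -> exists2 V, open V /\ V x & Cp p V f) -> Cp p U f.
Proof.
move=> oU H s sp; split=> [x Ux|sp' i x Ux].
  by have [V [oV Vx] /(_ s sp) []] := H x Ux => + _; apply.
by have [V [oV Vx] /(_ s sp) []] := H x Ux => _; apply.
Qed.

Lemma Cp_continuous p U f x : Cp p U f -> U x -> {for x, continuous f}.
Proof. by move=> /(_ [::] isT) [+ _]; apply. Qed.

(** The recursion peels off the direction differentiated first, which is the last letter of a word;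
    hence [rcons] and [lastP]. Continuity of [f] is listed separately because partial derivatives
    alone do not give it. *)
Lemma Cp_succ p U f : open U ->
  Cp p.+1 U f <->
  (forall x, U x -> {for x, continuous f}) /\
  forall i, exists g, (forall x, U x -> is_derive x (evec R i) f (g x)) /\ Cp p U g.
Proof.
move=> oU; split.
  move=> cf; split=> [x Ux|i]; first exact: (Cp_continuous cf Ux).
  exists (dpartial f [:: i]); split.
    by move=> x Ux; have [_] := Cp_jet cf (s := [::]) isT; apply.
  move=> s sp; rewrite -dpartial_rcons.
  have [|H1 H2] := cf (rcons s i); first by rewrite size_rcons.
  by split=> // sp' j x Ux; apply: H2; rewrite ?size_rcons.
move=> [cf H] s; case: (lastP s) => [_|{}s i].
  split=> // _ i x Ux; have [g [/(_ x Ux) [? _] _]] := H i; done.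
rewrite size_rcons ltnS => sp; rewrite dpartial_rcons.
have [g [dg cg]] := H i.
have {}cg : Cp p U (dpartial f [:: i]).
  by apply: Cp_eq cg => // x Ux /=; have [_ ->] := dg x Ux.
by have [H1 H2] := cg s sp.
Qed.

Lemma Cp0 U f : Cp 0 U f <-> forall x, U x -> {for x, continuous f}.
Proof. by split=> [cf x|cf [|//]]; [exact: (Cp_continuous cf)|by move=> _; split]. Qed.

Lemma Cp_cst p U (a : R) : open U -> Cp p U (fun=> a).
Proof.
elim: p a => [|p IH] a oU; first by apply/Cp0 => x _; exact: cst_continuous.
apply/Cp_succ => //; split => [x _|i]; first exact: cst_continuous.
exists (fun=> 0); split; last exact: IH.
by move=> x _; exact: is_derive_cst.
Qed.

Lemma is_derive_coord x i j : is_derive x (evec R i) (fun y : pt => y 0 j) ((j == i)%:R).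
Proof.
apply/is_deriveE => e e0; exists 1 => // t _.
by rewrite !mxE eqxx /= [x 0 j + _]addrC addrK subrr normr0 mulr_ge0 // ltW.
Qed.

Lemma Cp_coord p U j : open U -> Cp p U (fun x => x 0 j).
Proof.
move=> oU; case: p => [|p]; first by apply/Cp0 => x _; exact: coord_continuous.
apply/Cp_succ => //; split=> [x _|i]; first exact: coord_continuous.
exists (fun=> (j == i)%:R); split; last exact: Cp_cst.
by move=> x _; exact: is_derive_coord.
Qed.

Lemma Cp_add p U f g : open U -> Cp p U f -> Cp p U g -> Cp p U (fun x => f x + g x).
Proof.
move=> oU; elim: p f g => [|p IH] f g.
  by move=> /Cp0 cf /Cp0 cg; apply/Cp0 => x Ux; exact: (cvgD (cf x Ux) (cg x Ux)).
move=> /Cp_succ [//|cf Hf] /Cp_succ [//|cg Hg]; apply/Cp_succ => //.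
split=> [x Ux|i]; first exact: (cvgD (cf x Ux) (cg x Ux)).
have [f' [df cf']] := Hf i; have [g' [dg cg']] := Hg i.
exists (fun x => f' x + g' x); split; last exact: IH.
by move=> x Ux; apply: is_deriveD; [exact: df|exact: dg].
Qed.

Lemma Cp_mul p U f g : open U -> Cp p U f -> Cp p U g -> Cp p U (fun x => f x * g x).
Proof.
move=> oU; elim: p f g => [|p IH] f g cf0 cg0.
  move: cf0 cg0 => /Cp0 cf /Cp0 cg.
  by apply/Cp0 => x Ux; exact: (cvgM (cf x Ux) (cg x Ux)).
move: (cf0) (cg0) => /Cp_succ [//|cf Hf] /Cp_succ [//|cg Hg]; apply/Cp_succ => //.
split=> [x Ux|i]; first exact: (cvgM (cf x Ux) (cg x Ux)).
have [f' [df cf']] := Hf i; have [g' [dg cg']] := Hg i.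
exists (fun x => f x * g' x + g x * f' x); split.
  by move=> x Ux; apply: is_deriveM; [exact: df|exact: dg].
have cf1 := Cp_sub (leqnSn p) (@subset_refl _ U) cf0.
have cg1 := Cp_sub (leqnSn p) (@subset_refl _ U) cg0.
exact: (@Cp_add p U (fun x => f x * g' x) (fun x => g x * f' x) oU (IH f g' cf1 cg') (IH g f' cg1 cf')).
Qed.

Lemma Cp_scale p U (a : R) f : open U -> Cp p U f -> Cp p U (fun x => a * f x).
Proof. by move=> oU cf; apply: Cp_mul => //; exact: Cp_cst. Qed.

Lemma Cp_sub_fun p U f g : open U -> Cp p U f -> Cp p U g -> Cp p U (fun x => f x - g x).
Proof.
move=> oU cf cg; rewrite (_ : (fun x => f x - g x) = fun x => f x + (- 1) * g x).
  exact: (@Cp_add p U f (fun x => (- 1) * g x) oU cf (Cp_scale (- 1) oU cg)).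
by apply/funext => x; rewrite mulN1r.
Qed.

Lemma Cp_sum p U (I : Type) (r : seq I) (P : pred I) (F : I -> pt -> R) : open U ->
  (forall k, P k -> Cp p U (F k)) -> Cp p U (fun x => \sum_(k <- r | P k) F k x).
Proof.
move=> oU cF; elim: r => [|k r IH].
  by under eq_fun do rewrite big_nil; exact: Cp_cst.
under eq_fun do rewrite big_cons; case Pk : (P k) => //.
by apply: Cp_add => //; exact: cF.
Qed.

Lemma Cp_prod p U (I : Type) (r : seq I) (P : pred I) (F : I -> pt -> R) : open U ->
  (forall k, P k -> Cp p U (F k)) -> Cp p U (fun x => \prod_(k <- r | P k) F k x).
Proof.
move=> oU cF; elim: r => [|k r IH].
  by under eq_fun do rewrite big_nil; exact: Cp_cst.
under eq_fun do rewrite big_cons; case Pk : (P k) => //.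
by apply: Cp_mul => //; exact: cF.
Qed.

Lemma Cp_exp p U f k : open U -> Cp p U f -> Cp p U (fun x => f x ^+ k).
Proof.
move=> oU cf; elim: k => [|k IH]; first by under eq_fun do rewrite expr0; exact: Cp_cst.
by under eq_fun do rewrite exprS; exact: Cp_mul.
Qed.

Lemma Cp_inv p U f : open U -> (forall x, U x -> f x != 0) ->
  Cp p U f -> Cp p U (fun x => (f x)^-1).
Proof.
move=> oU f0; elim: p => [|p IH] cf0.
  by move: cf0 => /Cp0 cf; apply/Cp0 => x Ux; exact: (cvgV (f0 x Ux) (cf x Ux)).
move: (cf0) => /Cp_succ [//|cf Hf]; apply/Cp_succ => //.
split=> [x Ux|i]; first by exact: (cvgV (f0 x Ux) (cf x Ux)).
have [f' [df cf']] := Hf i.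
exists (fun x => - 1 * ((f x)^-1 * (f x)^-1) * f' x); split.
  move=> x Ux; have [dfx <-] := df x Ux.
  apply: DeriveDef; first by apply: derivableV => //; exact: f0.
  by rewrite deriveV ?f0// mulN1r -invfM -expr2.
have cV : Cp p U (fun x => (f x)^-1) by apply: IH; apply: (Cp_sub (leqnSn p) (@subset_refl _ U)).
exact: (@Cp_mul p U (fun x => - 1 * ((f x)^-1 * (f x)^-1)) f' oU
  (@Cp_scale p U (- 1) (fun x => (f x)^-1 * (f x)^-1) oU
    (@Cp_mul p U (fun x => (f x)^-1) (fun x => (f x)^-1) oU cV cV)) cf').
Qed.

End Jets.

(** Besides radii, [d] will often be the reciprocal of a bound: with [P i d] of the form
    [u * d <= 1], the lemma yields one bound for finitely many quantities. *)
Lemma common_radius (R : realType) (I : finType) (P : I -> R -> Prop) :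
  (forall i d d', P i d -> d' <= d -> P i d') ->
  (forall i, exists2 d, 0 < d & P i d) -> exists2 d, 0 < d & forall i, P i d.
Proof.
move=> mono H.
have /choice [d Hd] : forall i, exists d, 0 < d /\ P i d.
  by move=> i; have [d ? ?] := H i; exists d.
exists (\big[Num.min/1]_i d i).
  by apply/bigmin_gtP; split=> // i _; have [] := Hd i.
by move=> i; have [_ /mono] := Hd i; apply; exact: bigmin_le.
Qed.

(** * Chain rule and Leibniz rule *)

Section Calculus3.
Variables (R : realType) (n : nat).
Local Notation pt := 'rV[R]_n.
Implicit Types (f g : pt -> R) (x y z c : pt) (i j : 'I_n) (s t : seq 'I_n) (U V : set pt).

Lemma coordwise_continuousE (phi : pt -> pt) x :
  (forall j, {for x, continuous (fun y => phi y 0 j)}) ->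
  forall e : R, 0 < e -> exists2 d, 0 < d & forall y, `|y - x| < d -> `|phi y - phi x| < e.
Proof.
move=> H e e0.
have [|i|d d0 Hd] := @common_radius R 'I_n (fun j d => forall y, `|y - x| < d -> `|phi y 0 j - phi x 0 j| < e).
- by move=> i d d' Hd dd' y yx; apply: Hd; exact: lt_le_trans yx dd'.
- have /continuousE := H i; exact.
exists d => // y yx; apply: norm_lt_coord => // j; rewrite !mxE; exact: Hd.
Qed.

Lemma is_derive_comp f (g : 'I_n -> pt -> R) (phi : pt -> pt) (l : 'I_n -> R) W x (v : pt) :
  open W -> W (phi x) ->
  (forall j y, W y -> is_derive y (evec R j) f (g j y)) ->
  (forall j, {for phi x, continuous (g j)}) ->
  (forall j, is_derive x v (fun y => phi y 0 j) (l j)) ->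
  is_derive x v (f \o phi) (\sum_j g j (phi x) * l j).
Proof.
move=> oW Wx df cg dphi; apply/is_deriveE => e e0.
set c := phi x.
pose L := \sum_j (`|l j| + 1); pose G := \sum_j `|g j c|.
have L0 : 0 <= L by apply: sumr_ge0 => j _; rewrite addr_ge0.
have G0 : 0 <= G by apply: sumr_ge0.
(* [e1] is the error of linearising [f], multiplied by the total increment of [phi], at most
   [L * |t|]; [e2] is the error of linearising [phi], multiplied by the gradient sum [G]. Each
   contributes at most [e / 2], and [e2 <= 1] is what gives the increment bound [L]. *)
pose e1 := e / (2 * (L + 1)); pose e2 := Num.min 1 (e / (2 * (G + 1))).
have e10 : 0 < e1 by rewrite divr_gt0//; lra.
have e20 : 0 < e2 by rewrite lt_min ltr01 divr_gt0//; lra.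
have e21 : e2 <= 1 by rewrite ge_min lexx.
have e1L : e1 * L <= e / 2.
  rewrite /e1 mulrAC ler_pdivrMr; last lra.
  have -> : e / 2 * (2 * (L + 1)) = e * (L + 1) by field.
  by rewrite ler_wpM2l//; lra.
have e2G : e2 * G <= e / 2.
  apply: (@le_trans _ _ (e / (2 * (G + 1)) * G)).
    by rewrite ler_wpM2r// ge_min lexx orbT.
  rewrite mulrAC ler_pdivrMr; last lra.
  have -> : e / 2 * (2 * (G + 1)) = e * (G + 1) by field.
  by rewrite ler_wpM2l//; lra.
have /nbhs_ballP [r1 /= r10 Hr1] := open_nbhs_nbhs (conj oW Wx).
have [|j|r2 r20 Hr2] := @common_radius R 'I_n
   (fun j d => forall y, `|y - c| < d -> `|g j y - g j c| < e1).
- by move=> i d d' Hd dd' y yx; apply: Hd; exact: lt_le_trans yx dd'.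
- have /continuousE := cg j; exact.
pose r := Num.min r1 r2.
have r0 : 0 < r by rewrite lt_min r10 r20.
have [|j|d d0 Hd] := @common_radius R 'I_n
   (fun j d => (forall t : R, `|t| < d -> `|phi (x + t *: v) 0 j - phi x 0 j - t * l j| <= e2 * `|t|)
     /\ (`|l j| + 1) * d <= r).
- move=> i d d' [Hd1 Hd2] dd'; split.
    by move=> t td; apply: Hd1; exact: lt_le_trans td dd'.
  by apply: le_trans Hd2; rewrite ler_wpM2l// addr_ge0.
- have /is_deriveE /(_ _ e20) [d d0 Hd] := dphi j.
  have lp : 0 < `|l j| + 1 by rewrite ltr_wpDl.
  exists (Num.min d (r / (`|l j| + 1))); first by rewrite lt_min d0 divr_gt0.
  split; first by move=> t; rewrite lt_min => /andP[td _]; exact: Hd.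
  by rewrite mulrC -ler_pdivlMr// ge_min lexx orbT.
exists d => // t td.
have inc j : `|phi (x + t *: v) 0 j - c 0 j| <= (`|l j| + 1) * `|t|.
  have [/(_ _ td) H _] := Hd j.
  have -> : phi (x + t *: v) 0 j - c 0 j =
    (phi (x + t *: v) 0 j - phi x 0 j - t * l j) + t * l j by rewrite /c subrK.
  apply: le_trans (ler_normD _ _) _; rewrite mulrDl mul1r addrC normrM.
  rewrite [`|t| * _]mulrC lerD2l; apply: le_trans H _.
  by rewrite ler_piMl.
have inb : `|phi (x + t *: v) - c| < r.
  apply: norm_lt_coord => // j; rewrite !mxE.
  apply: le_lt_trans (inc j) _; have [_ H] := Hd j.
  apply: lt_le_trans H; rewrite ltr_pM2l// ltr_wpDl//.
have rr1 : r <= r1 by rewrite ge_min lexx.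
have rr2 : r <= r2 by rewrite ge_min lexx orbT.
have SD : `|f (phi (x + t *: v)) - f c - \sum_j g j c * (phi (x + t *: v) 0 j - c 0 j)|
    <= e1 * \sum_j `|phi (x + t *: v) 0 j - c 0 j|.
  apply: (@strict_diff R n f g c r e1 (fun j => g j c)) => //.
  - move=> j y yc; apply: df; apply: Hr1; rewrite -ball_normE /= distrC; exact: lt_le_trans yc rr1.
  - move=> j y yc; apply: ltW; apply: Hr2; exact: lt_le_trans yc rr2.
  - by rewrite subrr normr0.
rewrite /comp.
set y := phi (x + t *: v) in inc inb SD *.
have -> : f y - f (phi x) - t * (\sum_j g j (phi x) * l j) =
   (f y - f c - \sum_j g j c * (y 0 j - c 0 j)) +
   \sum_j g j c * (y 0 j - c 0 j - t * l j).
  have -> : \sum_j g j c * (y 0 j - c 0 j - t * l j) =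
     \sum_j g j c * (y 0 j - c 0 j) - t * \sum_j g j c * l j.
    by rewrite mulr_sumr -sumrB; apply: eq_bigr => j _; ring.
  by rewrite /c; ring.
apply: le_trans (ler_normD _ _) _.
have B1 : \sum_j `|y 0 j - c 0 j| <= L * `|t|.
  by rewrite mulr_suml; apply: ler_sum => j _; exact: inc.
have B2 : `|\sum_j g j c * (y 0 j - c 0 j - t * l j)| <= G * (e2 * `|t|).
  rewrite mulr_suml; apply: le_trans (ler_norm_sum _ _ _) _.
  apply: ler_sum => j _; rewrite normrM ler_wpM2l//.
  by have [/(_ _ td) H _] := Hd j.
have -> : e * `|t| = e / 2 * `|t| + e / 2 * `|t| by field.
apply: lerD.
  apply: le_trans SD _; apply: le_trans (_ : e1 * (L * `|t|) <= _).
    by rewrite ler_wpM2l// ltW.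
  by rewrite mulrA ler_wpM2r.
apply: le_trans B2 _; rewrite mulrA [G * _]mulrC; exact: ler_wpM2r.
Qed.

Lemma Cp_comp p U W (phi : pt -> pt) f : open U -> open W ->
  (forall x, U x -> W (phi x)) -> (forall j, Cp p U (fun x => phi x 0 j)) ->
  Cp p W f -> Cp p U (f \o phi).
Proof.
move=> oU oW UW; elim: p f => [|p IH] f cphi cf0.
  apply/Cp0 => x Ux; apply/continuousE => e e0.
  have /continuousE /(_ e e0) [d d0 Hd] := Cp_continuous cf0 (UW _ Ux).
  have [d1 d10 Hd1] := coordwise_continuousE (fun j => Cp_continuous (cphi j) Ux) d0.
  by exists d1 => // y /Hd1; exact: Hd.
move: (cf0) => /Cp_succ [//|cf Hf]; apply/Cp_succ => //; split=> [x Ux|i].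
  apply/continuousE => e e0.
  have /continuousE /(_ e e0) [d d0 Hd] := Cp_continuous cf0 (UW _ Ux).
  have [d1 d10 Hd1] := coordwise_continuousE (fun j => Cp_continuous (cphi j) Ux) d0.
  by exists d1 => // y /Hd1; exact: Hd.
have /choice [g Hg] := Hf.
have dphi j : exists l, (forall x, U x -> is_derive x (evec R i) (fun y => phi y 0 j) (l x)) /\ Cp p U l.
  by have /Cp_succ [//|_ /(_ i)] := cphi j.
have /choice [l Hl] := dphi.
exists (fun x => \sum_j g j (phi x) * l j x); split.
  move=> x Ux; apply: (is_derive_comp (W := W)) => //.
  - exact: UW.
  - by move=> j y Wy; have [H _] := Hg j; exact: H.
  - by move=> j; have [_ H] := Hg j; apply: (Cp_continuous H); exact: UW.
  - by move=> j; have [H _] := Hl j; exact: H.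
apply: Cp_sum => // j _; apply: Cp_mul => //; last by have [] := Hl j.
apply: IH; last by have [] := Hg j.
move=> k; exact: (Cp_sub (leqnSn p) (@subset_refl _ U)).
Qed.

Lemma is_derive_sum_seq (I : eqType) (r : seq I) (F : I -> pt -> R) (dF : I -> R) x (v : pt) :
  {in r, forall k, is_derive x v (F k) (dF k)} ->
  is_derive x v (fun y => \sum_(k <- r) F k y) (\sum_(k <- r) dF k).
Proof.
elim: r => [|k r IH] H.
  under eq_fun do rewrite big_nil; rewrite big_nil; exact: is_derive_cst.
under eq_fun do rewrite big_cons; rewrite big_cons; apply: is_deriveD.
  by apply: H; rewrite mem_head.
by apply: IH => k' k'r; apply: H; rewrite in_cons k'r orbT.
Qed.

Lemma continuous_sum_seq (I : eqType) (r : seq I) (F : I -> pt -> R) x :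
  {in r, forall k, {for x, continuous (F k)}} ->
  {for x, continuous (fun y => \sum_(k <- r) F k y)}.
Proof.
elim: r => [|k r IH] H.
  have -> : (fun y => \sum_(k <- [::]) F k y) = cst 0 by apply/funext => y; rewrite big_nil.
  exact: cst_continuous.
have -> : (fun y => \sum_(k <- k :: r) F k y) = (fun y => F k y + \sum_(k <- r) F k y).
  by apply/funext => y; rewrite big_cons.
have H1 := H k (mem_head _ _).
have H2 : {for x, continuous (fun y => \sum_(k <- r) F k y)}.
  by apply: IH => k' k'r; apply: H; rewrite in_cons k'r orbT.
exact: (cvgD H1 H2).
Qed.

(* Leibniz' rule over words: [splits s] lists the 2^|s| ways of distributing
   the letters of [s] over two factors. *)
Fixpoint splits (s : seq 'I_n) : seq (seq 'I_n * seq 'I_n) :=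
  if s is i :: s' then
    [seq (i :: uv.1, uv.2) | uv <- splits s'] ++ [seq (uv.1, i :: uv.2) | uv <- splits s']
  else [:: ([::], [::])].

Lemma size_splits s : size (splits s) = (2 ^ size s)%N.
Proof. by elim: s => //= i s IH; rewrite size_cat !size_map IH expnS mul2n addnn. Qed.

Lemma mem_splits s uv : uv \in splits s -> (size uv.1 + size uv.2 = size s)%N.
Proof.
elim: s uv => [|i s IH] uv /=; first by rewrite inE => /eqP ->.
rewrite mem_cat => /orP[] /mapP [uv' /IH <- ->] //=.
by rewrite addnS.
Qed.

Definition mulj (G H : seq 'I_n -> pt -> R) s x : R :=
  \sum_(uv <- splits s) G uv.1 x * H uv.2 x.

Lemma jet_mul p U (G H : seq 'I_n -> pt -> R) : jet p U G -> jet p U H -> jet p U (mulj G H).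
Proof.
move=> jG jH s sp.
have szle uv : uv \in splits s -> (size uv.1 <= size s)%N /\ (size uv.2 <= size s)%N.
  by move=> /mem_splits <-; rewrite leq_addr leq_addl.
split=> [x Ux|sp' i x Ux].
  apply: continuous_sum_seq => uv /szle [u1 u2].
  have [/(_ x Ux) c1 _] := jG _ (leq_trans u1 sp).
  have [/(_ x Ux) c2 _] := jH _ (leq_trans u2 sp).
  exact: (cvgM c1 c2).
rewrite /mulj /= big_cat /= !big_map -big_split /=.
apply: is_derive_sum_seq => uv /szle [u1 u2].
have [_ /(_ (leq_ltn_trans u1 sp') i x Ux) c1] := jG _ (leq_trans u1 sp).
have [_ /(_ (leq_ltn_trans u2 sp') i x Ux) c2] := jH _ (leq_trans u2 sp).
have -> : G (i :: uv.1) x * H uv.2 x + G uv.1 x * H (i :: uv.2) x =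
  G uv.1 x * H (i :: uv.2) x + H uv.2 x * G (i :: uv.1) x by ring.
exact: is_deriveM.
Qed.

Lemma dpartial_mul p U f g s x : open U -> U x -> Cp p U f -> Cp p U g -> (size s <= p)%N ->
  dpartial (fun y => f y * g y) s x = mulj (dpartial f) (dpartial g) s x.
Proof.
move=> oU Ux /Cp_jet cf /Cp_jet cg sp.
rewrite -(jet_dpartial oU (jet_mul cf cg) sp Ux); congr (dpartial _ s x).
by apply/funext => y; rewrite /mulj /= big_seq1.
Qed.

Lemma jet_sum p U (I : eqType) (r : seq I) (c : I -> R) (G : I -> seq 'I_n -> pt -> R) :
  {in r, forall k, jet p U (G k)} -> jet p U (fun s x => \sum_(k <- r) c k * G k s x).
Proof.
move=> H s sp; split=> [x Ux|sp' i x Ux].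
  apply: continuous_sum_seq => k kr; have [/(_ x Ux) h _] := H k kr s sp.
  exact: (cvgM (@cst_continuous _ _ (c k) x) h).
apply: is_derive_sum_seq => k kr; have [_ /(_ sp' i x Ux) h] := H k kr s sp.
by apply: is_deriveZ.
Qed.

Lemma dpartial_sum p U (I : eqType) (r : seq I) (c : I -> R) (F : I -> pt -> R) s x :
  open U -> U x -> {in r, forall k, Cp p U (F k)} -> (size s <= p)%N ->
  dpartial (fun y => \sum_(k <- r) c k * F k y) s x = \sum_(k <- r) c k * dpartial (F k) s x.
Proof.
move=> oU Ux cF sp.
have jF : jet p U (fun s x => \sum_(k <- r) c k * dpartial (F k) s x).
  by apply: jet_sum => k kr; apply: Cp_jet; exact: cF.
exact: (jet_dpartial oU jF sp Ux).
Qed.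

Lemma dpartial_add p U f g s x : open U -> U x -> Cp p U f -> Cp p U g -> (size s <= p)%N ->
  dpartial (fun y => f y + g y) s x = dpartial f s x + dpartial g s x.
Proof.
move=> oU Ux cf cg sp.
have -> : (fun y => f y + g y) = (fun y => \sum_(b <- [:: true; false]) 1 * (if b then f else g) y).
  by apply/funext => y; rewrite !big_cons big_nil !mul1r addr0.
rewrite (dpartial_sum (p := p) (U := U) _ (F := fun b => if b then f else g))//; last by case.
by rewrite !big_cons big_nil !mul1r addr0.
Qed.

Lemma dpartial_scale p U f (c : R) s x : open U -> U x -> Cp p U f -> (size s <= p)%N ->
  dpartial (fun y => c * f y) s x = c * dpartial f s x.
Proof.
move=> oU Ux cf sp.
have -> : (fun y => c * f y) = (fun y => \sum_(b <- [:: tt]) c * f y).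
  by apply/funext => y; rewrite big_seq1.
by rewrite (dpartial_sum (p := p) (U := U) (fun=> c) (F := fun=> f))// big_seq1.
Qed.

Lemma dpartial_sub p U f g s x : open U -> U x -> Cp p U f -> Cp p U g -> (size s <= p)%N ->
  dpartial (fun y => f y - g y) s x = dpartial f s x - dpartial g s x.
Proof.
move=> oU Ux cf cg sp.
have := dpartial_add oU Ux cf (Cp_scale (-1) oU cg) sp.
rewrite (dpartial_scale _ oU Ux cg sp) mulN1r => <-; congr (dpartial _ s x).
by apply/funext => y; rewrite mulN1r.
Qed.

End Calculus3.

(** There are finitely many words of length at most [p]; the induction splits off the first letter,
    so no finite type of words has to be built. *)
Lemma common_word_radius (R : realType) (n p : nat) (P : seq 'I_n -> R -> Prop) :
  (forall s d d', P s d -> d' <= d -> P s d') ->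
  (forall s, (size s <= p)%N -> exists2 d, 0 < d & P s d) ->
  exists2 d, 0 < d & forall s, (size s <= p)%N -> P s d.
Proof.
elim: p P => [|p IH] P mono H.
  by have [d d0 Pd] := H [::] isT; exists d => // -[].
have [i|i|d d0 Hd] := @common_radius R 'I_n
  (fun i d => forall s, (size s <= p)%N -> P (i :: s) d).
- by move=> d d' Pd d'd s sp; exact: mono (Pd s sp) d'd.
- by apply: IH => [s d d'|s sp]; [exact: mono|exact: H].
have [e e0 Pe] := H [::] isT.
exists (Num.min d e); first by rewrite lt_min d0 e0.
move=> [_|i s sp]; first by apply: mono Pe _; rewrite ge_min lexx orbT.
by apply: (mono _ d); [exact: Hd|rewrite ge_min lexx].
Qed.

(** * Bounds for derivatives at a given scale *)

Section ScaledBounds.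
Variables (R : realType) (n : nat).
Local Notation pt := 'rV[R]_n.
Implicit Types (f g : pt -> R) (x y z c : pt) (i j : 'I_n) (s t : seq 'I_n) (U V : set pt).

(* Weighting a derivative of order k by d^k makes the bounds multiplicative
   under Leibniz' rule at every scale d. *)
Definition scaled_bound p (d A : R) f x :=
  forall s, (size s <= p)%N -> d ^+ size s * `|dpartial f s x| <= A.

Lemma scaled_bound_ge0 p d A f x : scaled_bound p d A f x -> 0 <= A.
Proof. by move=> /(_ [::] isT); rewrite expr0 mul1r; apply: le_trans. Qed.

Lemma scaled_boundW p d d' A B f x : 0 <= d' <= d -> A <= B ->
  scaled_bound p d A f x -> scaled_bound p d' B f x.
Proof.
move=> /andP[d'0 d'd] AB H s sp; apply: le_trans AB; apply: le_trans (H s sp).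
by apply: ler_wpM2r => //; apply: lerXn2r => //; rewrite nnegrE //; exact: le_trans d'd.
Qed.

Lemma scaled_bound_eq_on p d A f g U x : open U -> U x -> (forall y, U y -> f y = g y) ->
  scaled_bound p d A f x -> scaled_bound p d A g x.
Proof. by move=> oU Ux fg H s sp; rewrite -(dpartial_eq_on s oU fg Ux); exact: H. Qed.

(** The factor d^|s| splits along each of the 2^|s| ways to distribute [s], so each term is at most
    [A * B]. *)
Lemma scaled_bound_mul p d A B f g U x : 0 <= d -> open U -> U x -> Cp p U f -> Cp p U g ->
  scaled_bound p d A f x -> scaled_bound p d B g x ->
  scaled_bound p d (2 ^+ p * (A * B)) (fun y => f y * g y) x.
Proof.
move=> d0 oU Ux cf cg Hf Hg s sp; rewrite (dpartial_mul oU Ux cf cg sp).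
have AB0 : 0 <= A * B by rewrite mulr_ge0// ?(scaled_bound_ge0 Hf) ?(scaled_bound_ge0 Hg).
apply: (@le_trans _ _ (\sum_(uv <- splits s) A * B)).
  apply: (@le_trans _ _ (\sum_(uv <- splits s)
      (d ^+ size s * `|dpartial f uv.1 x * dpartial g uv.2 x|))).
    by rewrite -mulr_sumr ler_wpM2l ?exprn_ge0//; exact: ler_norm_sum.
  rewrite big_seq [leRHS]big_seq; apply: ler_sum => uv uvs.
  have E := mem_splits uvs.
  rewrite -E exprD normrM mulrACA; apply: ler_pM.
  - by rewrite mulr_ge0// exprn_ge0.
  - by rewrite mulr_ge0// exprn_ge0.
  - by apply: Hf; apply: leq_trans sp; rewrite -E leq_addr.
  - by apply: Hg; apply: leq_trans sp; rewrite -E leq_addl.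
rewrite big_const_seq count_predT size_splits iter_addr_0 -[A * B *+ _]mulr_natl natrX.
by rewrite ler_wpM2r// ler_weXn2l// ler1n.
Qed.

Lemma scaled_bound_add p d A B f g U x : 0 <= d -> open U -> U x -> Cp p U f -> Cp p U g ->
  scaled_bound p d A f x -> scaled_bound p d B g x ->
  scaled_bound p d (A + B) (fun y => f y + g y) x.
Proof.
move=> d0 oU Ux cf cg Hf Hg s sp; rewrite (dpartial_add oU Ux cf cg sp).
apply: (le_trans (ler_wpM2l (exprn_ge0 _ d0) (ler_normD _ _))).
by rewrite mulrDr lerD//; [exact: Hf|exact: Hg].
Qed.

Lemma dpartial_cst0 s x : dpartial (fun=> 0 : R) s x = 0.
Proof.
elim: s x => //= i s IH x; rewrite (_ : dpartial _ s = cst 0); first exact: derive_cst.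
by apply/funext => y; exact: IH.
Qed.

Lemma dpartial_cst (a : R) s x : s != [::] -> dpartial (fun=> a) s x = 0.
Proof.
case/lastP: s => // s i _; rewrite dpartial_rcons.
rewrite (_ : dpartial _ [:: i] = cst 0); first exact: dpartial_cst0.
by apply/funext => y; exact: derive_cst.
Qed.

Lemma scaled_bound_cst p d (a : R) x : scaled_bound p d `|a| (fun=> a) x.
Proof.
move=> [_|i s sp]; first by rewrite expr0 mul1r.
by rewrite dpartial_cst// normr0 mulr0.
Qed.

Lemma scaled_bound_scale p d A (a : R) f U x : open U -> U x -> Cp p U f ->
  scaled_bound p d A f x -> scaled_bound p d (`|a| * A) (fun y => a * f y) x.
Proof.
move=> oU Ux cf H s sp; rewrite (dpartial_scale a oU Ux cf sp) normrM mulrCA.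
by apply: ler_wpM2l => //; exact: H.
Qed.

Lemma scaled_bound_sum p d (I : Type) (r : seq I) (P : pred I) (A : I -> R) (F : I -> pt -> R) U x :
  0 <= d -> open U -> U x -> (forall k, P k -> Cp p U (F k)) ->
  (forall k, P k -> scaled_bound p d (A k) (F k) x) ->
  scaled_bound p d (\sum_(k <- r | P k) A k) (fun y => \sum_(k <- r | P k) F k y) x.
Proof.
move=> d0 oU Ux cF H; elim: r => [|k r IH].
  rewrite (_ : (fun y => \sum_(k <- [::] | P k) F k y) = fun=> 0); last by apply/funext => y; rewrite big_nil.
  rewrite big_nil -[X in scaled_bound _ _ X](@normr0 _ R).
  exact: scaled_bound_cst.
have E y : \sum_(k <- k :: r | P k) F k y = if P k then F k y + \sum_(k <- r | P k) F k y else \sum_(k <- r | P k) F k y.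
  by rewrite big_cons.
rewrite (funext E) big_cons; case Pk : (P k) => //.
apply: (scaled_bound_add d0 oU Ux (cF k Pk)) => //; last exact: H.
exact: Cp_sum.
Qed.

Lemma scaled_bound_prod p d (I : Type) (r : seq I) (A : I -> R) (F : I -> pt -> R) U x :
  0 <= d -> open U -> U x -> (forall k, Cp p U (F k)) ->
  (forall k, scaled_bound p d (A k) (F k) x) ->
  scaled_bound p d (\prod_(k <- r) (2 ^+ p * A k)) (fun y => \prod_(k <- r) F k y) x.
Proof.
move=> d0 oU Ux cF H; elim: r => [|k r IH].
  rewrite (_ : (fun y => \prod_(k <- [::]) F k y) = fun=> 1); last by apply/funext => y; rewrite big_nil.
  rewrite big_nil -[X in scaled_bound _ _ X](@normr1 R).
  exact: scaled_bound_cst.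
rewrite (_ : (fun y => \prod_(k <- k :: r) F k y) = fun y => F k y * \prod_(k <- r) F k y); last first.
  by apply/funext => y; rewrite big_cons.
rewrite big_cons -mulrA.
apply: (scaled_bound_mul d0 oU Ux (cF k) _ (H k)) => //.
exact: Cp_prod.
Qed.

Lemma scaled_bound_exp p d A f k U x : 0 <= d -> open U -> U x -> Cp p U f ->
  scaled_bound p d A f x -> scaled_bound p d ((2 ^+ p * A) ^+ k) (fun y => f y ^+ k) x.
Proof.
move=> d0 oU Ux cf H.
rewrite (_ : (fun y => _) = fun y => \prod_(i <- iota 0 k) f y); last first.
  by apply/funext => y; rewrite big_const_seq count_predT size_iota -Monoid.iteropE.
rewrite (_ : _ ^+ k = \prod_(i <- iota 0 k) (2 ^+ p * A)); last first.
  by rewrite big_const_seq count_predT size_iota -Monoid.iteropE.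
exact: (@scaled_bound_prod p d nat (iota 0 k) (fun=> A) (fun=> f) U x d0 oU Ux (fun=> cf) (fun=> H)).
Qed.

Lemma jet_affine p (G : seq 'I_n -> pt -> R) (a : R) (v : pt) : jet p setT G ->
  jet p setT (fun s x => a ^+ size s * G s (a *: x + v)).
Proof.
move=> jG s sp; have [cG dG] := jG s sp; split=> [x _|sp' i x _].
  apply/continuousE => e e0.
  have cs : {for a *: x + v, continuous (fun y => a ^+ size s * G s y)}.
    exact: (cvgM (@cst_continuous _ _ (a ^+ size s) (a *: x + v)) (cG (a *: x + v) I)).
  move/continuousE: cs => /(_ e e0) [d d0 Hd].
  have ap : 0 < `|a| + 1 by rewrite ltr_wpDl.
  exists (d / (`|a| + 1)); first by rewrite divr_gt0.
  move=> y yx; apply: Hd; rewrite opprD addrACA subrr addr0 -scalerBr normrZ.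
  rewrite ltr_pdivlMr// in yx; apply: le_lt_trans yx.
  by rewrite mulrC ler_wpM2l// lerDl.
have := is_derive_dirZ a (dG sp' i (a *: x + v) I) => D.
have {}D : is_derive x (evec R i) (fun y => G s (a *: y + v)) (a * G (i :: s) (a *: x + v)).
  move/is_deriveE: D => H; apply/is_deriveE => e /H [d d0 Hd]; exists d => // t td.
  rewrite (_ : a *: (x + t *: evec R i) + v = a *: x + v + t *: (a *: evec R i)); first exact: Hd.
  by rewrite scalerDr !scalerA [a * t]mulrC addrAC.
rewrite /= exprSr -mulrA; exact: is_deriveZ.
Qed.

Lemma dpartial_affine p f (a : R) (v : pt) s x : Cp p setT f -> (size s <= p)%N ->
  dpartial (fun y => f (a *: y + v)) s x = a ^+ size s * dpartial f s (a *: x + v).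
Proof.
move=> /Cp_jet cf sp; have := jet_dpartial openT (jet_affine a v cf) sp (I : setT x).
by move=> <-; congr (dpartial _ s x); apply/funext => y /=; rewrite expr0 mul1r.
Qed.

Lemma Cp_affine p f (a : R) (v : pt) : Cp p setT f -> Cp p setT (fun y => f (a *: y + v)).
Proof.
move=> /Cp_jet cf; apply: (jet_Cp openT (jet_affine a v cf)) => y _ /=.
by rewrite expr0 mul1r.
Qed.

End ScaledBounds.

(** * Taylor polynomials over words *)

Section Taylor.
Variables (R : realType) (n : nat).
Local Notation pt := 'rV[R]_n.
Implicit Types (f g : pt -> R) (x y z c a b v : pt) (i j : 'I_n) (s t : seq 'I_n) (U V : set pt)
  (l : seq 'I_n -> R).

(* Words s stand for iterated derivatives; the sum over all words of length j
   divided by j! replaces the multi-index form of the degree-j Taylor term. *)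
Fixpoint hpoly l (k : nat) t v : R :=
  if k is k'.+1 then \sum_i v 0 i * hpoly l k' (i :: t) v else l t.

Definition taylor l (q : nat) t v : R := \sum_(j < q.+1) hpoly l j t v / (j`!)%:R.

Definition word_sym p l := forall s i j t,
  ((size s + size t).+2 <= p)%N -> l (s ++ i :: j :: t) = l (s ++ j :: i :: t).

Lemma hpoly_sym p l k s i j t v : word_sym p l -> ((size s + size t).+2 + k <= p)%N ->
  hpoly l k (s ++ i :: j :: t) v = hpoly l k (s ++ j :: i :: t) v.
Proof.
move=> sl; elim: k s => [|k IH] s sp /=; first by apply: sl; rewrite addn0 in sp.
apply: eq_bigr => m _; congr (_ * _).
by apply: (IH (m :: s)); move: sp; rewrite /= addnS.
Qed.

Lemma hpolyS0 l (j : nat) t : hpoly l j.+1 t 0 = 0.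
Proof. by rewrite /= big1// => i _; rewrite mxE mul0r. Qed.

Lemma taylor_at0 l q t : taylor l q t 0 = l t.
Proof.
rewrite /taylor big_ord_recl fact0 divr1 big1 ?addr0// => j _.
by rewrite lift0 hpolyS0 mul0r.
Qed.

Lemma taylor0 l t v : taylor l 0 t v = l t.
Proof. by rewrite /taylor big_ord1 /= fact0 divr1. Qed.

Lemma Cp_hpoly p U l (j : nat) t a : open U -> Cp p U (fun x => hpoly l j t (x - a)).
Proof.
move=> oU; elim: j t => [|j IH] t /=; first exact: Cp_cst.
apply: Cp_sum => // i _; apply: Cp_mul => //.
have := Cp_sub_fun oU (Cp_coord (p := p) i oU) (Cp_cst (p := p) (a 0 i) oU).
by rewrite (_ : (fun x => x 0 i - a 0 i) = (fun x => (x - a) 0 i))//; apply/funext => x; rewrite !mxE.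
Qed.

Lemma Cp_taylor p U l q t a : open U -> Cp p U (fun x => taylor l q t (x - a)).
Proof.
move=> oU; apply: Cp_sum => // j _; apply: Cp_mul => //; last exact: Cp_cst.
exact: Cp_hpoly.
Qed.

(** The product rule differentiates one of [k] linear factors; by symmetry all [k] choices give the
    same form of degree [k - 1]. The factor [k] later turns 1/k! into 1/(k-1)!. *)
Lemma is_derive_hpoly p l k t a i x : word_sym p l -> (size t + k <= p)%N ->
  is_derive x (evec R i) (fun y => hpoly l k t (y - a)) (k%:R * hpoly l k.-1 (i :: t) (x - a)).
Proof.
move=> sl; elim: k t => [|k IH] t tk.
  by rewrite mul0r /=; exact: is_derive_cst.
have -> : k.+1%:R * hpoly l k.+1.-1 (i :: t) (x - a) =
   \sum_m ((x - a) 0 m * (k%:R * hpoly l k.-1 (i :: m :: t) (x - a)) +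
     hpoly l k (m :: t) (x - a) * (m == i)%:R).
  have E : \sum_m hpoly l k (m :: t) (x - a) * (m == i)%:R = hpoly l k (i :: t) (x - a).
    rewrite (bigD1 i)//= eqxx mulr1 big1 ?addr0// => m mi.
    by rewrite (negbTE mi) mulr0.
  rewrite big_split /= E.
  rewrite -addn1 natrD mulrDl mul1r; congr (_ + _).
  case: k {IH E} tk => [|k] tk; first by rewrite mul0r big1// => m _; rewrite mul0r mulr0.
  rewrite /= mulr_sumr; apply: eq_bigr => m _; rewrite mulrCA; congr (_ * (_ * _)).
  by apply: (@hpoly_sym p l k [::]) => //=; lia.
rewrite /=; apply: is_derive_sum_seq => m _; apply: is_deriveM; last first.
  by apply: IH => /=; lia.
have := @is_derive_translate R n (fun y => y 0 m) x (- a) (evec R i) _ (is_derive_coord _ i m).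
by [].
Qed.

Lemma is_derive_taylor p l q t a i x : word_sym p l -> (size t + q.+1 <= p)%N ->
  is_derive x (evec R i) (fun y => taylor l q.+1 t (y - a)) (taylor l q (i :: t) (x - a)).
Proof.
move=> sl tq.
have -> : taylor l q (i :: t) (x - a) =
    \sum_(j < q.+2) ((j`!)%:R^-1 * (j%:R * hpoly l j.-1 (i :: t) (x - a))).
  rewrite big_ord_recl mul0r mulr0 add0r; apply: eq_bigr => j _.
  rewrite lift0 factS natrM invfM mulrCA !mulrA divff ?mul1r ?pnatr_eq0//.
  by rewrite mulrC.
rewrite /taylor (_ : (fun y => _) = fun y => \sum_(j < q.+2) (j`!)%:R^-1 * hpoly l j t (y - a)); last first.
  by apply/funext => y; apply: eq_bigr => j _; rewrite mulrC.
apply: is_derive_sum_seq => j _; apply: is_deriveZ.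
by apply: is_derive_hpoly sl _; have := ltn_ord j; lia.
Qed.

Definition tjet p l a t x := taylor l (p - size t) t (x - a).

Lemma jet_tjet p l a U : word_sym p l -> jet p U (tjet p l a).
Proof.
move=> sl s sp; split=> [x _|sp' i x _].
  exact: (Cp_continuous (Cp_taylor (p := 0) l (p - size s) s a openT) (I : setT x)).
rewrite /tjet /=; have -> : (p - size s = (p - (size s).+1).+1)%N by lia.
by apply: is_derive_taylor sl _; lia.
Qed.

Lemma jet_subf p U (G H : seq 'I_n -> pt -> R) :
  jet p U G -> jet p U H -> jet p U (fun s x => G s x - H s x).
Proof.
move=> jG jH s sp; have [cG dG] := jG s sp; have [cH dH] := jH s sp.
split=> [x Ux|sp' i x Ux]; first exact: (cvgB (cG x Ux) (cH x Ux)).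
by apply: is_deriveB; [exact: dG|exact: dH].
Qed.

(* Descending induction on the order: the mean value inequality turns a bound
   for the derivatives of order k+1 into one for those of order k. *)
Lemma jet_mean_bound p (G : seq 'I_n -> pt -> R) c (D e : R) : 0 <= e ->
  jet p [set x | `|x - c| < D] G ->
  (forall t, (size t <= p)%N -> `|G t c| <= e * D ^+ (p - size t)) ->
  (forall t x, size t = p -> `|x - c| < D -> `|G t x| <= e) ->
  forall t x, (size t <= p)%N -> `|x - c| < D ->
    `|G t x| <= (1 + n%:R) ^+ (p - size t) * e * D ^+ (p - size t).
Proof.
move=> e0 jG Gc Gtop t.
have [k] := ubnP (p - size t); elim: k t => // k IH t kt x tp xD.
have D0 : 0 < D by apply: le_lt_trans xD.
have [E|tp'] := eqVneq (size t) p.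
  by rewrite E subnn !expr0 mul1r mulr1; exact: Gtop.
have {tp'}tp' : (size t < p)%N by rewrite ltn_neqAle tp'.
have [_ /(_ tp') dG] := jG t tp.
have Eq : (p - size t = (p - (size t).+1).+1)%N by lia.
set q := (p - (size t).+1)%N in Eq.
have bnd i y : `|y - c| < D -> `|G (i :: t) y - 0| <= (1 + n%:R) ^+ q * e * D ^+ q.
  by move=> yD; rewrite subr0; apply: (IH (i :: t)) => //=; lia.
have := strict_diff (m := fun=> 0) dG bnd xD (_ : `|c - c| < D).
rewrite subrr normr0 => /(_ D0).
rewrite big1 => [|i _]; last by rewrite mul0r.
rewrite subr0 => H.
have Hs : \sum_i `|x 0 i - c 0 i| <= n%:R * D.
  apply: (@le_trans _ _ (\sum_(i < n) D)); last by rewrite sumr_const card_ord mulr_natl.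
  apply: ler_sum => i _; apply: ltW; apply: le_lt_trans xD.
  by have := coord_le_norm (x - c) i; rewrite !mxE.
have M0 : 0 <= (1 + n%:R) ^+ q * e * D ^+ q.
  by rewrite !mulr_ge0// exprn_ge0// ?ltW// addr_ge0.
have -> : G t x = (G t x - G t c) + G t c by rewrite subrK.
apply: le_trans (ler_normD _ _) _.
apply: (@le_trans _ _ ((1 + n%:R) ^+ q * e * D ^+ q * (n%:R * D) + e * D ^+ q.+1)).
  apply: lerD; first by apply: le_trans H _; exact: ler_wpM2l.
  by have := Gc t tp; rewrite Eq.
rewrite Eq.
have -> : (1 + n%:R) ^+ q.+1 * e * D ^+ q.+1 =
  (1 + n%:R) ^+ q * e * D ^+ q * (n%:R * D) + (1 + n%:R) ^+ q * (e * D ^+ q.+1).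
  by rewrite !exprS; ring.
rewrite lerD2l ler_peMl//; first by rewrite mulr_ge0// exprn_ge0// ltW.
by rewrite exprn_ege1// lerDl.
Qed.

(** Schwarz's theorem swaps the letters after [t] at every point of [U]; the equality of functions
    is then differentiated along [s]. *)
Lemma dpartial_sym p U g a : open U -> U a -> Cp p U g -> word_sym p (fun s => dpartial g s a).
Proof.
move=> oU Ua cg s i j t st; rewrite !dpartial_cat.
apply: (dpartial_eq_on s oU _ Ua) => x Ux.
have jg := Cp_jet cg.
have tp : (size t <= p)%N by lia.
have [_ d0] := jg t tp.
have [ci di] := jg (i :: t) (ltac:(rewrite /=; lia)).
have [cj dj] := jg (j :: t) (ltac:(rewrite /=; lia)).
have [cij _] := jg (i :: j :: t) (ltac:(rewrite /=; lia)).
have [cji _] := jg (j :: i :: t) (ltac:(rewrite /=; lia)).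
symmetry; apply: (@schwarz R n (dpartial g t) (dpartial g (i :: t)) (dpartial g (j :: t))
  (dpartial g (j :: i :: t)) (dpartial g (i :: j :: t)) i j U x oU Ux).
- by move=> y Uy; apply: d0 => //; lia.
- by move=> y Uy; apply: d0 => //; lia.
- by move=> y Uy; apply: di => //=; lia.
- by move=> y Uy; apply: dj => //=; lia.
- exact: cji.
- exact: cij.
Qed.

(** Subtracting the Taylor polynomial at [a] leaves a family that vanishes at [a] and whose
    derivatives of order p are oscillations of those of [g], hence small; [jet_mean_bound] carries
    this down to lower orders. The estimate is uniform in both [a] and [b], as Whitney's condition
    requires. *)
Lemma taylor_remainder p U g c (e : R) : open U -> U c -> Cp p U g -> 0 < e ->
  exists2 d, 0 < d & forall a b, `|a - c| < d -> `|b - c| < d ->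
  forall t, (size t <= p)%N ->
  `|dpartial g t b - taylor (fun s => dpartial g s a) (p - size t) t (b - a)|
     <= e * `|b - a| ^+ (p - size t).
Proof.
move=> oU Uc cg e0.
(* [jet_mean_bound] loses powers of [1 + n], working in a ball of radius [2 * |b - a|] loses powers
   of 2, and comparing two values with the one at [c] doubles [e']. *)
pose C : R := (2 * (1 + n%:R)) ^+ p.
have C1 : 1 <= C by rewrite exprn_ege1//; have : (0 : R) <= n%:R by []; lra.
have C0 : 0 < C by lra.
pose e' := e / C / 2.
have e'0 : 0 < e' by rewrite !divr_gt0.
have jg := Cp_jet cg.
have [| |d1 d10 Hd1] := @common_word_radius R n p
  (fun s d => forall x, `|x - c| < d -> `|dpartial g s x - dpartial g s c| < e').
- by move=> s d d' H d'd x xd; apply: H; exact: lt_le_trans d'd.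
- by move=> s sp; have [/(_ c Uc) /continuousE /(_ _ e'0)] := jg s sp.
have /nbhs_ballP [d2 /= d20 Hd2] := open_nbhs_nbhs (conj oU Uc).
pose m := Num.min d1 d2.
have m0 : 0 < m by rewrite lt_min d10 d20.
(* Then |b - a| < 2m/5, and the ball of radius [D] < 4m/5 around [a] stays within [m] of [c]. *)
exists (m / 5); first by rewrite divr_gt0.
move=> a b ac bc t tp.
have [->|ab] := eqVneq b a.
  by rewrite subrr taylor_at0 subrr normr0 mulr_ge0// ltW.
pose D := 2 * `|b - a|.
have ab0 : 0 < `|b - a| by rewrite normr_gt0 subr_eq0.
have D0 : 0 < D by rewrite mulr_gt0.
have baD : `|b - a| < 2 * m / 5.
  have -> : b - a = (b - c) - (a - c) by rewrite opprB addrA subrK.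
  by apply: le_lt_trans (ler_normB _ _) _; lra.
have inm x : `|x - a| < D -> `|x - c| < m.
  move=> xa; have -> : x - c = (x - a) + (a - c) by rewrite addrA subrK.
  by apply: le_lt_trans (ler_normD _ _) _; rewrite /D in xa; lra.
have sUD : [set x | `|x - a| < D] `<=` U.
  move=> x /inm xm; apply: Hd2; rewrite -ball_normE /= distrC.
  by apply: lt_le_trans xm _; rewrite ge_min lexx orbT.
have aU : U a by apply: sUD; rewrite /= subrr normr0.
have sy := dpartial_sym oU aU cg.
have jG : jet p [set x | `|x - a| < D]
   (fun s x => dpartial g s x - tjet p (fun s => dpartial g s a) a s x).
  by apply: jet_subf; [exact: Cp_jet (Cp_sub (leqnn p) sUD cg)|exact: jet_tjet].
have bD : `|b - a| < D by rewrite /D; lra.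
have H : `|dpartial g t b - tjet p (fun s => dpartial g s a) a t b| <=
    (1 + n%:R) ^+ (p - size t) * (2 * e') * D ^+ (p - size t).
  apply: (jet_mean_bound (c := a) _ jG) => //.
  - by rewrite mulr_ge0// ltW.
  - move=> s sp; rewrite /tjet subrr taylor_at0 subrr normr0 mulr_ge0// ?exprn_ge0 ?ltW//.
    by rewrite mulr_gt0.
  - move=> s x sp /inm xm; rewrite /tjet sp subnn taylor0.
    have ac1 : `|a - c| < d1.
      by apply: lt_trans ac _; have : m <= d1 by [rewrite ge_min lexx]; lra.
    have xc1 : `|x - c| < d1.
      by apply: lt_le_trans xm _; rewrite ge_min lexx.
    have -> : dpartial g s x - dpartial g s a =
      (dpartial g s x - dpartial g s c) - (dpartial g s a - dpartial g s c).
      by rewrite opprB addrA subrK.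
    apply: le_trans (ler_normB _ _) _.
    have := Hd1 s (_ : (size s <= p)%N) x xc1; have := Hd1 s (_ : (size s <= p)%N) a ac1.
    by rewrite sp leqnn => /(_ isT) + /(_ isT); lra.
apply: le_trans H _; rewrite /D exprMn.
have -> : (1 + n%:R) ^+ (p - size t) * (2 * e') * (2 ^+ (p - size t) * `|b - a| ^+ (p - size t))
   = ((2 * (1 + n%:R)) ^+ (p - size t) * (2 * e')) * `|b - a| ^+ (p - size t).
  by rewrite exprMn; ring.
rewrite ler_wpM2r ?exprn_ge0//.
have -> : e = C * (2 * e') by rewrite /e'; field; rewrite gt_eqF.
rewrite ler_wpM2r//; first by rewrite mulr_ge0// ltW.
by rewrite /C ler_weXn2l ?leq_subr//; have : (0 : R) <= n%:R by []; lra.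
Qed.

End Taylor.

(** * Cells, partitions of unity and gluing *)

Section Bumps.
Variables (R : realType) (n : nat).
Local Notation pt := 'rV[R]_n.
Implicit Types (f g : pt -> R) (x y z c a b v : pt) (i j : 'I_n) (s t : seq 'I_n) (U V : set pt).

Lemma sqr_pos_part_diff (a h : R) :
  `|Num.max (a + h) 0 ^+ 2 - Num.max a 0 ^+ 2 - h * (2 * Num.max a 0)| <= h ^+ 2.
Proof.
rewrite ler_norml; apply/andP.
by case: (leP 0 (a + h)) => h1; case: (leP 0 a) => h2; split; nra.
Qed.

(** The square is handled by hand; higher powers of the positive part are the coordinate times the
    previous power, so the product rule applies. *)
Lemma is_derive_pos_part_exp (k : nat) i j x :
  is_derive x (evec R j) (fun y => Num.max (y 0 i) 0 ^+ k.+2)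
    ((i == j)%:R * (k.+2%:R * Num.max (x 0 i) 0 ^+ k.+1)).
Proof.
elim: k => [|k IH].
  apply/is_deriveE => e e0; exists e => // t te.
  have := sqr_pos_part_diff (x 0 i) (t * (i == j)%:R).
  rewrite !mxE eqxx /= expr1 -mulrA => H; apply: le_trans H _.
  case: (i == j); rewrite ?mulr1 ?mulr0 ?expr0n /=; last by rewrite mulr_ge0// ltW.
  by rewrite -(ger0_norm (sqr_ge0 t)) expr2 normrM ler_wpM2r// ltW.
have E y : Num.max (y 0 i) 0 ^+ k.+3 = y 0 i * Num.max (y 0 i) 0 ^+ k.+2.
  by rewrite [LHS]exprS; case: (leP 0 (y 0 i)) => // _; rewrite mul0r expr0n mulr0.
rewrite (funext E).
have -> : (i == j)%:R * (k.+3%:R * Num.max (x 0 i) 0 ^+ k.+2) =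
  x 0 i * ((i == j)%:R * (k.+2%:R * Num.max (x 0 i) 0 ^+ k.+1)) +
  Num.max (x 0 i) 0 ^+ k.+2 * (i == j)%:R.
  have -> : Num.max (x 0 i) 0 ^+ k.+2 = x 0 i * Num.max (x 0 i) 0 ^+ k.+1.
    by rewrite exprS; case: (leP 0 (x 0 i)) => // _; rewrite mul0r expr0n mulr0.
  by rewrite -[k.+3]addn1 natrD; ring.
exact: (is_deriveM (is_derive_coord x j i) IH).
Qed.

Lemma Cp_pos_part_exp k i : Cp k setT (fun x : pt => Num.max (x 0 i) 0 ^+ k.+1).
Proof.
have c1 x : {for x, continuous (fun x : pt => Num.max (x 0 i) 0)}.
  apply/continuousE => e e0; exists e => // y ye.
  have := coord_le_norm (y - x) i; rewrite !mxE => h.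
  have {}ye := le_lt_trans h ye.
  apply: le_lt_trans ye; rewrite ler_norml.
  have h3 := ler_norm (y 0 i - x 0 i).
  have h4 := ler_norm (- (y 0 i - x 0 i)); rewrite normrN in h4.
  by case: (leP 0 (y 0 i)) => h1; case: (leP 0 (x 0 i)) => h2; apply/andP; split; lra.
have cX m x : {for x, continuous (fun x : pt => Num.max (x 0 i) 0 ^+ m.+1)}.
  elim: m => [|m IH]; first exact: c1.
  rewrite (_ : (fun _ => _) = fun x : pt => Num.max (x 0 i) 0 * Num.max (x 0 i) 0 ^+ m.+1).
    exact: (cvgM (c1 x) IH).
  by apply/funext => y; rewrite exprS.
elim: k => [|k IH]; first by apply/Cp0 => x _; exact: cX.
apply/Cp_succ; [exact: openT|split=> [x _|j]; first exact: cX].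
exists (fun x => ((i == j)%:R * k.+2%:R) * Num.max (x 0 i) 0 ^+ k.+1); split.
  by move=> x _; rewrite -mulrA; exact: is_derive_pos_part_exp.
exact: (Cp_scale _ openT).
Qed.

(** A C^p transition from 0 to 1 on the unit interval, rational in positive parts; the denominator
    is positive because [u] and [1 - u] are never both nonpositive. *)
Definition smoothstep p (u : R) : R :=
  Num.max u 0 ^+ p.+1 / (Num.max u 0 ^+ p.+1 + Num.max (1 - u) 0 ^+ p.+1).

Lemma smoothstep_den p (u : R) : 0 < Num.max u 0 ^+ p.+1 + Num.max (1 - u) 0 ^+ p.+1.
Proof.
have [u0|u0] := ltP 0 u.
  by rewrite ltr_pwDl ?exprn_gt0 ?exprn_ge0// le_max lexx orbT.
rewrite expr0n add0r exprn_gt0// lt_max; apply/orP; left; lra.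
Qed.

Lemma smoothstep_le0 p (u : R) : u <= 0 -> smoothstep p u = 0.
Proof. by move=> u0; rewrite /smoothstep (max_idPr u0) expr0n mul0r. Qed.

Lemma smoothstep_ge1 p (u : R) : 1 <= u -> smoothstep p u = 1.
Proof.
move=> u1; have := smoothstep_den p u; rewrite /smoothstep.
rewrite (_ : Num.max (1 - u) 0 = 0); last by apply/max_idPr; lra.
by rewrite expr0n addr0 => h; rewrite divff// gt_eqF.
Qed.

Lemma Cp_smoothstep p i (k : R) : Cp p setT (fun x : pt => smoothstep p (x 0 i + k)).
Proof.
have c1 (r : R) : Cp p setT (fun x : pt => Num.max (x 0 i + r) 0 ^+ p.+1).
  have := Cp_affine 1 (const_mx r) (Cp_pos_part_exp (k := p) i).
  by under eq_fun do rewrite !mxE mul1r.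
have c2 : Cp p setT (fun x : pt => Num.max (1 - (x 0 i + k)) 0 ^+ p.+1).
  have := Cp_affine (-1) (const_mx (1 - k)) (Cp_pos_part_exp (k := p) i).
  rewrite (_ : (fun y => _) = fun x : pt => Num.max (1 - (x 0 i + k)) 0 ^+ p.+1)//.
  by apply/funext => y; rewrite !mxE; congr (Num.max _ _ ^+ _); ring.
apply: (Cp_mul openT) => //; apply: (Cp_inv openT).
  by move=> x _; rewrite gt_eqF// smoothstep_den.
by apply: (Cp_add openT); [exact: c1|exact: c2].
Qed.

(* The translates of [cell] by integer vectors telescope to 1. *)
Definition cell p (x : pt) : R :=
  \prod_i (smoothstep p (x 0 i + 1) - smoothstep p (x 0 i)).

Lemma Cp_cell p : Cp p setT (cell p).
Proof.
rewrite (_ : cell p = fun x => \prod_i (smoothstep p (x 0 i + 1) - smoothstep p (x 0 i)))//.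
apply: Cp_prod; first exact: openT.
move=> i _; apply: (Cp_sub_fun openT); first exact: Cp_smoothstep.
by have := @Cp_smoothstep p i 0; under eq_fun do rewrite addr0.
Qed.

Lemma cell_out p x : 1 <= `|x| -> cell p x = 0.
Proof.
move=> x1; apply/eqP; rewrite prodf_seq_eq0.
have [i xi] : exists i, 1 <= `|x 0 i|.
  apply: contrapT => H; move: x1; rewrite leNgt => /negP; apply.
  by apply: norm_lt_coord => // i; rewrite ltNge; apply/negP => h; apply: H; exists i.
apply/hasP; exists i; rewrite ?mem_index_enum//=.
move: xi; rewrite ler_normr => /orP[] xi.
  by rewrite !smoothstep_ge1 ?subrr//; lra.
by rewrite !smoothstep_le0 ?subrr//; lra.
Qed.


End Bumps.

(** * Supports, grids and the counting of cells *)

Section Partition.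
Variables (R : realType) (n : nat).
Local Notation pt := 'rV[R]_n.
Implicit Types (f g : pt -> R) (x y z c a b v : pt) (i j : 'I_n) (s t : seq 'I_n) (U V : set pt).

Lemma continuous_ball_bounded f c (r : R) : (forall x, {for x, continuous f}) ->
  exists2 B, 0 < B & forall x, `|x - c| <= r -> `|f x| <= B.
Proof.
move=> cf; pose K : set pt := [set x | `|x - c| <= r].
have Kc : compact K.
  apply: bounded_closed_compact.
    exists (`|c| + r); split; first by rewrite num_real.
    move=> M rM x /= xr; apply: ltW; apply: le_lt_trans rM.
    have -> : x = c + (x - c) by rewrite addrC subrK.
    by apply: le_trans (ler_normD _ _) _; rewrite lerD2l.
  rewrite (_ : K = closed_ball_ (fun x => `|x|) c r); first exact: closed_closed_ball_.
  by apply/seteqP; split=> x; rewrite /K /closed_ball_ /= distrC.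
have := @continuous_compact _ _ f K (continuous_subspaceT cf) Kc.
move=> /compact_bounded [M [Mr HM]].
exists (`|M| + 1); first by rewrite ltr_wpDl.
move=> x xK; apply: HM; last by exists x.
by apply: le_lt_trans (ler_norm _) _; rewrite ltrDl.
Qed.

Lemma open_norm_gt c (r : R) : open [set x : pt | r < `|x - c|].
Proof.
rewrite openE => x /= xr; apply/nbhs_ballP; exists (`|x - c| - r); first by rewrite /= subr_gt0.
move=> y; rewrite -ball_normE /= => h.
have : `|x - c| <= `|x - y| + `|y - c|.
  by have := ler_normD (x - y) (y - c); rewrite addrA subrK.
lra.
Qed.

Lemma open_norm_lt c (r : R) : open [set x : pt | `|x - c| < r].
Proof.
rewrite openE => x /= xr; apply/nbhs_ballP; exists (r - `|x - c|); first by rewrite /= subr_gt0.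
move=> y; rewrite -ball_normE /= => h.
have : `|y - c| <= `|y - x| + `|x - c|.
  by have := ler_normD (y - x) (x - c); rewrite addrA subrK.
rewrite distrC in h; lra.
Qed.

Lemma Cp_support_bounded p f c (r : R) : Cp p setT f ->
  (forall x, r <= `|x - c| -> f x = 0) ->
  exists2 B, 0 < B & forall s x, (size s <= p)%N -> `|dpartial f s x| <= B.
Proof.
move=> cf f0.
(* Here [d] is the reciprocal of a bound, not a radius. *)
have [||d d0 Hd] := @common_word_radius R n p
  (fun s d => forall x, `|dpartial f s x| * d <= 1).
- move=> s d d' H d'd x; apply: le_trans (H x); exact: ler_wpM2l.
- move=> s sp; have [cs _] := Cp_jet cf sp.
  have [B B0 HB] := continuous_ball_bounded c r (fun x => cs x I).
  exists B^-1; first by rewrite invr_gt0.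
  move=> x; rewrite ler_pdivrMr// mul1r.
  have [xr|xr] := leP `|x - c| r; first exact: HB.
  rewrite (dpartial_eq_on (g := fun=> 0) s (@open_norm_gt c r) _ xr).
    by rewrite dpartial_cst0 normr0 ltW.
  by move=> y /ltW/f0.
exists d^-1; first by rewrite invr_gt0.
by move=> s x sp; rewrite -[d^-1]mul1r ler_pdivlMr//; exact: Hd.
Qed.

Definition grid N (q : {ffun 'I_n -> 'I_(N + N).+1}) : pt :=
  \row_i ((q i)%:R - N%:R).

(** Distributivity turns the sum over grid points into a product of n telescoping sums. Shifts from
    -N to N suffice: at the two ends [smoothstep] has already reached 1 and 0. *)
Lemma cell_sum p N x : (forall i, `|x 0 i| <= N%:R) ->
  \sum_(q : {ffun 'I_n -> 'I_(N + N).+1}) cell p (x - grid q) = 1.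
Proof.
move=> xN.
under eq_bigr => q _.
  rewrite /cell; under eq_bigr => i _ do rewrite !mxE.
  over.
rewrite -(bigA_distr_bigA (fun (i : 'I_n) (k : 'I_(N + N).+1) =>
  smoothstep p (x 0 i - (k%:R - N%:R) + 1) - smoothstep p (x 0 i - (k%:R - N%:R)))).
rewrite big1// => i _.
pose G k := smoothstep p (x 0 i + N%:R - k%:R + 1).
transitivity (\sum_(k < (N + N).+1) - (G k.+1 - G k)).
  apply: eq_bigr => k _; rewrite /G [RHS]opprB; congr (_ - _).
    by congr (smoothstep p _); ring.
  by congr (smoothstep p _); rewrite -[k.+1]addn1 natrD; ring.
rewrite sumrN -(big_mkord predT (fun k => G k.+1 - G k)) telescope_sumr// opprB.
have := xN i; rewrite ler_norml => /andP[h1 h2].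
rewrite /G smoothstep_ge1; last by lra.
rewrite smoothstep_le0 ?subr0//.
by rewrite -[(N + N).+1]addn1 !natrD; lra.
Qed.

(** Everything that is counted lies among the least such integer and its three successors. *)
Lemma near_ints_card (L : nat) (u : R) : (#|[pred k : 'I_L | (`|u - k%:R| < 2)%R]| <= 4)%N.
Proof.
set A := [pred _ | _].
have [k0 k0A|A0] := pickP A; last by rewrite eq_card0.
have [m mA mmin] := arg_minnP (fun k : 'I_L => k : nat) k0A.
have : (size (map val (enum A)) <= size [:: val m; (val m).+1; (val m).+2; (val m).+3])%N.
  apply: uniq_leq_size; first by rewrite (map_inj_uniq val_inj) enum_uniq.
  move=> _ /mapP [k + ->]; rewrite mem_enum => kA.
  have mk := mmin k kA.
  move: kA mA; rewrite !inE /= => h1 h2.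
  have : (k%:R : R) < m%:R + 4.
    by move: h1 h2; rewrite !ltr_norml => /andP[? ?] /andP[? ?]; lra.
  rewrite -natrD ltr_nat => h3.
  by rewrite -[k : nat]/(val k) -[m : nat]/(val m) in h3 mk *; lia.
by rewrite size_map -cardE.
Qed.

Lemma near_cells_card N x :
  (#|[pred q : {ffun 'I_n -> 'I_(N + N).+1} | (`|x - grid q| < 2)%R]| <= 4 ^ n)%N.
Proof.
pose F i := [pred k : 'I_(N + N).+1 | `|x 0 i + N%:R - k%:R| < 2].
apply: (@leq_trans #|family F|).
  apply/subset_leq_card/fintype.subsetP => q; rewrite !inE => h; apply/familyP => i; rewrite inE /=.
  apply: le_lt_trans h; have := coord_le_norm (x - grid q) i; rewrite !mxE.
  by rewrite (_ : x 0 i + N%:R - (q i)%:R = x 0 i - ((q i)%:R - N%:R))//; ring.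
rewrite card_family /image_mem -[X in (_ <= 4 ^ X)%N](card_ord n) cardT.
elim: (enum 'I_n) => //= i r IH.
by rewrite expnS; apply: leq_mul => //; exact: near_ints_card.
Qed.

Lemma sum_near_cells N x (B : R) (A : {ffun 'I_n -> 'I_(N + N).+1} -> R) : 0 <= B ->
  (forall q, A q <= B) -> (forall q, 2 <= `|x - grid q| -> A q = 0) ->
  \sum_q A q <= 4 ^+ n * B.
Proof.
move=> B0 AB A0.
rewrite (bigID [pred q | `|x - grid q| < 2]) /= addrC big1 ?add0r; last first.
  by move=> q; rewrite -leNgt => /A0.
apply: (@le_trans _ _ (\sum_(q | `|x - grid q| < 2) B)); first exact: ler_sum.
rewrite big_const iter_addr_0 -[B *+ _]mulr_natl -natrX.
by rewrite ler_wpM2r// ler_nat; exact: near_cells_card.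
Qed.

End Partition.

(** * Dyadically convergent series and gluing *)

Lemma dyadic_lt (R : realType) (e : R) : 0 < e -> exists m, (2 ^+ m)^-1 < e.
Proof.
move=> e0; exists (Num.bound e^-1).
rewrite invf_plt ?posrE ?exprn_gt0//.
apply: lt_trans (archi_boundP (ltW _)) _; first by rewrite invr_gt0.
by rewrite -natrX ltr_nat ltn_expl.
Qed.

(** The subtracted term is the remaining geometric tail; with it the induction on [d] closes. *)
Lemma dyadic_tail (R : realType) (u : nat -> R) (m d : nat) :
  (forall k, `|u k| <= (2 ^+ k)^-1) ->
  `|\sum_(k <- iota m d) u k| <= 2 * (2 ^+ m)^-1 - 2 * (2 ^+ (m + d))^-1.
Proof.
move=> ub; elim: d => [|d IH]; first by rewrite big_nil normr0 addn0 subrr.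
rewrite -[d.+1]addn1 iotaD big_cat /= big_seq1.
apply: le_trans (ler_normD _ _) _; have := ub (m + d)%N.
rewrite addn1 addnS exprS invfM.
have -> : 2 * (2^-1 * (2 ^+ (m + d))^-1) = (2 ^+ (m + d))^-1 :> R by rewrite mulrA divff// mul1r.
by move: IH; lra.
Qed.

(** The limit is the supremum of the lower estimates [v m - 2 / 2 ^ m], each of which lies below
    every upper estimate [v M + 2 / 2 ^ M]; the rate of convergence comes with it. *)
Lemma dyadic_series (R : realType) (u : nat -> R) :
  (forall k, `|u k| <= (2 ^+ k)^-1) ->
  exists S, forall m, `|S - \sum_(k <- iota 0 m) u k| <= 2 * (2 ^+ m)^-1.
Proof.
move=> ub; pose v (m : nat) := \sum_(k <- iota 0 m) u k.
have vd m d : `|v (m + d)%N - v m| <= 2 * (2 ^+ m)^-1.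
  rewrite /v iotaD big_cat /= add0n [X in X - _]addrC addrK.
  apply: le_trans (dyadic_tail m d ub) _.
  by rewrite gerBl mulr_ge0// invr_ge0 exprn_ge0.
pose A := [set v m - 2 * (2 ^+ m)^-1 | m in setT].
have d0 (m : nat) : 0 <= 2 * (2 ^+ m)^-1 :> R by rewrite mulr_ge0// invr_ge0 exprn_ge0.
have ubA M : ubound A (v M + 2 * (2 ^+ M)^-1).
  move=> _ [m _ <-]; have [mM|/ltnW Mm] := leqP m M.
    have := vd m (M - m)%N; rewrite subnKC// ler_norml => /andP[h1 h2].
    by have := d0 M; lra.
  have := vd M (m - M)%N; rewrite subnKC// ler_norml => /andP[h1 h2].
  by have := d0 m; lra.
exists (sup A) => m; rewrite -/(v m) ler_norml.
have h1 : v m - 2 * (2 ^+ m)^-1 <= sup A.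
  by apply: ub_le_sup; [exists (v 0%N + 2 * (2 ^+ 0)^-1); exact: ubA|exists m].
have h2 : sup A <= v m + 2 * (2 ^+ m)^-1.
  by apply: ge_sup; [exists (v 0%N - 2 * (2 ^+ 0)^-1), 0%N|exact: ubA].
by apply/andP; split; lra.
Qed.

Section Gluing.
Variables (R : realType) (n : nat).
Local Notation pt := 'rV[R]_n.
Implicit Types (f g : pt -> R) (x y z c a b v : pt) (i j : 'I_n) (s t : seq 'I_n) (U V : set pt).

Lemma Cp_series p (w : nat -> R) (g : nat -> pt -> R) :
  (forall k, Cp p setT (g k)) ->
  (forall k s x, (size s <= p)%N -> `|w k * dpartial (g k) s x| <= (2 ^+ k)^-1) ->
  exists2 S : pt -> R, Cp p setT S &
    forall x m, `|S x - \sum_(k <- iota 0 m) w k * g k x| <= 2 * (2 ^+ m)^-1.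
Proof.
move=> cg wb.
have /choice [G HG] : forall sx : seq 'I_n * pt, exists S, (size sx.1 <= p)%N ->
    forall m, `|S - \sum_(k <- iota 0 m) w k * dpartial (g k) sx.1 sx.2| <= 2 * (2 ^+ m)^-1.
  move=> [s x] /=; have [sp|sp] := leqP (size s) p; last by exists 0.
  by have [S HS] := dyadic_series (fun k => wb k s x sp); exists S.
pose v m s x := \sum_(k <- iota 0 m) w k * dpartial (g k) s x.
have jv m : jet p setT (v m) by apply: jet_sum => k _; exact: Cp_jet.
have {}HG s x m : (size s <= p)%N -> `|G (s, x) - v m s x| <= 2 * (2 ^+ m)^-1.
  by move=> sp; exact: (HG (s, x) sp).
have d0 (m : nat) : 0 <= 2 * (2 ^+ m)^-1 :> R by rewrite mulr_ge0// invr_ge0 exprn_ge0.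
exists (fun x => G ([::], x)); last by move=> x m; exact: HG.
apply: (jet_Cp (G := fun s x => G (s, x)) openT) => // s sp; split=> [x _|sp' i x _].
  apply/continuousE => e e0.
  have [m me] := dyadic_lt (divr_gt0 e0 (ltr0n _ 8)).
  have [/(_ x I) /continuousE /(_ (e / 2)) cv _] := jv m s sp.
  have [|d dp Hd] := cv; first by rewrite divr_gt0.
  exists d => // y /Hd h.
  have := HG s x m sp; have := HG s y m sp; rewrite !ler_norml => /andP[? ?] /andP[? ?].
  by move: h; rewrite !ltr_norml => /andP[? ?]; apply/andP; split; lra.
apply/is_deriveE => e e0.
have [m me] := dyadic_lt (divr_gt0 e0 (ltr0n _ 8)).
have [_ /(_ sp' i x I) /is_deriveE /(_ (e / 2)) dv] := jv m s sp.
have [|d dp Hd] := dv; first by rewrite divr_gt0.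
exists d => // u /Hd h.
(* The increment of the tail is bounded through the finite sums [v M - v m], by a mean value
   estimate that does not depend on [M]; replacing [v M] by its limit costs an arbitrary [e']. *)
have tail : `|(G (s, x + u *: evec R i) - v m s (x + u *: evec R i)) - (G (s, x) - v m s x)|
    <= `|u| * (2 * (2 ^+ m)^-1).
  apply/ler_addgt0Pr => e' e'0.
  have [M0 M0e] := dyadic_lt (divr_gt0 e'0 (ltr0n _ 8)).
  pose M := (m + M0)%N.
  have Me : (2 ^+ M)^-1 < e' / 8.
    by apply: le_lt_trans M0e; rewrite lef_pV2 ?posrE ?exprn_gt0// ler_weXn2l ?ler1n// leq_addl.
  have vM : `|(v M s (x + u *: evec R i) - v m s (x + u *: evec R i)) - (v M s x - v m s x)|
      <= `|u| * (2 * (2 ^+ m)^-1).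
    have jd : jet p setT (fun s x => v M s x - v m s x) by exact: jet_subf.
    have H := @line_mean_value R pt (fun x => v M s x - v m s x)
      (fun r => u * (v M (i :: s) (x + r *: (u *: evec R i)) - v m (i :: s) (x + r *: (u *: evec R i))))
      x (u *: evec R i) 0 (`|u| * (2 * (2 ^+ m)^-1)).
    rewrite subr0 in H; apply: H => r _.
      by apply: is_derive_dirZ; have [_ H] := jd s sp; exact: H.
    rewrite subr0 normrM ler_wpM2l// /v /M iotaD big_cat /= add0n [X in X - _]addrC addrK.
    apply: le_trans (dyadic_tail m M0 _) _; last by rewrite gerBl.
    by move=> k; exact: (wb k (i :: s) _ sp').
  have := HG s x M sp; have := HG s (x + u *: evec R i) M sp.
  move: vM; rewrite !ler_norml => /andP[? ?] /andP[? ?] /andP[? ?].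
  by apply/andP; split; lra.
have : `|u * (v m (i :: s) x - G (i :: s, x))| <= `|u| * (2 * (2 ^+ m)^-1).
  by rewrite normrM ler_wpM2l// distrC; exact: HG.
have uu : `|u| * (2 * (2 ^+ m)^-1) <= `|u| * (e / 4).
  by rewrite ler_wpM2l//; lra.
have -> : e * `|u| = e / 2 * `|u| + `|u| * (e / 4) + `|u| * (e / 4) by field.
move: h tail; rewrite !ler_norml => /andP[? ?] /andP[? ?] /andP[? ?].
by apply/andP; split; lra.
Qed.

Definition bump p (x : pt) : R := \prod_i (Num.max (x 0 i + 1) 0 ^+ p.+1 * Num.max (1 - x 0 i) 0 ^+ p.+1).

Lemma Cp_bump p : Cp p setT (bump p).
Proof.
rewrite (_ : bump p = fun x => \prod_i (Num.max (x 0 i + 1) 0 ^+ p.+1 * Num.max (1 - x 0 i) 0 ^+ p.+1))//.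
apply: Cp_prod; first exact: openT.
move=> i _; apply: (Cp_mul openT).
  have := Cp_affine 1 (const_mx 1) (@Cp_pos_part_exp R n p i).
  by under eq_fun do rewrite !mxE mul1r.
have := Cp_affine (-1) (const_mx 1) (@Cp_pos_part_exp R n p i).
rewrite (_ : (fun y => _) = fun x : pt => Num.max (1 - x 0 i) 0 ^+ p.+1)//.
by apply/funext => y; rewrite !mxE; congr (Num.max _ _ ^+ _); ring.
Qed.

Lemma bump_ge0 p x : 0 <= bump p x.
Proof. by apply: prodr_ge0 => i _; rewrite mulr_ge0// exprn_ge0// le_max lexx orbT. Qed.

Lemma bump_gt0 p x : `|x| < 1 -> 0 < bump p x.
Proof.
move=> x1; apply: prodr_gt0 => i _; have := le_lt_trans (coord_le_norm x i) x1.
rewrite ltr_norml => /andP[h1 h2].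
by rewrite mulr_gt0// exprn_gt0// lt_max; apply/orP; left; lra.
Qed.

Lemma bump_out p x : 1 <= `|x| -> bump p x = 0.
Proof.
move=> x1; apply/eqP; rewrite prodf_seq_eq0.
have [i xi] : exists i, 1 <= `|x 0 i|.
  apply: contrapT => H; move: x1; rewrite leNgt => /negP; apply.
  by apply: norm_lt_coord => // i; rewrite ltNge; apply/negP => h; apply: H; exists i.
apply/hasP; exists i; rewrite ?mem_index_enum//=.
rewrite mulf_eq0 !expf_eq0 /=; apply/orP.
move: xi; rewrite ler_normr => /orP[] xi.
  by right; apply/eqP/max_idPr; lra.
by left; apply/eqP/max_idPr; lra.
Qed.

Lemma rational_center x (r : R) : 0 < r -> exists q : 'rV[rat]_n, `|x - map_mx ratr q| < r.
Proof.
move=> r0.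
have /choice [q Hq] : forall i, exists q : rat, `|x 0 i - ratr q| < r.
  move=> i; have [q] := @rat_in_itvoo R (x 0 i - r) (x 0 i + r) (ltac:(lra)).
  rewrite in_itv /= => /andP[h1 h2]; exists q; rewrite ltr_norml; apply/andP; split; lra.
exists (\row_i q i); apply: norm_lt_coord => // i; rewrite !mxE; exact: Hq.
Qed.

Definition extends_near p (X : set pt) f c (r : R) (F : pt -> R) :=
  Cp p [set y | `|y - c| < r] F /\ forall y, `|y - c| < r -> X y -> F y = f y.

(** The bump vanishes from radius [r] on, while [F] is C^p up to [2 * r]: so [b * F] is C^p on two
    overlapping open sets that cover the space, whatever [F] does outside its ball. *)
Lemma local_bump p (X : set pt) f c (r : R) F : 0 < r -> extends_near p X f c (2 * r) F ->
  exists b g : pt -> R, [/\ Cp p setT b, Cp p setT g,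
    (exists2 B, 0 < B & forall s x, (size s <= p)%N -> `|dpartial b s x| <= B /\ `|dpartial g s x| <= B),
    (forall x, X x -> g x = f x * b x) &
    (forall x, 0 <= b x) /\ forall x, `|x - c| < r -> 0 < b x].
Proof.
move=> r0 [cF Ff].
pose b x := bump p (r^-1 *: x + - (r^-1 *: c)).
have bE x : b x = bump p (r^-1 *: (x - c)) by rewrite scalerBr.
have nE x : `|r^-1 *: (x - c)| = `|x - c| / r by rewrite normrZ gtr0_norm ?invr_gt0// mulrC.
have cb : Cp p setT b by apply: Cp_affine; exact: Cp_bump.
have bout x : r <= `|x - c| -> b x = 0.
  by move=> xr; rewrite bE bump_out// nE ler_pdivlMr// mul1r.
have gout x : r <= `|x - c| -> b x * F x = 0 by move=> /bout ->; rewrite mul0r.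
have cg : Cp p setT (fun x => b x * F x).
  apply: Cp_local; first exact: openT.
  move=> x _; have [xr|xr] := ltP `|x - c| (2 * r).
    exists [set y | `|y - c| < 2 * r]; first by split => //; exact: open_norm_lt.
    apply: (Cp_mul (@open_norm_lt _ _ c (2 * r))) => //.
    exact: (Cp_sub (leqnn p) (@subsetT _ _) cb).
  exists [set y | r < `|y - c|]; first by split; [exact: open_norm_gt|rewrite /=; lra].
  apply: (Cp_eq (f := fun=> 0) (@open_norm_gt _ _ c r)).
    by move=> y /= /ltW /gout ->.
  by apply: Cp_cst; exact: open_norm_gt.
exists b, (fun x => b x * F x); split => //.
- have [B1 B10 H1] := Cp_support_bounded cb bout; have [B2 B20 H2] := Cp_support_bounded cg gout.
  exists (B1 + B2); first by rewrite addr_gt0.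
  move=> s x sp; have := H1 s x sp; have := H2 s x sp; split; lra.
- move=> x Xx; have [xr|/bout ->] := ltP `|x - c| r; last by rewrite mul0r mulr0.
  by rewrite Ff// 1?mulrC//; lra.
- split=> x; first exact: bump_ge0.
  by move=> xr; rewrite bE bump_gt0// nE ltr_pdivrMr// mul1r.
Qed.

(* Index rational balls by nat and divide two weighted series with the same
   bump functions; the weights decrease so fast that local finiteness is not
   needed. *)
Lemma Cp_gluing p U (X : set pt) f : open U ->
  (forall x, U x -> exists2 r, 0 < r & exists F, extends_near p X f x r F) ->
  exists2 F, Cp p U F & forall x, U x -> X x -> F x = f x.
Proof.
move=> oU H.
pose Q k (t : R * (pt -> R) * (pt -> R)) := [/\ 0 < t.1.1, Cp p setT t.1.2, Cp p setT t.2,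
  (forall s x, (size s <= p)%N -> `|t.1.1 * dpartial t.1.2 s x| <= (2 ^+ k)^-1 /\
     `|t.1.1 * dpartial t.2 s x| <= (2 ^+ k)^-1) &
  [/\ forall x, X x -> t.2 x = f x * t.1.2 x, forall x, 0 <= t.1.2 x &
   forall (q : 'rV[rat]_n) (e : nat), unpickle k = Some (q, e) ->
    (exists F, extends_near p X f (map_mx ratr q) (2 * (2 ^+ e)^-1) F) ->
    forall x, `|x - map_mx ratr q| < (2 ^+ e)^-1 -> 0 < t.1.2 x]].
have /choice [t Ht] : forall k, exists w, Q k w.
  move=> k; have k0 : 0 < (2 ^+ k)^-1 :> R by rewrite invr_gt0 exprn_gt0.
  (* A code that names no ball, or a ball to which [f] does not extend, contributes zero
     functions. *)
  have trivial_case : (forall (q : 'rV[rat]_n) (e : nat), unpickle k = Some (q, e) ->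
     ~ exists F, extends_near p X f (map_mx ratr q) (2 * (2 ^+ e)^-1) F) -> exists w, Q k w.
    move=> nk; exists (1, fun=> 0, fun=> 0); split => //=; try by apply: Cp_cst; exact: openT.
      by move=> s x _; rewrite !dpartial_cst0 mulr0 normr0 !ltW.
    by split=> [x _|//|q e /nk nF /nF//]; rewrite mulr0.
  case E : (unpickle k : option ('rV[rat]_n * nat)) => [[q e]|]; last first.
    by apply: trivial_case => q e; rewrite E.
  have [[F HF]|nF] := pselect (exists F, extends_near p X f (map_mx ratr q) (2 * (2 ^+ e)^-1) F); last first.
    by apply: trivial_case => q' e'; rewrite E => -[<- <-].
  have e0 : 0 < (2 ^+ e)^-1 :> R by rewrite invr_gt0 exprn_gt0.
  have [b [g [cb cg [B B0 HB] gb [b0 bp]]]] := local_bump e0 HF.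
  exists ((2 ^+ k)^-1 / B, b, g); split => //=; first by rewrite divr_gt0.
    have w0 : 0 <= (2 ^+ k)^-1 / B by rewrite divr_ge0 ?ltW.
    move=> s x sp; have [h1 h2] := HB s x sp.
    rewrite [`|_ * dpartial b _ _|]normrM [`|_ * dpartial g _ _|]normrM (ger0_norm w0).
    by split; rewrite -[leRHS](divfK (lt0r_neq0 B0)) ler_wpM2l.
  by split=> // q' e'; rewrite E => -[<- <-] _; exact: bp.
have [S cS HS] := @Cp_series p (fun k => (t k).1.1) (fun k => (t k).1.2)
  (fun k => let: And5 _ h _ _ _ := Ht k in h)
  (fun k s x sp => let: And5 _ _ _ h _ := Ht k in (h s x sp).1).
have [N cN HN] := @Cp_series p (fun k => (t k).1.1) (fun k => (t k).2)
  (fun k => let: And5 _ _ h _ _ := Ht k in h)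
  (fun k s x sp => let: And5 _ _ _ h _ := Ht k in (h s x sp).2).
have Spos x : U x -> 0 < S x.
  move=> Ux; have [r r0 [F [cF Ff]]] := H x Ux.
  (* With 2^-e < r/3 and a rational centre within 2^-e of [x], the ball of radius 2 * 2^-e around
     that centre lies within [r] of [x] and inherits [F]. *)
  have [e er] := dyadic_lt (divr_gt0 r0 (ltr0n _ 3)).
  have e0 : 0 < (2 ^+ e)^-1 :> R by rewrite invr_gt0 exprn_gt0.
  have [q qx] := rational_center x e0.
  set c := map_mx ratr q in qx.
  have sub y : `|y - c| < 2 * (2 ^+ e)^-1 -> `|y - x| < r.
    move=> yc; have -> : y - x = (y - c) - (x - c) by rewrite opprB addrA subrK.
    by apply: le_lt_trans (ler_normB _ _) _; lra.
  pose k := pickle (q, e).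
  have [wk _ _ _ [_ _ bp]] := Ht k.
  have bk : 0 < (t k).1.2 x.
    apply: (bp q e) => //; first by rewrite /k pickleK.
    exists F; split=> [|y /sub]; last exact: Ff.
    by apply: (Cp_sub (leqnn p) _ cF) => y; exact: sub.
  have wb : 0 < (t k).1.1 * (t k).1.2 x by rewrite mulr_gt0.
  have [m mw] := dyadic_lt (divr_gt0 wb (ltr0n _ 2)).
  (* The partial sum then contains the [k]-th term, and the tail [2 / 2 ^ M] is smaller than that
     term. *)
  pose M := maxn k.+1 m.
  have Mm : (2 ^+ M)^-1 <= (2 ^+ m)^-1 :> R.
    by rewrite lef_pV2 ?posrE ?exprn_gt0// ler_weXn2l ?ler1n// leq_maxr.
  have := HS x M; rewrite ler_norml => /andP[h _].
  have : (t k).1.1 * (t k).1.2 x <= \sum_(k0 <- iota 0 M) (t k0).1.1 * (t k0).1.2 x.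
    rewrite (bigD1_seq k) ?iota_uniq ?mem_iota//=; last by rewrite leq_max ltnSn.
    rewrite lerDl sumr_ge0// => k' _.
    by have [w _ _ _ [_ b0 _]] := Ht k'; rewrite mulr_ge0// ltW.
  lra.
exists (fun x => N x * (S x)^-1).
  apply: (Cp_mul oU); first exact: (Cp_sub (leqnn p) (@subsetT _ _) cN).
  apply: (Cp_inv oU); first by move=> x /Spos; exact: lt0r_neq0.
  exact: (Cp_sub (leqnn p) (@subsetT _ _) cS).
move=> x Ux Xx; suff -> : N x = f x * S x by rewrite mulfK// lt0r_neq0// Spos.
(* The identity holds term by term, so the error at the fixed point [x] is at most [2 / 2 ^ m] times
   [1 + |f x|]; no local bound for [f] is involved. *)
apply/eqP; rewrite -subr_eq0 -normr_le0; apply/ler_addgt0Pr => e e0; rewrite add0r.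
have fp : 0 < 2 * (1 + `|f x|) by rewrite mulr_gt0// ltr_wpDr.
have [m me] := dyadic_lt (divr_gt0 e0 fp).
have E : \sum_(k <- iota 0 m) (t k).1.1 * (t k).2 x =
    f x * \sum_(k <- iota 0 m) (t k).1.1 * (t k).1.2 x.
  rewrite mulr_sumr; apply: eq_bigr => k _.
  by have [_ _ _ _ [-> // _ _]] := Ht k; rewrite mulrCA.
have -> : N x - f x * S x = (N x - \sum_(k <- iota 0 m) (t k).1.1 * (t k).2 x)
   - f x * (S x - \sum_(k <- iota 0 m) (t k).1.1 * (t k).1.2 x) by rewrite E; ring.
apply: le_trans (ler_normB _ _) _; rewrite normrM.
have h1 := HN x m; have h2 := ler_wpM2l (normr_ge0 (f x)) (HS x m).
apply: le_trans (lerD h1 h2) _.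
rewrite ltr_pdivlMr// in me; apply: ltW; apply: le_lt_trans me.
by rewrite le_eqVlt; apply/orP; left; apply/eqP; ring.
Qed.

End Gluing.

(** * Whitney's extension theorem *)

Section Whitney.
Variables (R : realType) (n p : nat).
Local Notation pt := 'rV[R]_n.
Variables (K : set pt) (l : seq 'I_n -> pt -> R) (N0 : nat).
Hypothesis symK : forall a, K a -> word_sym p (fun s => l s a).
Hypothesis bdK : forall a, K a -> `|a| + 4 <= N0%:R.
Implicit Types (x y z c a b v : pt) (i j : 'I_n) (s t : seq 'I_n) (m k : nat).

Definition whitney_pair a b (e : R) := forall t, (size t <= p)%N ->
  `|l t b - taylor (fun s => l s a) (p - size t) t (b - a)| <= e * `|b - a| ^+ (p - size t).

Local Notation J a := (tjet p (fun s => l s a) a).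
Local Notation P a := (tjet p (fun s => l s a) a [::]).

(** At [b] the difference of the two jets is exactly a Whitney remainder, and its derivatives of
    order p are constants; [jet_mean_bound] then spreads the estimate over a ball. *)
Lemma jet_compare a b e D x t : K a -> K b -> 0 <= e -> whitney_pair a b e ->
  `|b - a| <= D -> `|x - b| < D -> (size t <= p)%N ->
  `|J a t x - J b t x| <= (1 + n%:R) ^+ (p - size t) * e * D ^+ (p - size t).
Proof.
move=> Ka Kb e0 W baD xbD tp.
have jG : jet p [set x | `|x - b| < D] (fun s x => J a s x - J b s x).
  by apply: jet_subf; apply: jet_tjet; exact: symK.
apply: (jet_mean_bound (c := b) e0 jG) => //.
- move=> s sp; rewrite /tjet subrr taylor_at0 distrC; apply: le_trans (W s sp) _.
  by rewrite ler_wpM2l// lerXn2r// nnegrE//; exact: le_trans baD.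
- move=> s y sp _; rewrite /tjet sp subnn !taylor0.
  by have := W s; rewrite sp subnn taylor0 expr0 mulr1 distrC; apply.
Qed.

Lemma Cp_tjet0 a : Cp p setT (P a).
Proof. exact: Cp_taylor openT. Qed.

Lemma dpartial_tjet a t x : K a -> (size t <= p)%N -> dpartial (P a) t x = J a t x.
Proof. by move=> Ka tp; rewrite (jet_dpartial openT (jet_tjet a setT (symK Ka)) tp I). Qed.

(* At scale 2^-m, each cell close to [K] carries the Taylor polynomial of a
   chosen point of [K]; [stage m] replaces [stage (m - 1)] by the blend of these
   polynomials near [K].  The constants 3, 4, 5 are such that the blend is pure
   within 3 meshes of [K], no cell is used beyond 5 meshes, and 5 meshes at one
   scale are less than 3 at the previous one.  Hence a point off [K] sees at
   most one impure replacement and [stage m] is eventually constant there. *)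
Definition mesh m : R := (2 ^+ m)^-1.
Local Notation box m := {ffun 'I_n -> 'I_(N0 * 2 ^ m + N0 * 2 ^ m).+1}.
Definition near_pt m (q : box m) : set pt := [set a | K a /\ `|mesh m *: grid R q - a| <= 4 * mesh m].
Definition near_K m (q : box m) : bool := `[< exists a, near_pt q a >].
Definition apick m (q : box m) : pt := xget 0 (near_pt q).
Definition chi m (q : box m) x : R := cell p (2 ^+ m *: x - grid R q).
Definition near_weight m x : R := \sum_(q : box m | near_K q) chi q x.
Definition near_blend m x : R := \sum_(q : box m | near_K q) chi q x * P (apick q) x.
Fixpoint stage m x : R := if m is k.+1 then (1 - near_weight k.+1 x) * stage k x + near_blend k.+1 x else near_blend 0 x.

Lemma mesh_gt0 m : 0 < mesh m. Proof. by rewrite invr_gt0 exprn_gt0. Qed.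
Lemma meshS m : mesh m = 2 * mesh m.+1.
Proof. by rewrite /mesh exprS invfM mulrA divff// mul1r. Qed.
Lemma mesh_le1 m : mesh m <= 1.
Proof. by rewrite invf_le1 ?exprn_gt0// exprn_ege1// ler1n. Qed.

Lemma apickP m (q : box m) : near_K q -> K (apick q) /\ `|mesh m *: grid R q - apick q| <= 4 * mesh m.
Proof. by move=> /asboolP [a Ha]; apply: (xgetPex 0 (ex_intro _ a Ha)). Qed.

Lemma cell_distE m (q : box m) x :
  `|2 ^+ m *: x - grid R q| = `|x - mesh m *: grid R q| / mesh m.
Proof.
have -> : 2 ^+ m *: x - grid R q = (mesh m)^-1 *: (x - mesh m *: grid R q).
  by rewrite scalerBr scalerA mulVf ?gt_eqF ?mesh_gt0// scale1r invrK.
by rewrite normrZ ger0_norm ?invr_ge0 ?ltW ?mesh_gt0// mulrC.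
Qed.

Lemma Cp_chi m (q : box m) : Cp p setT (chi q).
Proof. exact: (Cp_affine (2 ^+ m) (- grid R q) (@Cp_cell R n p)). Qed.

Lemma Cp_near_weight m : Cp p setT (near_weight m).
Proof.
rewrite (_ : near_weight m = fun x => \sum_(q : box m | near_K q) chi q x)//.
by apply: Cp_sum; [exact: openT|move=> q _; exact: Cp_chi].
Qed.

Lemma Cp_near_blend m : Cp p setT (near_blend m).
Proof.
rewrite (_ : near_blend m = fun x => \sum_(q : box m | near_K q) chi q x * P (apick q) x)//.
apply: Cp_sum; [exact: openT|move=> q _; apply: (Cp_mul openT); [exact: Cp_chi|exact: Cp_tjet0]].
Qed.

Lemma Cp_stage m : Cp p setT (stage m).
Proof.
elim: m => [|m IH]; first exact: Cp_near_blend.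
rewrite (_ : stage m.+1 = fun x => (1 - near_weight m.+1 x) * stage m x + near_blend m.+1 x)//.
apply: (Cp_add openT); last exact: Cp_near_blend.
apply: (Cp_mul openT) => //; apply: (Cp_sub_fun openT); last exact: Cp_near_weight.
by apply: Cp_cst; exact: openT.
Qed.

(** A cell that does not vanish at [x] has its centre within one mesh of [x], hence within 4 meshes
    of [c], so no cell is missing from the sum. The margin 4 in [bdK] keeps [x] inside the grid,
    since meshes are at most 1. *)
Lemma near_weight1 m x c : K c -> `|x - c| < 3 * mesh m -> near_weight m x = 1.
Proof.
move=> Kc xc.
have m0 := mesh_gt0 m.
rewrite -(@cell_sum R n p (N0 * 2 ^ m) (2 ^+ m *: x)); last first.
  move=> i; apply: le_trans (coord_le_norm _ i) _.
  rewrite normrZ ger0_norm ?exprn_ge0// natrM natrX mulrC ler_wpM2r ?exprn_ge0//.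
  have -> : x = c + (x - c) by rewrite addrC subrK.
  apply: le_trans (ler_normD _ _) _; apply: le_trans (bdK Kc); rewrite lerD2l.
  by have := mesh_le1 m; lra.
rewrite /near_weight big_mkcond; apply: eq_bigr => q _; rewrite /chi; case: ifPn => // /asboolPn H.
rewrite cell_out// leNgt; apply/negP; rewrite cell_distE ltr_pdivrMr// mul1r => h.
apply: H; exists c; split => //.
have -> : mesh m *: grid R q - c = (x - c) - (x - mesh m *: grid R q).
  by rewrite opprB [RHS]addrC addrA subrK.
by apply: le_trans (ler_normB _ _) _; lra.
Qed.

Lemma stage_near m x c : K c -> `|x - c| < 3 * mesh m -> stage m x = near_blend m x.
Proof. by case: m => [//|m] Kc xc /=; rewrite (near_weight1 Kc xc) subrr mul0r add0r. Qed.

Lemma chi_far m (q : box m) x : near_K q ->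
  (forall a, K a -> 5 * mesh m < `|x - a|) -> chi q x = 0.
Proof.
move=> /apickP [Ka Ha] H; apply: cell_out; rewrite cell_distE ler_pdivlMr ?mesh_gt0// mul1r.
have := H _ Ka.
have -> : x - apick q = (x - mesh m *: grid R q) + (mesh m *: grid R q - apick q).
  by rewrite addrA subrK.
by move=> h; have := lt_le_trans h (ler_normD _ _); lra.
Qed.

Lemma stage_far m x : (forall a, K a -> 5 * mesh m.+1 < `|x - a|) -> stage m.+1 x = stage m x.
Proof.
move=> H /=; rewrite /near_weight /near_blend big1 => [|q qn]; last exact: chi_far.
by rewrite big1 ?subr0 ?mul1r ?addr0// => q qn; rewrite chi_far// mul0r.
Qed.

Lemma stage_stable m k x : (m <= k)%N -> (forall a, K a -> 5 * mesh m.+1 < `|x - a|) ->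
  stage k x = stage m x.
Proof.
move=> + H; elim: k => [|k IH]; first by rewrite leqn0 => /eqP ->.
rewrite leq_eqVlt => /orP[/eqP -> //|]; rewrite ltnS => mk.
rewrite -(IH mk); apply: stage_far => a Ka; apply: le_lt_trans (H a Ka).
rewrite ler_wpM2l// /mesh lef_pV2 ?posrE ?exprn_gt0//.
by rewrite ler_weXn2l ?ler1n.
Qed.

Definition far m x := forall a, K a -> 5 * mesh m.+1 < `|x - a|.
(** Off [K] any [m] with [far m x] would do, because all later stages agree at [x]; the arbitrary
    choice is removed by [extension_far]. *)
Definition extension x : R := if `[< K x >] then l [::] x else stage (xget 0%N [set m | far m x]) x.

Lemma extension_far m x : far m x -> extension x = stage m x.
Proof.
move=> H; rewrite /extension; case: asboolP => [Kx|_].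
  by have := H x Kx; rewrite subrr normr0 ltNge mulr_ge0// ltW// mesh_gt0.
have Hx : far (xget 0%N [set m | far m x]) x by apply: (@xgetPex _ 0%N [set m | far m x]); exists m.
have [mk|/ltnW km] := leqP m (xget 0%N [set m | far m x]); first exact: stage_stable.
by rewrite (stage_stable km Hx).
Qed.


(** The radius 40 is generous: in the blends below the two points of [K] are at most 18 meshes
    apart. The powers of [mu] from the weight and from [jet_compare] combine to mu^p. *)
Lemma scaled_bound_diff a c e (mu : R) x : K a -> K c -> 0 <= e -> 0 < mu ->
  whitney_pair a c e -> `|c - a| <= 40 * mu -> `|x - c| < 40 * mu ->
  scaled_bound p mu ((40 * (1 + n%:R)) ^+ p * e * mu ^+ p) (fun y => P a y - P c y) x.
Proof.
move=> Ka Kc e0 mu0 W ca xc t tp.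
rewrite (dpartial_sub openT (I : setT x) (Cp_tjet0 a) (Cp_tjet0 c) tp) !dpartial_tjet//.
have H := jet_compare Ka Kc e0 W ca xc tp.
apply: (le_trans (ler_wpM2l (exprn_ge0 _ (ltW mu0)) H)).
rewrite [(40 * mu) ^+ _]exprMn.
have -> : mu ^+ size t * ((1 + n%:R) ^+ (p - size t) * e * (40 ^+ (p - size t) * mu ^+ (p - size t)))
  = (40 * (1 + n%:R)) ^+ (p - size t) * (e * (mu ^+ size t * mu ^+ (p - size t))).
  by rewrite exprMn; ring.
rewrite -exprD subnKC// -[leRHS]mulrA ler_wpM2r//; first by rewrite mulr_ge0// exprn_ge0// ltW.
by rewrite ler_weXn2l ?leq_subr//; have : (0 : R) <= n%:R by []; lra.
Qed.

Section CellBound.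
Variable B : R.
Hypothesis B_gt0 : 0 < B.
Hypothesis cellB : forall s x, (size s <= p)%N -> `|dpartial (@cell R n p) s x| <= B.

Lemma scaled_bound_chi m (q : box m) x : scaled_bound p (mesh m) B (chi q) x.
Proof.
move=> s sp; rewrite (dpartial_affine (2 ^+ m) (- grid R q) x (@Cp_cell R n p) sp).
rewrite normrM mulrA normrX ger0_norm ?exprn_ge0// -exprMn mulVf ?expr1n ?mul1r.
  exact: cellB.
by rewrite gt_eqF// exprn_gt0.
Qed.

(** Distance 2 rather than 1, so that a whole neighbourhood of [x] misses the cell and all
    derivatives vanish at [x]. *)
Lemma scaled_bound_chi_out m (q : box m) d g x : 2 <= `|2 ^+ m *: x - grid R q| ->
  scaled_bound p d 0 (fun y => chi q y * g y) x.
Proof.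
rewrite cell_distE ler_pdivlMr ?mesh_gt0// => h.
have xO : mesh m < `|x - mesh m *: grid R q| by apply: lt_le_trans h; have := mesh_gt0 m; lra.
apply: (scaled_bound_eq_on (f := fun=> 0) (@open_norm_gt _ _ (mesh m *: grid R q) (mesh m)) xO).
  move=> y /= yO; rewrite /chi cell_out ?mul0r// cell_distE ler_pdivlMr ?mesh_gt0// mul1r.
  exact: ltW.
by have := @scaled_bound_cst R n p d 0 x; rewrite normr0.
Qed.

(** The chain rule makes the scaled bound of each cell independent of [m], and at most 4^n cells
    count at [x]; thus the constant is the same at every scale. *)
Lemma scaled_bound_cells m (b : R) (G : box m -> pt -> R) x : 0 <= b ->
  (forall q, near_K q -> Cp p setT (G q)) ->
  (forall q, near_K q -> `|2 ^+ m *: x - grid R q| < 2 -> scaled_bound p (mesh m) b (G q) x) ->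
  scaled_bound p (mesh m) (4 ^+ n * (2 ^+ p * (B * b)))
    (fun y => \sum_(q : box m | near_K q) chi q y * G q y) x.
Proof.
move=> b0 cG HG.
have m0 := ltW (mesh_gt0 m).
pose A (q : box m) := if `|2 ^+ m *: x - grid R q| < 2 then 2 ^+ p * (B * b) else 0.
have cst0 : 0 <= 2 ^+ p * (B * b) by rewrite !mulr_ge0 ?exprn_ge0// ltW.
have A0 q : 0 <= A q by rewrite /A; case: ifP.
apply: (scaled_boundW (d := mesh m) (A := \sum_(q : box m | near_K q) A q)).
- by rewrite m0 lexx.
- apply: (@le_trans _ _ (\sum_(q : box m) A q)).
    by rewrite [leRHS](bigID (@near_K m)) /= lerDl sumr_ge0.
  apply: (@sum_near_cells R n _ (2 ^+ m *: x)) => // q; rewrite /A; case: ifP => //.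
  by move=> h; rewrite leNgt h.
apply: (@scaled_bound_sum R n p (mesh m) _ _ (@near_K m) A (fun q y => chi q y * G q y) setT x m0 openT) => //.
- by move=> q qn; apply: (Cp_mul openT); [exact: Cp_chi|exact: cG].
- move=> q qn; rewrite /A; case: ltP => h; last exact: scaled_bound_chi_out.
  apply: (scaled_bound_mul m0 openT) => //; [exact: Cp_chi|exact: cG|exact: scaled_bound_chi|exact: HG].
Qed.

(** Where the weights sum to 1 this is [near_blend m] minus [P c], written through differences of
    Taylor polynomials that the Whitney condition makes small. *)
Definition blend_diff m c x : R := \sum_(q : box m | near_K q) chi q x * (P (apick q) x - P c x).

Lemma blend_diffE m c x : blend_diff m c x = near_blend m x - near_weight m x * P c x.
Proof.
rewrite /blend_diff /near_blend /near_weight mulr_suml -sumrB; apply: eq_bigr => q _; by rewrite mulrBr.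
Qed.

Lemma Cp_diff a c : Cp p setT (fun y => P a y - P c y).
Proof. by apply: (Cp_sub_fun openT); exact: Cp_tjet0. Qed.

Lemma Cp_blend_diff m c : Cp p setT (blend_diff m c).
Proof.
rewrite (_ : blend_diff m c = fun x => \sum_(q : box m | near_K q) chi q x * (P (apick q) x - P c x))//.
apply: Cp_sum; [exact: openT|move=> q _; apply: (Cp_mul openT); [exact: Cp_chi|exact: Cp_diff]].
Qed.

Definition blend_const : R := 4 ^+ n * (2 ^+ p * (B * (40 * (1 + n%:R)) ^+ p)).

Lemma blend_const_ge0 : 0 <= blend_const.
Proof. by rewrite /blend_const !mulr_ge0 ?exprn_ge0 ?mulr_ge0 ?addr_ge0// ltW. Qed.

Lemma scaled_bound_blend_diff m c e x : K c -> 0 <= e -> `|x - c| <= 12 * mesh m ->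
  (forall a, K a -> `|x - a| <= 6 * mesh m -> whitney_pair a c e) ->
  scaled_bound p (mesh m) (blend_const * e * mesh m ^+ p) (blend_diff m c) x.
Proof.
move=> Kc e0 xc W; have m0 := mesh_gt0 m.
rewrite /blend_diff; have -> : blend_const * e * mesh m ^+ p = 4 ^+ n * (2 ^+ p * (B *
   ((40 * (1 + n%:R)) ^+ p * e * mesh m ^+ p))) by rewrite /blend_const; ring.
apply: scaled_bound_cells.
- have h40 : 0 <= 40 * (1 + n%:R) :> R by rewrite mulr_ge0// addr_ge0.
  by apply: mulr_ge0; [apply: mulr_ge0 => //; exact: exprn_ge0|exact: exprn_ge0 (ltW m0)].
- by move=> q _; exact: Cp_diff.
move=> q /apickP [Ka Ha]; rewrite cell_distE ltr_pdivrMr// => h.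
have xa : `|x - apick q| <= 6 * mesh m.
  have -> : x - apick q = (x - mesh m *: grid R q) + (mesh m *: grid R q - apick q).
    by rewrite addrA subrK.
  by apply: le_trans (ler_normD _ _) _; lra.
apply: scaled_bound_diff => //; first exact: W.
  have -> : c - apick q = (x - apick q) - (x - c) by rewrite opprB [RHS]addrC addrA subrK.
  by apply: le_trans (ler_normB _ _) _; lra.
by apply: le_lt_trans xc _; lra.
Qed.

Lemma scaled_bound_near_weight m x :
  scaled_bound p (mesh m) (1 + 4 ^+ n * (2 ^+ p * B)) (fun y => 1 - near_weight m y) x.
Proof.
have H : scaled_bound p (mesh m) (4 ^+ n * (2 ^+ p * (B * 1))) (near_weight m) x.
  rewrite (_ : near_weight m = fun y => \sum_(q : box m | near_K q) chi q y * (fun=> 1) y); last first.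
    by apply/funext => y; apply: eq_bigr => q _; rewrite mulr1.
  apply: scaled_bound_cells => // [q _|q _ _]; first by apply: Cp_cst; exact: openT.
  by rewrite -[X in scaled_bound _ _ X](@normr1 R); exact: scaled_bound_cst.
rewrite (_ : (fun y => 1 - near_weight m y) = fun y => 1 + - 1 * near_weight m y); last first.
  by apply/funext => y; rewrite mulN1r.
apply: (scaled_bound_add (ltW (mesh_gt0 m)) openT) => //.
- by apply: Cp_cst; exact: openT.
- by apply: (Cp_scale _ openT); exact: Cp_near_weight.
- by rewrite -[X in scaled_bound _ _ X](@normr1 R); exact: scaled_bound_cst.
have := scaled_bound_scale (-1) openT (I : setT x) (Cp_near_weight m) H.
by rewrite normrN normr1 mul1r mulr1.
Qed.

(** The inner [2 ^+ p] converts from the mesh of stage [k] to the half as large one of stage [k.+1];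
    the outer one is Leibniz' constant. *)
Definition stage_const : R := 2 ^+ p * ((1 + 4 ^+ n * (2 ^+ p * B)) * (blend_const * 2 ^+ p)) + blend_const.

Lemma stage_const_ge0 : 0 <= stage_const.
Proof. by rewrite /stage_const !(addr_ge0, mulr_ge0) ?exprn_ge0 ?blend_const_ge0// ltW. Qed.

(* In this region [stage k] is a pure blend, so that [stage k.+1 - P c] is a
   combination of the two differences [blend_diff k c] and [blend_diff k.+1 c]. *)
Lemma scaled_bound_stage k c e x : K c -> 0 <= e -> `|x - c| < 6 * mesh k.+1 ->
  (forall a, K a -> `|x - a| <= 12 * mesh k.+1 -> whitney_pair a c e) ->
  scaled_bound p (mesh k.+1) (stage_const * e * mesh k.+1 ^+ p) (fun y => stage k.+1 y - P c y) x.
Proof.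
move=> Kc e0 xc W; have m0 := mesh_gt0 k.+1.
have E := meshS k.
have mk : 3 * mesh k = 6 * mesh k.+1 by rewrite E; ring.
have xO : `|x - c| < 3 * mesh k by rewrite mk.
apply: (scaled_bound_eq_on (f := fun y => (1 - near_weight k.+1 y) * blend_diff k c y + blend_diff k.+1 c y)
   (@open_norm_lt _ _ c (3 * mesh k)) xO).
  move=> y /= yc; rewrite !blend_diffE (stage_near Kc yc) (near_weight1 Kc yc) mul1r; ring.
have ch : Cp p setT (fun y => (1 - near_weight k.+1 y) * blend_diff k c y).
  apply: (Cp_mul openT); last exact: Cp_blend_diff.
  by apply: (Cp_sub_fun openT); [apply: Cp_cst; exact: openT|exact: Cp_near_weight].
have -> : stage_const * e * mesh k.+1 ^+ p =
   2 ^+ p * ((1 + 4 ^+ n * (2 ^+ p * B)) * (blend_const * e * mesh k ^+ p)) + blend_const * e * mesh k.+1 ^+ p.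
  by rewrite E exprMn /stage_const; ring.
apply: (scaled_bound_add (ltW m0) openT) => //; first exact: Cp_blend_diff.
  apply: (scaled_bound_mul (ltW m0) openT) => //.
  - by apply: (Cp_sub_fun openT); [apply: Cp_cst; exact: openT|exact: Cp_near_weight].
  - exact: Cp_blend_diff.
  - exact: scaled_bound_near_weight.
  - apply: (scaled_boundW (d := mesh k) (A := blend_const * e * mesh k ^+ p)) => //.
      by rewrite ltW//= E; lra.
    apply: scaled_bound_blend_diff => //; first by rewrite E; lra.
    by move=> a Ka xa; apply: W => //; rewrite E in xa; lra.
apply: scaled_bound_blend_diff => //; first lra.
by move=> a Ka xa; apply: W => //; lra.
Qed.

End CellBound.
Hypothesis clK : closed K.
Hypothesis whitK : forall c, K c -> forall e, 0 < e -> exists2 d, 0 < d &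
  forall a b, K a -> K b -> `|a - c| < d -> `|b - c| < d -> whitney_pair a b e.

(** The least scale after which no cell touches a neighbourhood of [x]. If [m] is positive,
    minimality gives a point of [K] within 5 + 1 meshes, the extra mesh being the [rho] tried for
    the previous scale. *)
Lemma far_scale x : ~ K x -> exists m, exists2 rho, 0 < rho &
  (forall a, K a -> 5 * mesh m.+1 + rho <= `|x - a|) /\
  (m = 0%N \/ exists2 c, K c & `|x - c| < 6 * mesh m).
Proof.
move=> nKx.
pose Q m := `[< exists2 rho, 0 < rho & forall a, K a -> 5 * mesh m.+1 + rho <= `|x - a| >].
have exQ : exists m, Q m.
  have oK : open (~` K) by rewrite openC.
  have /nbhs_ballP [r /= r0 Hr] := open_nbhs_nbhs (conj oK nKx).
  have [m mr] := dyadic_lt (divr_gt0 r0 (ltr0n _ 10)).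
  exists m; apply/asboolP; exists (r / 2); first by rewrite divr_gt0.
  move=> a Ka; have ra : r <= `|x - a|.
    by rewrite leNgt; apply/negP => h; apply: (Hr a) => //; rewrite -ball_normE.
  by have := meshS m; have := mesh_gt0 m.+1; rewrite -/(mesh m) in mr; lra.
have [m /asboolP [rho rho0 Hm0] mmin] := ex_minnP exQ.
exists m; exists rho => //; split => //; case: m mmin {Hm0} => [|k] mmin; [by left|right].
apply: contrapT => H; have : Q k; last by move=> /mmin; rewrite ltnn.
apply/asboolP; exists (mesh k.+1); first exact: mesh_gt0.
move=> a Ka; rewrite leNgt; apply/negP => h; apply: H; exists a => //; lra.
Qed.

Lemma extension_ball m (rho : R) x y : (forall a, K a -> 5 * mesh m.+1 + rho <= `|x - a|) ->
  `|y - x| < rho -> extension y = stage m y.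
Proof.
move=> H yx; apply: extension_far => a Ka; have := H a Ka.
have -> : x - a = (y - a) - (y - x) by rewrite opprB [RHS]addrC addrA subrK.
by move=> h; have := le_trans h (ler_normB _ _); lra.
Qed.

(** Let [c] be a point of [K] whose distance from [x] is comparable with the mesh. The extension is
    close to the Taylor polynomial at [c] by the stage estimate, and this one to the polynomial at
    [c0] by the Whitney condition on [K]. *)
Lemma extension_estimate c0 e : K c0 -> 0 < e -> exists2 d, 0 < d &
  forall x t, ~ K x -> `|x - c0| < d -> (size t <= p)%N ->
  `|dpartial extension t x - J c0 t x| <= e * `|x - c0| ^+ (p - size t).
Proof.
move=> Kc0 e0.
have [B B0 HB] : exists2 B, 0 < B & forall s x, (size s <= p)%N -> `|dpartial (@cell R n p) s x| <= B.
  by apply: (@Cp_support_bounded R n p (@cell R n p) 0 1 (@Cp_cell R n p)) => x; rewrite subr0; exact: cell_out.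
pose C4 : R := (4 * (1 + n%:R)) ^+ p.
have n0 : (0 : R) <= n%:R by [].
have C41 : 1 <= C4 by rewrite /C4 exprn_ege1//; lra.
have sc0 := stage_const_ge0 B0.
pose C := stage_const B + C4.
have C0 : 0 < C by rewrite /C; lra.
pose e1 := e / C.
have e10 : 0 < e1 by rewrite divr_gt0.
have [d d0 Hd] := whitK Kc0 e10.
(* The bound 1 excludes [m = 0], where the distance to [K] exceeds 5/2. Otherwise the mesh is below
   2r/5, so every point of [K] involved is within r + 12 * 2r/5 < 10r of [c0]. *)
exists (Num.min (d / 10) 1); first by rewrite lt_min ltr01 divr_gt0.
move=> x t nKx; rewrite lt_min; set r := `|x - c0| => /andP[rd r1] tp.
have r0 : 0 < r by rewrite normr_gt0 subr_eq0; apply/eqP => E; rewrite E in nKx.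
have [m [rho rho0 [Hrho Hm0]]] := far_scale nKx.
have mr := Hrho _ Kc0; rewrite -/r in mr.
case: m Hm0 Hrho mr => [|k] Hm0 Hrho mr.
  by move: mr; have := meshS 0; rewrite {1}/mesh expr0 invr1; lra.
case: Hm0 => // -[c Kc xc].
have mS := meshS k.+1.
set mu := mesh k.+1 in xc mS.
have mu0 : 0 < mu := mesh_gt0 k.+1.
have mur : mu < 2 / 5 * r by lra.
have W : forall a, K a -> `|x - a| <= 12 * mu -> whitney_pair a c e1.
  move=> a Ka xa; apply: Hd => //.
    have -> : a - c0 = (x - c0) - (x - a) by rewrite opprB [RHS]addrC addrA subrK.
    by apply: le_lt_trans (ler_normB _ _) _; rewrite -/r; lra.
  have -> : c - c0 = (x - c0) - (x - c) by rewrite opprB [RHS]addrC addrA subrK.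
  by apply: le_lt_trans (ler_normB _ _) _; rewrite -/r; lra.
have SB := scaled_bound_stage B0 HB Kc (ltW e10) xc W.
have H1 : `|dpartial extension t x - J c t x| <= stage_const B * e1 * r ^+ (p - size t).
  have xO : `|x - x| < rho by rewrite subrr normr0.
  rewrite (dpartial_eq_on (g := stage k.+1) t (@open_norm_lt _ _ x rho) _ xO); last first.
    by move=> y; exact: extension_ball.
  have := SB t tp; rewrite (dpartial_sub openT (I : setT x) (Cp_stage _) (Cp_tjet0 c) tp).
  rewrite dpartial_tjet// -/mu -[in mu ^+ p](subnKC tp) exprD => H.
  have {}H : `|dpartial (stage k.+1) t x - J c t x| <= stage_const B * e1 * mu ^+ (p - size t).
    have mut : 0 < mu ^+ size t by rewrite exprn_gt0.
    by rewrite -(ler_pM2l mut); apply: le_trans H _; rewrite le_eqVlt; apply/orP; left; apply/eqP; ring.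
  apply: le_trans H _; apply: ler_wpM2l; first by rewrite mulr_ge0// ltW.
  by apply: lerXn2r; rewrite ?nnegrE; lra.
have H2 : `|J c t x - J c0 t x| <= C4 * e1 * r ^+ (p - size t).
  have Wc : whitney_pair c c0 e1.
    apply: Hd => //; last by rewrite subrr normr0.
    have -> : c - c0 = (x - c0) - (x - c) by rewrite opprB [RHS]addrC addrA subrK.
    by apply: le_lt_trans (ler_normB _ _) _; rewrite -/r; lra.
  have h1 : `|c0 - c| <= 4 * r.
    have -> : c0 - c = (x - c) - (x - c0) by rewrite opprB [RHS]addrC addrA subrK.
    by apply: le_trans (ler_normB _ _) _; rewrite -/r; lra.
  have h2 : `|x - c0| < 4 * r by rewrite -/r; lra.
  apply: le_trans (jet_compare Kc Kc0 (ltW e10) Wc h1 h2 tp) _.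
  rewrite exprMn.
  have -> : (1 + n%:R) ^+ (p - size t) * e1 * (4 ^+ (p - size t) * r ^+ (p - size t)) =
    (4 * (1 + n%:R)) ^+ (p - size t) * (e1 * r ^+ (p - size t)) by rewrite exprMn; ring.
  rewrite -[leRHS]mulrA ler_wpM2r//; first by rewrite mulr_ge0 ?exprn_ge0// ltW.
  by rewrite /C4 ler_weXn2l ?leq_subr//; lra.
have -> : dpartial extension t x - J c0 t x = (dpartial extension t x - J c t x) + (J c t x - J c0 t x).
  by rewrite addrA subrK.
apply: le_trans (ler_normD _ _) _; apply: le_trans (lerD H1 H2) _.
rewrite -mulrDl -mulrDl -/C /e1 [C * _]mulrC divfK ?gt_eqF//.
Qed.

Lemma whitney_extension : Cp p setT extension.
Proof.
(* The candidate jet. The estimate [est] holds both on and off [K], so at a point of [K] the family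
   [G] inherits continuity and derivatives from the Taylor jet. *)
pose G t x := if `[< K x >] then l t x else dpartial extension t x.
have est a : K a -> forall e, 0 < e -> exists2 d, 0 < d & forall x t, `|x - a| < d ->
    (size t <= p)%N -> `|G t x - J a t x| <= e * `|x - a| ^+ (p - size t).
  move=> Ka e e0; have [d1 d10 H1] := extension_estimate Ka e0; have [d2 d20 H2] := whitK Ka e0.
  exists (Num.min d1 d2); first by rewrite lt_min d10.
  move=> x t; rewrite lt_min => /andP[x1 x2] tp; rewrite /G; case: asboolP => [Kx|nKx].
    by apply: (H2 a x) => //; rewrite subrr normr0.
  exact: H1.
apply: (jet_Cp openT (G := G)); last first.
  by move=> x _; rewrite /G; case: asboolP => // Kx; rewrite /= /extension; case: asboolP.
have oK : open (~` K) by rewrite openC.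
have GE t x : ~ K x -> dpartial extension t x = G t x by move=> nKx; rewrite /G; case: asboolP.
have cpN : Cp p (~` K) extension.
  apply: Cp_local => // x nKx; have [m [rho rho0 [Hrho _]]] := far_scale nKx.
  exists [set y | `|y - x| < rho].
    by split; [exact: open_norm_lt|rewrite /= subrr normr0].
  apply: (Cp_eq (f := stage m) (@open_norm_lt _ _ x rho)).
    by move=> y /= yx; rewrite (extension_ball Hrho yx).
  by apply: (Cp_sub (leqnn p) (subsetT _)); exact: Cp_stage.
have jN := Cp_jet cpN.
have GJ a t : K a -> G t a = J a t a.
  by move=> Ka; rewrite /G asboolT// /tjet subrr taylor_at0.
move=> t tp; split=> [x _|tp' i x _].
  have [Kx|nKx] := pselect (K x); last first.
    by apply: (continuous_eq_on oK nKx (GE t)); have [H _] := jN t tp; exact: H.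
  apply/continuousE => e e0.
  have e20 : 0 < e / 2 by rewrite divr_gt0.
  have [d1 d10 H1] := est x Kx (e / 2) e20.
  have [cJ _] := jet_tjet x setT (symK Kx) tp.
  move/continuousE: (cJ x I) => /(_ _ e20) [d2 d20 H2].
  exists (Num.min 1 (Num.min d1 d2)); first by rewrite !lt_min ltr01 d10.
  move=> y; rewrite !lt_min => /and3P[y0 y1 y2]; rewrite (GJ x)//.
  have -> : G t y - J x t x = (G t y - J x t y) + (J x t y - J x t x) by rewrite addrA subrK.
  apply: le_lt_trans (ler_normD _ _) _.
  have := H1 y t y1 tp; have := H2 y y2.
  have : e / 2 * `|y - x| ^+ (p - size t) <= e / 2.
    by apply: ler_piMr; [exact: ltW|rewrite exprn_ile1// ltW].
  lra.
have [Kx|nKx] := pselect (K x); last first.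
  have [_ /(_ tp' i x nKx)] := jN t tp; rewrite -(GE (i :: t))//.
  by apply: is_derive_eq_on oK nKx _; exact: GE.
apply/is_deriveE => e e0.
have e20 : 0 < e / 2 by rewrite divr_gt0.
have [d1 d10 H1] := est x Kx (e / 2) e20.
have [_ /(_ tp' i x I)] := jet_tjet x setT (symK Kx) tp.
move=> /is_deriveE /(_ _ e20) [d2 d20 H2].
exists (Num.min 1 (Num.min d1 d2)); first by rewrite !lt_min ltr01 d10.
move=> u; rewrite !lt_min => /and3P[u0 u1 u2]; rewrite (GJ x)// (GJ x)//.
have yx : `|x + u *: evec R i - x| = `|u| by rewrite addrAC subrr add0r normrZ norm_evec mulr1.
have -> : G t (x + u *: evec R i) - J x t x - u * J x (i :: t) x =
  (G t (x + u *: evec R i) - J x t (x + u *: evec R i)) +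
  (J x t (x + u *: evec R i) - J x t x - u * J x (i :: t) x) by ring.
apply: le_trans (ler_normD _ _) _.
have := H2 u u2; have := H1 (x + u *: evec R i) t; rewrite yx => /(_ u1 tp).
(* The exponent is at least 1 because [size t < p], and |u| < 1. *)
have : e / 2 * `|u| ^+ (p - size t) <= e / 2 * `|u|.
  apply: ler_wpM2l; first exact: ltW.
  have -> : (p - size t = (p - (size t).+1).+1)%N by lia.
  by rewrite exprSr ler_piMl// exprn_ile1// ltW.
lra.
Qed.

Lemma extension_on a : K a -> extension a = l [::] a.
Proof. by move=> Ka; rewrite /extension asboolT. Qed.

End Whitney.

(** * The bundles along a chart *)

Section Functionals.
Variables (R : realType) (n p : nat).
Local Notation pt := 'rV[R]_n.
Local Notation midx := 'X_{1..n < p.+1}.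
Implicit Types (x y a b : pt) (s t : seq 'I_n).

Lemma eucl_le_norm (v : pt) : eucl v <= (1 + n%:R) * `|v|.
Proof.
have h0 : 0 <= (1 + n%:R) * `|v| by rewrite mulr_ge0// addr_ge0.
rewrite /eucl -(ler_sqr (sqrtr_ge0 _) h0) sqr_sqrtr; last by apply: sumr_ge0 => i _; exact: sqr_ge0.
apply: (@le_trans _ _ (\sum_(i < n) `|v| ^+ 2)).
  apply: ler_sum => i _; rewrite -real_normK ?num_real// lerXn2r ?nnegrE//.
  exact: coord_le_norm.
rewrite sumr_const card_ord exprMn -[_ *+ n]mulr_natl ler_wpM2r ?exprn_ge0//.
have : (0 : R) <= n%:R by []; nra.
Qed.

Lemma norm_le_eucl (v : pt) : `|v| <= eucl v.
Proof.
apply: norm_le_coord => [|i]; first exact: sqrtr_ge0.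
rewrite -sqrtr_sqr ler_wsqrtr// (bigD1 i)//= lerDl sumr_ge0// => j _; exact: sqr_ge0.
Qed.

Lemma eucl_ge0 (v : pt) : 0 <= eucl v. Proof. exact: sqrtr_ge0. Qed.

Definition peval (P : {mpoly R[n]}) (x : pt) : R := P.@[fun i => x 0 i].
Definition mon (al : midx) (x : pt) : R := peval 'X_[bmnm al] x.

Lemma shifted_monE (al : midx) b x :
  peval (shifted_mon al b) x = (mfact R al)^-1 * \prod_(i < n) (x 0 i - b 0 i) ^+ mcomp al i.
Proof.
rewrite /peval /shifted_mon mevalZ rmorph_prod /=; congr (_ * _).
by apply: eq_bigr => i _; rewrite rmorphXn /= mevalB mevalXU mevalC.
Qed.

Lemma msize_le1 d e (P Q : {mpoly R[n]}) : (msize P <= d.+1)%N -> (msize Q <= e.+1)%N ->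
  (msize (P * Q) <= (d + e).+1)%N.
Proof.
have [->|P0] := eqVneq P 0; first by rewrite mul0r msize0.
have [->|Q0] := eqVneq Q 0; first by rewrite mulr0 msize0.
move=> h1 h2; rewrite msizeM//.
by move: h1 h2; move: (mmeasure mdeg P) (mmeasure mdeg Q) => u v; lia.
Qed.

Lemma msize_shifted (al : midx) b : (msize (shifted_mon al b) <= p.+1)%N.
Proof.
apply: (@leq_trans (mdegb al).+1); last exact: bmdeg.
apply: leq_trans (msizeZ_le _ _) _; rewrite /mdegb mdegE.
apply: (@big_ind2 _ _ (fun (P : {mpoly R[n]}) d => (msize P <= d.+1)%N)).
- by rewrite msize1.
- by move=> P d Q e; exact: msize_le1.
move=> i _; rewrite -[bmnm al i]/(mcomp al i); elim: (mcomp al i) => [|k IH]; first by rewrite expr0 msize1.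
rewrite exprS; apply: (@msize_le1 1 k) => //.
rewrite -mpolyCN; apply: leq_trans (mmeasureD_le _ _ _) _.
by rewrite geq_max msizeX mdeg1 mmeasureC; case: eqP.
Qed.

Lemma Cp_mon q (U : set pt) (psi : pt -> pt) (al : midx) : open U ->
  (forall j, Cp q U (fun x => psi x 0 j)) -> Cp q U (fun x => mon al (psi x)).
Proof.
move=> oU cpsi; rewrite (_ : (fun x => _) = fun x => \prod_(i < n) (psi x 0 i) ^+ bmnm al i).
  by apply: Cp_prod => // i _; apply: Cp_exp.
by apply/funext => x; rewrite /mon /peval mevalX.
Qed.

Definition push (psi : pt -> pt) s y : dual R n p := fun al => dpartial (fun x => mon al (psi x)) s y.

(** A shifted monomial has degree at most p, hence is a combination of the monomials on which [push]
    is recorded, and D^s is linear. *)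
Lemma xi_at_push (U : set pt) (psi : pt -> pt) s y (al : midx) b : open U -> U y ->
  (forall j, Cp p U (fun x => psi x 0 j)) -> (size s <= p)%N ->
  xi_at (push psi s y) al b = dpartial (fun x => peval (shifted_mon al b) (psi x)) s y.
Proof.
move=> oU Uy cpsi sp; rewrite /xi_at /dual_app /push.
rewrite -(dpartial_sum (p := p) (U := U) (fun be : midx => (shifted_mon al b)@_(bmnm be))
   (F := fun be x => mon be (psi x)))//; last by move=> be _; exact: Cp_mon.
congr (dpartial _ s y); apply/funext => x.
rewrite [in RHS](mpolywE (msize_shifted al b)) /peval raddf_sum /=.
by apply: eq_bigr => be _; rewrite mevalZ.
Qed.

Lemma scaled_bound_shifted (U : set pt) (psi : pt -> pt) y (al : midx) (A d : R) : open U -> U y ->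
  (forall j, Cp p U (fun x => psi x 0 j)) -> 0 < d -> d <= 1 -> 1 <= A ->
  (forall j s, (size s <= p)%N -> `|dpartial (fun x => psi x 0 j) s y| <= A) ->
  scaled_bound p d ((2 ^+ p) ^+ n * (2 ^+ p * A) ^+ p * d ^+ mdegb al)
    (fun x => peval (shifted_mon al (psi y)) (psi x)) y.
Proof.
move=> oU Uy cpsi d0 d1 A1 HA.
have A0 : 0 <= A by lra.
have cj j : Cp p U (fun x => psi x 0 j - psi y 0 j).
  by apply: Cp_sub_fun => //; exact: Cp_cst.
(* The factor vanishes at [y], and every derivative carries at least one power of [d <= 1]; so one
   power of [d] can be extracted. *)
have bj j : scaled_bound p d (A * d) (fun x => psi x 0 j - psi y 0 j) y.
  move=> s sp; rewrite (dpartial_sub oU Uy (cpsi j) (Cp_cst _ oU) sp).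
  case: s sp => [|i s] sp.
    by rewrite /= subrr normr0 mulr0 mulr_ge0// ltW.
  rewrite dpartial_cst// subr0 mulrC; apply: ler_pM => //; first by rewrite exprn_ge0// ltW.
    exact: HA.
  by rewrite /= exprS; apply: ler_piMr; [exact: ltW|rewrite exprn_ile1// ltW].
have be j : scaled_bound p d ((2 ^+ p * (A * d)) ^+ mcomp al j) (fun x => (psi x 0 j - psi y 0 j) ^+ mcomp al j) y.
  exact: scaled_bound_exp (ltW d0) oU Uy (cj j) (bj j).
have bp := scaled_bound_prod (index_enum 'I_n) (ltW d0) oU Uy
   (fun j => Cp_exp (mcomp al j) oU (cj j)) be.
have cp : Cp p U (fun x => \prod_(i < n) (psi x 0 i - psi y 0 i) ^+ mcomp al i).
  by apply: Cp_prod => // j _; exact: Cp_exp.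
have := scaled_bound_scale (mfact R al)^-1 oU Uy cp bp.
rewrite (_ : (fun x => peval (shifted_mon al (psi y)) (psi x)) = fun x => (mfact R al)^-1 * \prod_(i < n) (psi x 0 i - psi y 0 i) ^+ mcomp al i); last first.
  by apply/funext => x; rewrite shifted_monE.
apply: scaled_boundW; first by rewrite lexx ltW.
have E : \prod_(k <- index_enum 'I_n) (2 ^+ p * (2 ^+ p * (A * d)) ^+ mcomp al k) =
    (2 ^+ p) ^+ n * ((2 ^+ p * A) ^+ mdegb al * d ^+ mdegb al).
  rewrite big_split /= prodr_const card_ord; congr (_ * _).
  rewrite -exprMn -mulrA /mdegb mdegE.
  by elim/big_rec2: _ => [|j k m _ ->]; rewrite ?expr0// exprD.
rewrite E.
have f1 : `|(mfact R al)^-1| <= 1.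
  have f1 : 1 <= mfact R al.
    rewrite /mfact; elim/big_ind: _ => // [u v|i _]; first exact: mulr_ege1.
    by rewrite ler1n fact_gt0.
  by rewrite normfV ger0_norm ?invf_le1 //; lra.
have X0 : 0 <= (2 ^+ p) ^+ n * ((2 ^+ p * A) ^+ mdegb al * d ^+ mdegb al).
  by rewrite mulr_ge0 ?exprn_ge0// mulr_ge0 ?exprn_ge0 ?mulr_ge0 ?exprn_ge0// ltW.
apply: (le_trans (ler_piMl X0 f1)).
rewrite -mulrA; apply: ler_wpM2l; first by rewrite !exprn_ge0.
apply: ler_wpM2r; first by rewrite exprn_ge0// ltW.
apply: ler_weXn2l; last by have := bmdeg al; rewrite ltnS.
by apply: mulr_ege1 => //; rewrite exprn_ege1// ler1n.
Qed.

End Functionals.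

(* The upper limit of the values as the parameter tends to 0. *)
Lemma cluster_value (R : realType) (Q : R -> set R) (d0 B : R) :
  (forall d d' u, d <= d' -> Q d u -> Q d' u) -> (forall d, 0 < d -> Q d !=set0) ->
  0 < d0 -> (forall u, Q d0 u -> `|u| <= B) ->
  exists u0, forall e d, 0 < e -> 0 < d -> exists2 u, Q d u & `|u0 - u| < e.
Proof.
move=> mono ne d00 bd.
pose S := [set s | exists2 d, 0 < d & forall u, Q d u -> u <= s].
have SB : S B by exists d0 => // u /bd; exact: le_trans (ler_norm _).
have lbS : lbound S (- B).
  move=> s [d dp Hs].
  have mp : 0 < Num.min d d0 by rewrite lt_min dp.
  have [u Qu] := ne _ mp.
  have h1 : u <= s by apply: Hs; apply: mono Qu; rewrite ge_min lexx.
  have := bd u; rewrite ler_norml; have Qd : Q d0 u by apply: mono Qu; rewrite ge_min lexx orbT.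
  by move=> /(_ Qd) /andP[]; lra.
exists (inf S) => e d e0 dp.
have [s [ds ds0 Hs] sS] : exists2 s, S s & s < inf S + e.
  by apply: inf_adherent => //; split; [exists B|exists (- B)].
pose m := Num.min d ds.
have mp : 0 < m by rewrite lt_min dp.
have [u Qu ue] : exists2 u, Q m u & inf S - e < u.
  apply: contrapT => H; have : S (inf S - e).
    exists m => // u Qu; rewrite leNgt; apply/negP => h; apply: H; by exists u.
  by move=> /(ge_inf (ex_intro _ _ lbS)); lra.
exists u; first by apply: mono Qu; rewrite ge_min lexx.
have := Hs u (_ : Q ds u); have Qs : Q ds u by apply: mono Qu; rewrite ge_min lexx orbT.
by move=> /(_ Qs) h; rewrite ltr_norml; apply/andP; split; lra.
Qed.

(** * Iterates of the bundle operation and limits in them *)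

Section Levels.
Variables (R : realType) (n p : nat) (X : set 'rV[R]_n) (f : 'rV[R]_n -> R).
Local Notation pt := 'rV[R]_n.
Local Notation dual := (dual R n p).
Local Notation dzero := (@Defs.dzero R n p).
Local Notation dadd := (@Defs.dadd R n p).
Local Notation dscale := (@Defs.dscale R n p).
Implicit Types (a b : pt) (xi zeta : dual) (la nu : R) (k : nat).

Definition level k : bundleR R n p := iter k (@rhoPhi R n p X) (@Phi0 R n p X f).

Lemma eucl0 : eucl (0 : pt) = 0.
Proof. by rewrite /eucl big1 ?sqrtr0// => i _; rewrite mxE expr0n. Qed.

Lemma dadd0 xi : dadd xi dzero = xi.
Proof. by apply/funext => al; rewrite /Defs.dadd /Defs.dzero addr0. Qed.

Lemma xi_at_scale c xi al b : xi_at (dscale c xi) al b = c * xi_at xi al b.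
Proof.
rewrite /xi_at /dual_app mulr_sumr; apply: eq_bigr => be _; by rewrite /Defs.dscale mulrCA.
Qed.

Lemma xi_at0 al b : xi_at dzero al b = 0.
Proof. by rewrite /xi_at /dual_app big1// => be _; rewrite mulr0. Qed.

Lemma level_base k a xi la : level k a xi la -> X a.
Proof. by case: k => [|k] []. Qed.

Lemma dRspan_sub (S : dual -> R -> Prop) xi la : S xi la -> dRspan S xi la.
Proof.
move=> H; exists 1%N, (fun=> 1), (fun=> xi), (fun=> la).
by split=> //; split=> [al|]; rewrite big_ord1 mul1r.
Qed.

Lemma dRspan_scale (S : dual -> R -> Prop) c xi la :
  dRspan S xi la -> dRspan S (dscale c xi) (c * la).
Proof.
move=> [m [d [v [l [Sv [Ex ->]]]]]]; exists m, (fun j => c * d j), v, l; split=> //.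
split=> [al|]; first by rewrite /Defs.dscale Ex mulr_sumr; apply: eq_bigr => j _; rewrite mulrA.
by rewrite mulr_sumr; apply: eq_bigr => j _; rewrite mulrA.
Qed.

Lemma dRspan_add (S : dual -> R -> Prop) xi la xi' la' :
  dRspan S xi la -> dRspan S xi' la' -> dRspan S (dadd xi xi') (la + la').
Proof.
move=> [m [d [v [l [Sv [Ex ->]]]]]] [m' [d' [v' [l' [Sv' [Ex' ->]]]]]].
pose u T (g : 'I_m -> T) (g' : 'I_m' -> T) (j : 'I_(m + m')) :=
  match fintype.split j with inl i => g i | inr i => g' i end.
exists (m + m')%N, (u _ d d'), (u _ v v'), (u _ l l').
have ul T (g : 'I_m -> T) g' i : u T g g' (lshift m' i) = g i.
  by rewrite /u (unsplitK (inl i) : fintype.split (lshift m' i) = inl i).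
have ur T (g : 'I_m -> T) g' i : u T g g' (rshift m i) = g' i.
  by rewrite /u (unsplitK (inr i) : fintype.split (rshift m i) = inr i).
split; first by move=> j; rewrite /u; case: (fintype.split j).
split=> [al|]; rewrite big_split_ord /=.
  rewrite /Defs.dadd Ex Ex'; congr (_ + _); apply: eq_bigr => i _; first by rewrite !ul.
  by rewrite !ur.
by congr (_ + _); apply: eq_bigr => i _; rewrite ?ul ?ur.
Qed.

Lemma level_scale k a xi la c : level k a xi la -> level k a (dscale c xi) (c * la).
Proof.
case: k => [|k] /=; last by move=> [Xa H]; split=> //; exact: dRspan_scale.
move=> [Xa [d [-> ->]]]; split=> //; exists (c * d); split; last by rewrite mulrA.
by apply/funext => al; rewrite /Defs.dscale mulrA.
Qed.

Lemma level_add k a xi la xi' la' :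
  level k a xi la -> level k a xi' la' -> level k a (dadd xi xi') (la + la').
Proof.
case: k => [|k] /=; last by move=> [Xa H] [_ H']; split=> //; exact: dRspan_add.
move=> [Xa [d [-> ->]]] [_ [d' [-> ->]]]; split=> //; exists (d + d'); split; last by rewrite mulrDl.
by apply/funext => al; rewrite /Defs.dscale /Defs.dadd mulrDl.
Qed.

Lemma level0 k a : X a -> level k a dzero 0.
Proof.
move=> Xa; have E : dzero = dscale 0 (@Defs.delta R n p a) by apply/funext => al; rewrite /Defs.dscale mul0r.
elim: k => [|k IH]; first by split=> //; exists 0; rewrite mul0r.
by split=> //; exists 0%N, (fun=> 0), (fun=> dzero), (fun=> 0); split=> [[]//|]; split=> [al|]; rewrite big_ord0.
Qed.

(** The hypothesis concerns the scaled pairs, so a vanishing coefficient needs no knowledge of its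
    functional; [hpoly_level] uses this for the normal directions. *)
Lemma level_sum (I : Type) (s : seq I) k a (c : I -> R) (v : I -> dual) (l : I -> R) : X a ->
  (forall i, level k a (dscale (c i) (v i)) (c i * l i)) ->
  level k a (fun al => \sum_(i <- s) c i * v i al) (\sum_(i <- s) c i * l i).
Proof.
move=> Xa H; elim: s => [|i s IH].
  rewrite big_nil (_ : (fun al => _) = dzero); first exact: level0.
  by apply/funext => al; rewrite big_nil.
rewrite big_cons (_ : (fun al => _) = dadd (dscale (c i) (v i)) (fun al => \sum_(i <- s) c i * v i al)).
  exact: level_add.
by apply/funext => al; rewrite big_cons.
Qed.

Lemma DeltaPhi_diag k a xi la : level k a xi la -> DeltaPhi X (level k) a a xi la.
Proof.
move=> H; have Xa := level_base H; split=> //; split=> //; exists xi, la, dzero, 0.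
split=> //; split; first exact: level0.
rewrite dadd0 addr0; split=> //; split=> // al.
by rewrite xi_at0 normr0 mulr0.
Qed.

Lemma prime_level k a xi la : primePhi X (level k) a xi la -> level k.+1 a xi la.
Proof. by move=> H; split; [case: H|exact: dRspan_sub]. Qed.

Lemma level_succ k a xi la : level k a xi la -> level k.+1 a xi la.
Proof.
move=> H; apply: prime_level; split; first exact: level_base H.
move=> e e0; exists a, a, xi, la; split; first exact: DeltaPhi_diag.
rewrite !subrr eucl0 normr0; split=> //; split=> //; split=> // al.
by rewrite subrr normr0.
Qed.

Lemma level_mono k m a xi la : (k <= m)%N -> level k a xi la -> level m a xi la.
Proof.
move=> + H; elim: m => [|m IH]; first by rewrite leqn0 => /eqP <-.
rewrite leq_eqVlt => /orP[/eqP <- //|]; rewrite ltnS => /IH; exact: level_succ.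
Qed.

Lemma DeltaPhi_scale k a b zeta nu c : `|c| <= 1 -> DeltaPhi X (level k) a b zeta nu ->
  DeltaPhi X (level k) a b (dscale c zeta) (c * nu).
Proof.
move=> c1 [Xa [Xb [xi [la [eta [mu [H1 [H2 [-> [-> H3]]]]]]]]]].
split=> //; split=> //; exists (dscale c xi), (c * la), (dscale c eta), (c * mu).
split; first exact: level_scale.
split; first exact: level_scale.
split; first by apply/funext => al; rewrite /Defs.dscale /Defs.dadd mulrDr.
split; first by rewrite mulrDr.
move=> al; rewrite xi_at_scale normrM mulrCA; apply: mulr_ile1 => //.
by rewrite mulr_ge0// exprn_ge0// eucl_ge0.
Qed.

Variable N : nat.
Hypothesis nabla0 : forall a la, level N a dzero la -> la = 0.

Lemma level_uniq k a xi la la' : (k <= N)%N -> level k a xi la -> level k a xi la' -> la = la'.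
Proof.
move=> kN /(level_mono kN) H /(level_mono kN) H'.
have := level_add H (level_scale (-1) H').
rewrite (_ : dadd _ _ = dzero); last by apply/funext => al; rewrite /Defs.dadd /Defs.dscale mulN1r subrr.
by move=> /nabla0; rewrite mulN1r => /eqP; rewrite subr_eq0 => /eqP.
Qed.

(* Otherwise rescaling a violating sequence yields (a, 0, e) in the next level. *)
Lemma DeltaPhi_small k a e : (k < N)%N -> X a -> 0 < e -> exists2 d, 0 < d &
  forall a' b' zeta nu, DeltaPhi X (level k) a' b' zeta nu -> eucl (a - a') < d ->
    eucl (a - b') < d -> (forall al, `|zeta al| < d) -> `|nu| < e.
Proof.
move=> kN Xa e0; apply: contrapT => H.
suff : level k.+1 a dzero e.
  by move=> /(level_mono kN) /nabla0 E; move: e0; rewrite E ltxx.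
apply: prime_level; split=> // d d0.
apply: contrapT => H'; apply: H; exists d => // a' b' zeta nu D aa' ab' zd.
rewrite ltNge; apply/negP => enu; apply: H'.
have nu0 : 0 < `|nu| by apply: lt_le_trans enu.
have nun0 : nu != 0 by rewrite -normr_gt0.
have c1 : `|e / nu| <= 1 by rewrite normrM normfV (gtr0_norm e0) ler_pdivrMr// mul1r.
exists a', b', (dscale (e / nu) zeta), (e / nu * nu); split; first exact: DeltaPhi_scale.
split=> //; split=> //; split; last by rewrite divfK// subrr normr0.
move=> al; rewrite /Defs.dzero sub0r normrN /Defs.dscale normrM.
by apply: le_lt_trans (zd al); rewrite ler_piMl.
Qed.

(** Values over a convergent family of functionals stay bounded, so they cluster, and any cluster
    value belongs to the closure. *)
Lemma DeltaPhi_limit k a zeta : (k < N)%N -> X a ->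
  (forall d, 0 < d -> exists a' b' zeta' nu, DeltaPhi X (level k) a' b' zeta' nu /\
     eucl (a - a') < d /\ eucl (a - b') < d /\ dclose d zeta zeta') ->
  exists nu, level k.+1 a zeta nu.
Proof.
move=> kN Xa H.
pose Q d nu := exists a' b' zeta', DeltaPhi X (level k) a' b' zeta' nu /\
     eucl (a - a') < d /\ eucl (a - b') < d /\ dclose d zeta zeta'.
have [d1 d10 Hd1] := DeltaPhi_small kN Xa (@ltr01 R).
pose Z := \big[Num.max/0]_al `|zeta al| + 1.
have Zal al : `|zeta al| + 1 <= Z by rewrite lerD2r; exact: le_bigmax.
have Z0 : 0 < Z by apply: ltr_wpDl => //; apply: bigmax_ge_id.
(* A value beyond [B] could be rescaled to 1 over a functional smaller than [d1], against [Hd1]. *)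
pose B := Num.max 1 (Z / d1).
pose d0 := Num.min 1 d1.
have d00 : 0 < d0 by rewrite lt_min ltr01.
have [|d dp||nu|u0 Hu0] := @cluster_value R Q d0 B.
- move=> d d' nu dd' [a' [b' [z' [D [h1 [h2 h3]]]]]]; exists a', b', z'.
  split=> //; split; first exact: lt_le_trans dd'.
  split; first exact: lt_le_trans dd'.
  by move=> al; exact: lt_le_trans (h3 al) dd'.
- have [a' [b' [z' [nu HQ]]]] := H d dp.
  by exists nu, a', b', z'.
- exact: d00.
- move=> [a' [b' [z' [D [h1 [h2 h3]]]]]]; rewrite leNgt; apply/negP => nuB.
  move: nuB; rewrite gt_max => /andP[nu1 nuZ].
  have nu0 : 0 < `|nu| by apply: lt_trans nu1.
  have nun0 : nu != 0 by rewrite -normr_gt0.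
  have c1 : `|nu^-1| <= 1 by rewrite normfV invf_le1// ltW.
  suff : `|nu^-1 * nu| < 1 by rewrite mulVf// normr1 ltxx.
  apply: (Hd1 a' b' _ _ (DeltaPhi_scale c1 D)).
  - by apply: lt_le_trans h1 _; rewrite ge_min lexx orbT.
  - by apply: lt_le_trans h2 _; rewrite ge_min lexx orbT.
  move=> al; rewrite /Defs.dscale normrM normfV mulrC ltr_pdivrMr//.
  rewrite ltr_pdivrMr// mulrC in nuZ; apply: lt_trans nuZ; apply: lt_le_trans (Zal al).
  have := h3 al; rewrite lt_min => /andP[h _].
  have -> : z' al = zeta al - (zeta al - z' al) by rewrite opprB addrC subrK.
  by apply: le_lt_trans (ler_normB _ _) _; rewrite ltrD2l.
exists u0; apply: prime_level; split=> // e e0.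
have [nu [a' [b' [z' [D [h1 [h2 h3]]]]]] ne] := Hu0 e e e0 e0.
by exists a', b', z', nu.
Qed.

End Levels.

(** * Functionals along a chart and their weights *)

Section Chart.
Variables (R : realType) (n p : nat) (M X V : set 'rV[R]_n) (f : 'rV[R]_n -> R).
Variables (k : nat) (phi psi : 'rV[R]_n -> 'rV[R]_n).
Local Notation pt := 'rV[R]_n.
Local Notation W := (phi @` V).
Local Notation dadd := (@Defs.dadd R n p).
Local Notation dscale := (@Defs.dscale R n p).
Local Notation push := (@push R n p psi).
Local Notation level := (@level R n p X f).
Implicit Types (x y z a b c : pt) (s t : seq 'I_n).
Hypothesis oW : open W.
Hypothesis psiK : forall x, V x -> psi (phi x) = x.
Hypothesis cpsi : forall j : 'I_n, Cp p W (fun y => psi y 0 j).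

Lemma psi_in_chart y : W y -> V (psi y) /\ phi (psi y) = y.
Proof. by move=> [x Vx <-]; rewrite psiK. Qed.

(** For p = 0 the map [psi] is merely continuous, so the Lipschitz bound is asked for p > 0 only;
    when p = 0 all weights have exponent 0. *)
Lemma chart_bounds c : W c -> exists2 rho, 0 < rho & exists A L : R, [/\ 1 <= A, 1 <= L,
  forall y, `|y - c| < rho -> W y,
  forall y j s, `|y - c| < rho -> (size s <= p)%N -> `|dpartial (fun y => psi y 0 j) s y| <= A &
  forall y z, `|y - c| < rho -> `|z - c| < rho -> (0 < p)%N -> eucl (psi y - psi z) <= L * `|y - z|].
Proof.
move=> Wc.
have H j : exists2 d, 0 < d & forall s, (size s <= p)%N ->
    forall y, `|y - c| < d -> `|dpartial (fun y => psi y 0 j) s y| * d <= 1.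
  apply: (@common_word_radius R n p (fun s d => forall y, `|y - c| < d -> `|dpartial (fun y => psi y 0 j) s y| * d <= 1)).
    move=> s d d' Hd d'd y yd; apply: le_trans (Hd y (lt_le_trans yd d'd)); exact: ler_wpM2l.
  move=> s sp; have [/(_ c Wc) /continuousE /(_ 1 ltr01) [d d0 Hd] _] := Cp_jet (cpsi j) sp.
  pose B := `|dpartial (fun y => psi y 0 j) s c| + 1.
  have B0 : 0 < B by rewrite ltr_wpDl.
  exists (Num.min d B^-1); first by rewrite lt_min d0 invr_gt0.
  move=> y; rewrite lt_min => /andP[yd _].
  apply: (@le_trans _ _ (B * B^-1)); last by rewrite divff// gt_eqF.
  apply: ler_pM => //; first by rewrite le_min ltW//= invr_ge0 ltW.
    have := Hd y yd; set u := dpartial _ s y; set u0 := dpartial _ s c => h.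
    have -> : u = (u - u0) + u0 by rewrite subrK.
    by apply: le_trans (ler_normD _ _) _; rewrite /B -/u0; lra.
  by rewrite ge_min lexx orbT.
have [|j|d d0 Hd] := @common_radius R 'I_n (fun j d => forall s, (size s <= p)%N ->
    forall y, `|y - c| < d -> `|dpartial (fun y => psi y 0 j) s y| * d <= 1).
- move=> j d d' Hd d'd s sp y yd; apply: le_trans (Hd s sp y (lt_le_trans yd d'd)); exact: ler_wpM2l.
- exact: H.
have /nbhs_ballP [d2 /= d20 Hd2] := open_nbhs_nbhs (conj oW Wc).
pose rho := Num.min 1 (Num.min d d2).
have rho0 : 0 < rho by rewrite !lt_min ltr01 d0.
have rho1 : rho <= 1 by rewrite ge_min lexx.
have rhod : rho <= d by rewrite !ge_min lexx orbT.
have inW y : `|y - c| < rho -> W y.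
  by rewrite !lt_min => /and3P[_ _ y2]; apply: Hd2; rewrite -ball_normE /= distrC.
pose A := rho^-1.
have A1 : 1 <= A by rewrite /A invf_ge1.
have HA y j s : `|y - c| < rho -> (size s <= p)%N -> `|dpartial (fun y => psi y 0 j) s y| <= A.
  move=> yr sp; rewrite /A -[rho^-1]mul1r ler_pdivlMr//.
  apply: le_trans (Hd j s sp y (lt_le_trans yr rhod)); exact: ler_wpM2l.
exists rho => //; exists A, ((1 + n%:R) * (A * n%:R) + 1); split => //.
  by rewrite lerDr mulr_ge0 ?addr_ge0 ?mulr_ge0//; lra.
move=> y z yr zr p0.
have lip j : `|psi y 0 j - psi z 0 j| <= A * n%:R * `|y - z|.
  have dj i x : `|x - c| < rho -> is_derive x (evec R i) (fun y => psi y 0 j) (dpartial (fun y => psi y 0 j) [:: i] x).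
    by move=> /inW Wx; have [_ /(_ p0)] := Cp_jet (cpsi j) (leq0n p : (size (@nil 'I_n) <= p)%N); apply.
  have bj i x : `|x - c| < rho -> `|dpartial (fun y => psi y 0 j) [:: i] x - 0| <= A.
    by move=> xr; rewrite subr0; exact: HA.
  have := strict_diff (m := fun=> 0) dj bj yr zr.
  rewrite [X in _ - X]big1 ?subr0 => [h|i _]; last by rewrite mul0r.
  apply: le_trans h _; rewrite -mulrA ler_wpM2l//; first lra.
  apply: (@le_trans _ _ (\sum_(i < n) `|y - z|)); last by rewrite sumr_const card_ord mulr_natl.
  by apply: ler_sum => i _; have := coord_le_norm (y - z) i; rewrite !mxE.
apply: le_trans (eucl_le_norm _) _.
apply: (@le_trans _ _ ((1 + n%:R) * (A * n%:R * `|y - z|))); last first.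
  by rewrite [leRHS]mulrDl mul1r mulrA lerDl.
rewrite ler_wpM2l ?addr_ge0//; apply: norm_le_coord => [|j].
  by rewrite !mulr_ge0//; lra.
by rewrite !mxE; exact: lip.
Qed.

(** [L ^+ p] accounts for distances being measured after [psi]; the rest is the constant of
    [scaled_bound_shifted]. *)
Definition push_const (A L : R) := L ^+ p * ((2 ^+ p) ^+ n * (2 ^+ p * A) ^+ p).

Lemma push_const_ge1 A L : 1 <= A -> 1 <= L -> 1 <= push_const A L.
Proof.
move=> A1 L1; have h2 : 1 <= 2 ^+ p :> R by rewrite exprn_ege1// ler1n.
by rewrite /push_const; do !(apply: mulr_ege1 || apply: exprn_ege1) => //; apply: mulr_ege1.
Qed.

(* [psi - psi y] vanishes at y, so that the shifted monomial of degree |alpha|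
   is O(d^|alpha|) in the scaled sense; this pays for the weight E^(p - |alpha|). *)
Lemma push_admissible y s (A L d E c : R) (al : 'X_{1..n < p.+1}) : W y -> 1 <= A -> 1 <= L ->
  (forall j s, (size s <= p)%N -> `|dpartial (fun y => psi y 0 j) s y| <= A) ->
  0 < d -> d <= 1 -> 0 <= E -> ((0 < p)%N -> E <= L * d) -> (size s <= p)%N ->
  `|c| * push_const A L * d ^+ p <= d ^+ size s ->
  E ^+ (p - mdegb al) * `|xi_at (dscale c (push s y)) al (psi y)| <= 1.
Proof.
move=> Wy A1 L1 HA d0 d1 E0 EL sp hc.
have alp : (mdegb al <= p)%N by have := bmdeg al; rewrite ltnS.
rewrite xi_at_scale (xi_at_push _ _ oW Wy cpsi sp).
have SB := scaled_bound_shifted al oW Wy cpsi d0 d1 A1 HA sp.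
set D := dpartial _ s y in SB *.
have ds0 : 0 < d ^+ size s by rewrite exprn_gt0.
rewrite -(ler_pM2l ds0) mulr1 normrM; apply: le_trans hc.
have -> : d ^+ size s * (E ^+ (p - mdegb al) * (`|c| * `|D|)) =
  `|c| * (E ^+ (p - mdegb al) * (d ^+ size s * `|D|)) by ring.
rewrite -mulrA ler_wpM2l//.
set C := (2 ^+ p) ^+ n * (2 ^+ p * A) ^+ p in SB *.
have C0 : 0 <= C by rewrite /C mulr_ge0 ?exprn_ge0// mulr_ge0 ?exprn_ge0//; lra.
have EE : E ^+ (p - mdegb al) <= L ^+ p * d ^+ (p - mdegb al).
  have [p0|] := ltnP 0 p; last first.
    move=> p0; have -> : (p - mdegb al = 0)%N by lia.
    by rewrite !expr0 mulr1 exprn_ege1.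
  apply: (@le_trans _ _ ((L * d) ^+ (p - mdegb al))).
    by apply: lerXn2r; rewrite ?nnegrE ?EL// mulr_ge0 ?ltW//; lra.
  rewrite exprMn; apply: ler_wpM2r; first by rewrite exprn_ge0// ltW.
  by rewrite ler_weXn2l// leq_subr.
have Ld0 : 0 <= L ^+ p * d ^+ (p - mdegb al) by rewrite mulr_ge0 ?exprn_ge0//; lra.
apply: (@le_trans _ _ (L ^+ p * d ^+ (p - mdegb al) * (C * d ^+ mdegb al))).
  apply: ler_pM => //; first by rewrite exprn_ge0.
  by rewrite mulr_ge0// exprn_ge0// ltW.
rewrite le_eqVlt; apply/orP; left; apply/eqP.
have Ep : d ^+ p = d ^+ (p - mdegb al) * d ^+ mdegb al by rewrite -exprD subnK.
by rewrite /push_const -/C Ep; ring.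
Qed.

End Chart.

(** * The Whitney field in a chart *)

Section ChartField.
Variables (R : realType) (n p : nat) (M X V : set 'rV[R]_n) (f : 'rV[R]_n -> R).
Variables (k N : nat) (phi psi : 'rV[R]_n -> 'rV[R]_n).
Local Notation pt := 'rV[R]_n.
Local Notation W := (phi @` V).
Local Notation dadd := (@Defs.dadd R n p).
Local Notation dscale := (@Defs.dscale R n p).
Local Notation push := (@push R n p psi).
Local Notation level := (@level R n p X f).
Implicit Types (x y z a b c : pt) (s t : seq 'I_n).
Hypothesis oW : open W.
Hypothesis psiK : forall x, V x -> psi (phi x) = x.
Hypothesis cpsi : forall j : 'I_n, Cp p W (fun y => psi y 0 j).
Definition flat y := forall j : 'I_n, (k <= j)%N -> y 0 j = 0.
Hypothesis flatP : forall x, V x -> (M x <-> flat (phi x)).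
Hypothesis oV : open V.
Hypothesis XM : X `<=` M.
Hypothesis Xcl : forall x, X x -> forall e : R, 0 < e -> exists2 y, `|y - x| < e &
  M y /\ exists2 e', 0 < e' & forall z, M z -> `|z - y| < e' -> X z.
Hypothesis nabla0 : forall a (la : R), level N a (@Defs.dzero R n p) la -> la = 0.
Hypothesis pN : (p.+1 < N)%N.

Definition tangent s := all (fun i : 'I_n => (i < k)%N) s.
Definition inner y := [/\ W y, flat y & exists2 e, 0 < e & forall z, M z -> `|z - psi y| < e -> X z].

Lemma eucl_sym x y : eucl (x - y) = eucl (y - x).
Proof. by rewrite /eucl; congr (Num.sqrt _); apply: eq_bigr => i _; rewrite !mxE -sqrrN opprB. Qed.

Lemma psi_continuous y : W y -> forall e : R, 0 < e -> exists2 d, 0 < d &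
  forall z, `|z - y| < d -> `|psi z - psi y| < e.
Proof.
by move=> Wy; apply: coordwise_continuousE => j; exact: (Cp_continuous (cpsi j) Wy).
Qed.

Lemma psi_eucl_continuous y : W y -> forall e : R, 0 < e -> exists2 d, 0 < d &
  forall z, `|z - y| < d -> eucl (psi z - psi y) < e.
Proof.
move=> Wy e e0; have n0 : 0 < 1 + n%:R :> R by rewrite ltr_wpDr.
have [d d0 Hd] := psi_continuous Wy (divr_gt0 e0 n0).
exists d => // z /Hd h; apply: le_lt_trans (eucl_le_norm _) _.
by rewrite mulrC -ltr_pdivlMr.
Qed.

Lemma psi_flat y : W y -> flat y -> M (psi y).
Proof. by move=> Wy fy; have [Vy E] := psi_in_chart psiK Wy; apply/flatP => //; rewrite E. Qed.

Lemma flat_psi y : W y -> M (psi y) -> flat y.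
Proof. by move=> Wy; have [Vy E] := psi_in_chart psiK Wy; move/flatP => /(_ Vy); rewrite E. Qed.

Lemma inner_X y : inner y -> X (psi y).
Proof. by move=> [Wy fy [e e0 H]]; apply: H; [exact: psi_flat|rewrite subrr normr0]. Qed.

Lemma inner_shift y (i : 'I_n) : (i < k)%N -> inner y ->
  exists2 d, 0 < d & forall t : R, `|t| < d -> inner (y + t *: evec R i).
Proof.
move=> ik [Wy fy [e e0 H]].
have e20 : 0 < e / 2 by rewrite divr_gt0.
have [d1 d10 H1] := psi_continuous Wy e20.
have /nbhs_ballP [d2 /= d20 Hd2] := open_nbhs_nbhs (conj oW Wy).
exists (Num.min d1 d2); first by rewrite lt_min d10.
move=> t; rewrite lt_min => /andP[t1 t2].
have yt : `|y + t *: evec R i - y| = `|t| by rewrite addrAC subrr add0r normrZ norm_evec mulr1.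
split.
- by apply: Hd2; rewrite -ball_normE /= distrC yt.
- move=> j kj; rewrite !mxE eqxx /= fy// add0r.
  by case: eqP => [E|_]; [move: kj; rewrite E leqNgt ik|rewrite mulr0].
exists (e / 2) => // z Mz zy; apply: H => //.
have -> : z - psi y = (z - psi (y + t *: evec R i)) + (psi (y + t *: evec R i) - psi y).
  by rewrite addrA subrK.
apply: le_lt_trans (ler_normD _ _) _.
by have := H1 (y + t *: evec R i); rewrite yt => /(_ t1); lra.
Qed.

Lemma push_nil y : push [::] y = dscale 1 (@Defs.delta R n p (psi y)).
Proof. by apply/funext => al; rewrite /Defs.dscale mul1r. Qed.

Lemma Cp_mon_psi al : Cp p W (fun x => mon (p := p) al (psi x)).
Proof. exact: Cp_mon. Qed.

Lemma inner_level j s y : (j <= p)%N -> (size s <= j)%N -> tangent s -> inner y ->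
  exists la, level j (psi y) (push s y) la.
Proof.
elim: j s y => [|j IH] s y jp.
  case: s => // _ _ iy; exists (f (psi y)); split; first exact: inner_X.
  by exists 1; rewrite mul1r push_nil.
move=> sj gs iy; have [sj'|sj'] := leqP (size s) j.
  have [la Hla] := IH s y (ltnW jp) sj' gs iy; exists la; exact: level_succ.
case: s sj sj' gs => [//|i s]; rewrite /= !ltnS => sj sj' /andP[ik gs].
have sp : (size s < p)%N by exact: leq_ltn_trans sj jp.
have [Wy fy _] := iy; have Xy := inner_X iy.
have [tau tau0 Htau] := inner_shift ik iy.
have [rho rho0 [A [L [A1 L1 inW HA HL]]]] := chart_bounds oW cpsi Wy.
have C1 := @push_const_ge1 R n p A L A1 L1; set C := @push_const R n p A L in C1.
have C0 : 0 < C by lra.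
have yy : `|y - y| < rho by rewrite subrr normr0.
(* The weights of the difference quotient are bounded by [C], so its multiple by [C^-1] is
   admissible; the fibres are linear and the factor is undone at the end. *)
have [la Hla] : exists la, level j.+1 (psi y) (dscale C^-1 (push (i :: s) y)) la.
  apply: (DeltaPhi_limit nabla0) => //; first lia.
  move=> d d0.
  have [d1 d10 H1] := psi_eucl_continuous Wy d0.
  have d20 : 0 < d / 2 by rewrite divr_gt0.
  have [||d2 d20' H2] := @common_radius R 'X_{1..n < p.+1}
    (fun al e => forall t : R, `|t| < e -> `|dpartial (fun x => mon al (psi x)) s (y + t *: evec R i)
       - push s y al - t * push (i :: s) y al| <= d / 2 * `|t|).
  - by move=> al e e' H e'e t te; apply: H; exact: lt_le_trans e'e.
  - move=> al; have [_ /(_ sp i y Wy)] := Cp_jet (Cp_mon_psi al) (ltnW sp).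
    by move/is_deriveE => /(_ _ d20).
  pose m := Num.min 1 (Num.min tau (Num.min rho (Num.min d1 d2))).
  have m0 : 0 < m by rewrite !lt_min ltr01 tau0 rho0 d10.
  pose t := m / 2.
  have t0 : 0 < t by rewrite divr_gt0.
  have tm : `|t| < m by rewrite gtr0_norm// /t; lra.
  move: (tm); rewrite !lt_min => /and5P[t1 ttau trho td1 td2].
  rewrite (gtr0_norm t0) in t1 trho.
  set y' := y + t *: evec R i.
  have y'y : `|y' - y| = `|t| by rewrite /y' addrAC subrr add0r normrZ norm_evec mulr1.
  have iy' : inner y' by exact: Htau.
  have [la' Hla'] := IH s y' (ltnW jp) sj gs iy'.
  have [la Hla] := IH s y (ltnW jp) sj gs iy.
  (* Only the functional at the second base point is subject to weights. Its coefficient 1/t is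
     affordable because t^(p-1) <= t^|s|, which uses |s| < p and t < 1. *)
  exists (psi y'), (psi y), (dadd (dscale (C^-1 / t) (push s y')) (dscale (- (C^-1 / t)) (push s y))),
    (C^-1 / t * la' + - (C^-1 / t) * la).
  split.
    split; first exact: inner_X.
    split=> //; exists (dscale (C^-1 / t) (push s y')), (C^-1 / t * la'), (dscale (- (C^-1 / t)) (push s y)), (- (C^-1 / t) * la).
    split; first exact: level_scale.
    split; first exact: level_scale.
    split=> //; split=> // al.
    apply: (@push_admissible R n p V phi psi oW cpsi y s A L t) => //.
    - by move=> jj s' s'p; exact: HA.
    - exact: ltW.
    - exact: eucl_ge0.
    - move=> p0; have := HL y' y; rewrite y'y (gtr0_norm t0); apply => //.
    - exact: ltnW.
    - rewrite normrN gtr0_norm ?divr_gt0 ?invr_gt0// -/C.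
      have -> : C^-1 / t * C * t ^+ p = t ^+ p / t by field; rewrite !gt_eqF.
      by rewrite ler_pdivrMr// -exprSr ler_wiXn2l// ltW.
  split; first by rewrite eucl_sym; apply: H1; rewrite y'y.
  split; first by rewrite subrr eucl0.
  move=> al; rewrite /Defs.dadd /Defs.dscale.
  have -> : C^-1 * push (i :: s) y al - (C^-1 / t * push s y' al + - (C^-1 / t) * push s y al) =
    - (C^-1 / t * (push s y' al - push s y al - t * push (i :: s) y al)).
    by field; rewrite !gt_eqF.
  rewrite normrN normrM gtr0_norm ?divr_gt0 ?invr_gt0//.
  apply: (@le_lt_trans _ _ (C^-1 / t * (d / 2 * t))).
    apply: ler_wpM2l; first by rewrite ltW// divr_gt0// invr_gt0.
    by have := H2 al t td2; rewrite (gtr0_norm t0).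
  have -> : C^-1 / t * (d / 2 * t) = C^-1 * (d / 2) by field; rewrite !gt_eqF.
  apply: (@le_lt_trans _ _ (1 * (d / 2))); last lra.
  by rewrite ler_wpM2r ?(ltW d20)// invf_le1.
exists (C * la); have := level_scale C Hla.
rewrite (_ : dscale C _ = push (i :: s) y)//.
by apply/funext => al; rewrite /Defs.dscale mulrA divff ?mul1r// gt_eqF.
Qed.

Definition charted y := W y /\ X (psi y).

Lemma charted_flat y : charted y -> flat y.
Proof. by move=> [Wy /XM]; exact: flat_psi. Qed.

Hypothesis cphi : forall j : 'I_n, Cp p V (fun x => phi x 0 j).

(** Near a point of [X] there are inner points, where diagonal pairs carry no weight condition;
    since [push s] is continuous, their functionals converge. *)
Lemma charted_level s y : (size s <= p)%N -> tangent s -> charted y ->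
  exists la, level p.+1 (psi y) (push s y) la.
Proof.
move=> sp gs [Wy Xy]; apply: (DeltaPhi_limit nabla0) => //; first lia.
move=> d d0.
have [Vy Ey] := psi_in_chart psiK Wy.
have [||d1 d10 H1] := @common_radius R 'X_{1..n < p.+1}
  (fun al e => forall z, `|z - y| < e -> `|push s z al - push s y al| < d).
- by move=> al e e' H e'e z ze; apply: H; exact: lt_le_trans e'e.
- move=> al; have [/(_ y Wy) + _] := Cp_jet (Cp_mon_psi al) sp.
  by move/continuousE => /(_ _ d0).
have [d2 d20 H2] := coordwise_continuousE (fun j => Cp_continuous (cphi j) Vy) d10.
have /nbhs_ballP [d3 /= d30 Hd3] := open_nbhs_nbhs (conj oV Vy).
have n0 : 0 < 1 + n%:R :> R by rewrite ltr_wpDr.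
have m0 : 0 < Num.min d2 (Num.min d3 (d / (1 + n%:R))) by rewrite !lt_min d20 d30 divr_gt0.
have [z + [Mz Hz]] := Xcl Xy m0.
rewrite !lt_min => /and3P[z2 z3 z4].
have Vz : V z by apply: Hd3; rewrite -ball_normE /= distrC.
have zE := psiK Vz.
have iz : inner (phi z).
  split; first by exists z.
    by apply/flatP.
  by rewrite zE.
have [la Hla] := inner_level (leqnn p) sp gs iz; rewrite zE in Hla.
exists z, z, (push s (phi z)), la; split; first exact: DeltaPhi_diag.
have ez : eucl (psi y - z) < d.
  rewrite eucl_sym; apply: le_lt_trans (eucl_le_norm _) _.
  by rewrite mulrC -ltr_pdivlMr.
split=> //; split=> // al; rewrite distrC; apply: H1.
by have := H2 z z2; rewrite Ey.
Qed.

(** The value 0 on words with a normal letter prescribes that normal derivatives vanish. *)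
Definition chart_field s y : R :=
  if tangent s then xget 0 [set la | level p.+1 (psi y) (push s y) la] else 0.
Local Notation l := chart_field.

Lemma chart_field_level s y : (size s <= p)%N -> tangent s -> charted y ->
  level p.+1 (psi y) (push s y) (l s y).
Proof.
move=> sp gs cy; rewrite /l gs; have [la Hla] := charted_level sp gs cy.
by apply: (@xgetPex _ 0 [set la | level p.+1 (psi y) (push s y) la]); exists la.
Qed.

Lemma chart_field_nil y : charted y -> l [::] y = f (psi y).
Proof.
move=> cy; have H := chart_field_level (leq0n p : (size (@nil 'I_n) <= p)%N) isT cy.
apply: (level_uniq nabla0 (ltnW pN) H).
apply: (@level_mono R n p X f 0 p.+1) => //; split; first by case: cy.
by exists 1; rewrite mul1r push_nil.
Qed.

Lemma push_sym s i j t y : W y -> ((size s + size t).+2 <= p)%N ->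
  push (s ++ i :: j :: t) y = push (s ++ j :: i :: t) y.
Proof.
by move=> Wy st; apply/funext => al; apply: (dpartial_sym oW Wy (Cp_mon_psi al)).
Qed.

(** The chosen value depends on the word only through [push s y] and tangency, and both are
    symmetric. *)
Lemma chart_field_sym y : charted y -> word_sym p (fun s => l s y).
Proof.
move=> [Wy _] s i j t st; rewrite /l (push_sym _ _ Wy st) /tangent !all_cat /=.
by rewrite (andbCA (i < k)%N).
Qed.

Lemma hpoly_normal m t a v : ~~ tangent t -> hpoly (fun s => l s a) m t v = 0.
Proof.
elim: m t => [|m IH] t nt /=; first by rewrite /l (negbTE nt).
by rewrite big1// => i _; rewrite IH ?mulr0//= negb_and nt orbT.
Qed.

Lemma taylor_normal q t a v : ~~ tangent t -> taylor (fun s => l s a) q t v = 0.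
Proof. by move=> nt; rewrite /taylor big1// => m _; rewrite hpoly_normal// mul0r. Qed.

Lemma hpoly_level a v m t : charted a -> flat v -> tangent t -> (size t + m <= p)%N ->
  level p.+1 (psi a) (fun al => hpoly (fun s => push s a al) m t v) (hpoly (fun s => l s a) m t v).
Proof.
move=> ca fv; elim: m t => [|m IH] t gt tm /=.
  by apply: chart_field_level => //; rewrite addn0 in tm.
have Xa : X (psi a) by case: ca.
apply: (@level_sum R n p X f _ (index_enum 'I_n) p.+1 (psi a) (fun i => v 0 i)
  (fun i al => hpoly (fun s => push s a al) m (i :: t) v) _ Xa) => i.
have [ik|ki] := ltnP i k.
  by apply: level_scale; apply: IH => /=; [rewrite ik|lia].
rewrite fv// mul0r (_ : dscale 0 _ = @Defs.dzero R n p); first exact: level0.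
by apply/funext => al; rewrite /Defs.dscale mul0r.
Qed.

Lemma taylor_level a v q t : charted a -> flat v -> tangent t -> (size t + q <= p)%N ->
  level p.+1 (psi a) (fun al => taylor (fun s => push s a al) q t v) (taylor (fun s => l s a) q t v).
Proof.
move=> ca fv gt tq; have Xa : X (psi a) by case: ca.
rewrite /taylor; under eq_bigr => m _ do rewrite mulrC.
rewrite (_ : (fun al => _) = fun al => \sum_(m < q.+1) (m`!)%:R^-1 * hpoly (fun s => push s a al) m t v); last first.
  by apply/funext => al; apply: eq_bigr => m _; rewrite mulrC.
apply: (@level_sum R n p X f _ (index_enum 'I_q.+1) p.+1 (psi a) (fun m : 'I_q.+1 => (m`!)%:R^-1)
  (fun m al => hpoly (fun s => push s a al) m t v) _ Xa) => m.
by apply: level_scale; apply: hpoly_level => //; have := ltn_ord m; lia.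
Qed.

(** The Taylor remainder of [push t] between [a] and [b] is a pair in [DeltaPhi] whose value is the
    remainder of the field. The functional remainder is small since [psi] is C^p, and
    [DeltaPhi_small] passes smallness on to the value. *)
Lemma chart_whitney c : charted c -> forall e : R, 0 < e -> exists2 d, 0 < d &
  forall a b, charted a -> charted b -> `|a - c| < d -> `|b - c| < d ->
  whitney_pair p l a b e.
Proof.
move=> [Wc Xc] e e0.
have [rho rho0 [A [L [A1 L1 inW HA HL]]]] := chart_bounds oW cpsi Wc.
have C1 := @push_const_ge1 R n p A L A1 L1; set C := @push_const R n p A L in C1.
have C0 : 0 < C by lra.
have eC0 : 0 < e * C^-1 by rewrite mulr_gt0// invr_gt0.
have [d6 d60 H6] := DeltaPhi_small nabla0 pN Xc eC0.
have d620 : 0 < d6 / 2 by rewrite divr_gt0.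
have [||d1 d10 H1] := @common_radius R 'X_{1..n < p.+1}
  (fun al d => forall a b, `|a - c| < d -> `|b - c| < d -> forall t, (size t <= p)%N ->
     `|push t b al - taylor (fun s => push s a al) (p - size t) t (b - a)|
        <= d6 / 2 * `|b - a| ^+ (p - size t)).
- by move=> al d d' H d'd a b ad bd; apply: H; exact: lt_le_trans d'd.
- by move=> al; exact: (taylor_remainder oW Wc (Cp_mon_psi al) d620).
have [d2 d20 H2] := psi_eucl_continuous Wc d60.
pose m := Num.min 1 (Num.min rho (Num.min d1 d2)).
have m0 : 0 < m by rewrite !lt_min ltr01 rho0 d10.
exists (m / 2); first by rewrite divr_gt0.
move=> a b ca cb ac bc t tp.
have [nt|] := boolP (~~ tangent t).
  by rewrite (taylor_normal _ _ _ nt) /l (negbTE nt) subrr normr0 mulr_ge0// ltW.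
rewrite negbK => gt.
have [->|ab] := eqVneq b a.
  by rewrite subrr taylor_at0 subrr normr0 mulr_ge0// ltW.
have acm : `|a - c| < m by lra.
have bcm : `|b - c| < m by lra.
move: acm bcm; rewrite !lt_min => /and4P[_ arho a1 a2] /and4P[_ brho b1 b2].
set D := `|b - a|.
have D0 : 0 < D by rewrite normr_gt0 subr_eq0.
have D1 : D < 1.
  have : D <= `|b - c| + `|a - c|.
    have -> : D = `|(b - c) - (a - c)| by rewrite opprB addrA subrK.
    exact: ler_normB.
  by have : m <= 1 by [rewrite ge_min lexx]; lra.
set q := (p - size t)%N.
have Dq : 0 < D ^+ q by rewrite exprn_gt0.
(* The largest factor that [push_admissible] allows with d = [D]: its condition becomes an equality.
   The remainder is thereby divided by the power of [D] required by Whitney's condition. *)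
pose w := C^-1 / D ^+ q.
have w0 : 0 < w by rewrite divr_gt0// invr_gt0.
have fab : flat (b - a).
  by move=> j kj; rewrite !mxE (charted_flat ca kj) (charted_flat cb kj) subr0.
pose T (al : 'X_{1..n < p.+1}) := taylor (fun s => push s a al) q t (b - a).
have HT : level p.+1 (psi a) T (taylor (fun s => l s a) q t (b - a)).
  by apply: taylor_level => //; rewrite /q subnKC.
have Hb := chart_field_level tp gt cb.
have [Wa Xa] := ca; have [Wb Xb] := cb.
have Del : DeltaPhi X (level p.+1) (psi a) (psi b)
    (dadd (dscale (- w) T) (dscale w (push t b)))
    (- w * taylor (fun s => l s a) q t (b - a) + w * l t b).
  split=> //; split=> //.
  exists (dscale (- w) T), (- w * taylor (fun s => l s a) q t (b - a)), (dscale w (push t b)), (w * l t b).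
  split; first exact: level_scale.
  split; first exact: level_scale.
  split=> //; split=> // al.
  apply: (@push_admissible R n p V phi psi oW cpsi b t A L D) => //.
  - by move=> jj s' s'p; exact: HA.
  - exact: ltW.
  - exact: eucl_ge0.
  - by move=> p0; have := HL a b arho brho p0; rewrite distrC.
  - rewrite gtr0_norm// -/C /w.
    have -> : D ^+ p = D ^+ q * D ^+ size t by rewrite -exprD /q subnK.
    have -> : C^-1 / D ^+ q * C * (D ^+ q * D ^+ size t) = D ^+ size t.
      by field; rewrite !gt_eqF.
    by [].
have := H6 _ _ _ _ Del.
rewrite eucl_sym (eucl_sym (psi c) (psi b)) => /(_ (H2 a a2) (H2 b b2)).
have -> : - w * taylor (fun s => l s a) q t (b - a) + w * l t b =
   w * (l t b - taylor (fun s => l s a) q t (b - a)) by ring.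
rewrite normrM (gtr0_norm w0) => H.
have {}H : w * `|l t b - taylor (fun s => l s a) q t (b - a)| < e / C.
  apply: H => al; rewrite /Defs.dadd /Defs.dscale.
  have -> : - w * T al + w * push t b al = w * (push t b al - T al) by ring.
  rewrite normrM (gtr0_norm w0); apply: (@le_lt_trans _ _ (w * (d6 / 2 * D ^+ q))).
    by rewrite ler_wpM2l ?(ltW w0)//; exact: H1.
  have -> : w * (d6 / 2 * D ^+ q) = C^-1 * (d6 / 2) by rewrite /w; field; rewrite !gt_eqF.
  apply: (@le_lt_trans _ _ (1 * (d6 / 2))); last lra.
  by rewrite ler_wpM2r ?(ltW d620)// invf_le1.
rewrite -(ler_pM2l w0); apply: ltW; apply: lt_le_trans H _.
rewrite le_eqVlt; apply/orP; left; apply/eqP.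
by rewrite /w; field; rewrite !gt_eqF.
Qed.

End ChartField.

(** * The theorem *)

Lemma closure_ball (R : realType) (n : nat) (A : set 'rV[R]_n) x :
  closure A x <-> forall e : R, 0 < e -> exists2 y, A y & `|y - x| < e.
Proof.
split=> [cA e e0|H B].
  have [y [Ay yx]] := cA _ (nbhsx_ballx x e e0); exists y => //.
  by move: yx; rewrite -ball_normE /= distrC.
move=> /nbhs_ballP [e /= e0 He]; have [y Ay yx] := H e e0.
by exists y; split=> //; apply: He; rewrite -ball_normE /= distrC.
Qed.

(** The powers 0 to p of a single variable are already p + 1 monomials. *)
Lemma ltn_dim (n p : nat) : (0 < n)%N -> (p < r n p)%N.
Proof.
move=> n0; pose i : 'I_n := Ordinal n0.
have md (q : 'I_p.+1) : (mdeg (U_(i) *+ q)%MM < p.+1)%N by rewrite mdegMn mdeg1 mul1n ltn_ord.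
pose g (q : 'I_p.+1) : 'X_{1..n < p.+1} := BMultinom (md q).
have gi : injective g.
  move=> q q' /(congr1 (fun m : 'X_{1..n < p.+1} => mdeg m)) /=.
  by rewrite !mdegMn mdeg1 !mul1n => /val_inj.
by have := leq_card g gi; rewrite card_ord.
Qed.

Section Main.
Variables (R : realType) (n p : nat) (U M X : set 'rV[R]_n) (f : 'rV[R]_n -> R).
Local Notation pt := 'rV[R]_n.
Hypothesis oU : open U.
Hypothesis subM : Cp_submanifold p U M.
Hypothesis clM : closed_in U M.
Hypothesis XM : X `<=` M.
Hypothesis XP : forall x, X x <-> rel_closure M (rel_interior M X) x.

Lemma eucl_lt_norm (v : pt) (e : R) : `|v| < e / (1 + n%:R) -> eucl v < e.
Proof.
have n0 : 0 < 1 + n%:R :> R by rewrite ltr_wpDr.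
by move=> h; apply: le_lt_trans (eucl_le_norm _) _; rewrite mulrC -ltr_pdivlMr.
Qed.

Lemma X_inner_dense x : X x -> forall e : R, 0 < e -> exists2 y, `|y - x| < e &
  M y /\ exists2 e', 0 < e' & forall z, M z -> `|z - y| < e' -> X z.
Proof.
move=> /XP [Mx H] e e0; have [y [[Xy [e' [e'0 He']]] yx]] := H e e0.
exists y; first exact: le_lt_trans (norm_le_eucl _) yx.
split; first exact: XM.
exists (e' / (1 + n%:R)); first by rewrite divr_gt0// ltr_wpDr.
by move=> z Mz zy; apply: He' => //; exact: eucl_lt_norm.
Qed.

Lemma X_closed_in x : U x -> (forall e : R, 0 < e -> exists2 y, X y & `|y - x| < e) -> X x.
Proof.
move=> Ux H; apply/XP; split.
  by apply: clM => //; apply/closure_ball => e /H [y /XM My yx]; exists y.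
move=> e e0; have n0 : 0 < 1 + n%:R :> R by rewrite ltr_wpDr.
have e20 : 0 < e / (1 + n%:R) / 2 by rewrite !divr_gt0.
have [y Xy yx] := H _ e20.
have /XP [_ /(_ _ e20) [z [iz zy]]] := Xy; exists z; split=> //; apply: eucl_lt_norm.
have -> : z - x = (z - y) + (y - x) by rewrite addrA subrK.
apply: le_lt_trans (ler_normD _ _) _; have := norm_le_eucl (z - y); lra.
Qed.

Variable N : nat.
Hypothesis nabla0 : forall a (la : R), level X f N a (@Defs.dzero R n p) la -> la = 0.
Hypothesis pN : (p.+1 < N)%N.

Lemma local_extension a0 : X a0 -> exists2 r : R, 0 < r & exists F, extends_near p X f a0 r F.
Proof.
move=> Xa0; have Ma0 := XM Xa0.
have [MU /(_ a0 Ma0) [V [k [phi [psi [oV [Va0 [VU [oW [psiK [cphi [cpsi flatP]]]]]]]]]]]] := subM.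
set W := phi @` V in oW cpsi.
have Wy0 : W (phi a0) by exists a0.
have /nbhs_ballP [rho2 /= rho20 Hrho2] := open_nbhs_nbhs (conj oW Wy0).
(* Half the radius keeps limits of points of [K] inside the chart. As [X] is closed only relative to
   [U], this is what makes [K] closed in R^n. *)
pose rho := rho2 / 2.
have rho0 : 0 < rho by rewrite divr_gt0.
pose K : set pt := [set y | charted X V phi psi y /\ `|y - phi a0| <= rho].
have clK : closed K.
  move=> y /closure_ball cy.
  have yrho : `|y - phi a0| <= rho.
    apply/ler_addgt0Pr => e e0; have [z [_ zr] zy] := cy e e0.
    have -> : y - phi a0 = (z - phi a0) - (z - y) by rewrite opprB [RHS]addrC addrA subrK.
    by apply: le_trans (ler_normB _ _) _; lra.
  have Wy : W y.
    by apply: Hrho2; rewrite -ball_normE /= distrC; apply: le_lt_trans yrho _; rewrite /rho; lra.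
  have [Vy _] := psi_in_chart psiK Wy.
  split=> //; split=> //; apply: X_closed_in; first exact: VU.
  move=> e e0; have [d d0 Hd] := coordwise_continuousE (fun j => Cp_continuous (cpsi j) Wy) e0.
  have [z [[Wz Xz] _] zy] := cy d d0.
  by exists (psi z) => //; exact: Hd.
have Kch y : K y -> charted X V phi psi y by case.
pose l := @chart_field R n p X f k psi.
have symK y : K y -> word_sym p (fun s => l s y).
  by move=> /Kch; exact: (chart_field_sym _ _ oW cpsi).
have whK c : K c -> forall e : R, 0 < e -> exists2 d, 0 < d &
  forall a b, K a -> K b -> `|a - c| < d -> `|b - c| < d -> whitney_pair p l a b e.
  move=> /Kch cc e e0.
  have [d d0 Hd] := chart_whitney oW psiK cpsi flatP oV XM X_inner_dense nabla0 pN cphi cc e0.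
  by exists d => // a b /Kch ca /Kch cb; exact: Hd.
pose N0 := Num.bound (`|phi a0| + rho + 4).
have bdK y : K y -> `|y| + 4 <= N0%:R.
  move=> [_ yr]; apply: ltW; apply: le_lt_trans (archi_boundP _); last first.
    by rewrite !addr_ge0// ltW.
  have -> : y = phi a0 + (y - phi a0) by rewrite addrC subrK.
  by rewrite lerD2r; apply: le_trans (ler_normD _ _) _; rewrite lerD2l.
pose H := extension p K l N0.
have cH : Cp p setT H := whitney_extension symK bdK clK whK.
have /nbhs_ballP [r1 /= r10 Hr1] := open_nbhs_nbhs (conj oV Va0).
have [r2 r20 Hr2] := coordwise_continuousE (fun j => Cp_continuous (cphi j) Va0) rho0.
exists (Num.min r1 r2); first by rewrite lt_min r10.
have inV x : `|x - a0| < Num.min r1 r2 -> V x /\ `|phi x - phi a0| < rho.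
  rewrite lt_min => /andP[x1 x2]; split; last exact: Hr2.
  by apply: Hr1; rewrite -ball_normE /= distrC.
exists (H \o phi); split.
  apply: (Cp_comp (W := setT) (@open_norm_lt _ _ a0 (Num.min r1 r2)) openT) => // j.
  by apply: (Cp_sub (leqnn p) _ (cphi j)) => x /inV [].
move=> x /inV [Vx xr] Xx.
have Kx : K (phi x).
  by split; [split; [exists x|rewrite psiK]|exact: ltW].
rewrite /= /H extension_on// /l (chart_field_nil oW psiK cpsi flatP oV X_inner_dense nabla0 pN cphi (Kch _ Kx)).
by rewrite psiK.
Qed.

Lemma global_extension : exists F, Cp p U F /\ forall x, X x -> F x = f x.
Proof.
have XU x : X x -> U x by move=> /XM; have [MU _] := subM; exact: MU.
have [|F cF FX] := @Cp_gluing R n p U X f oU; last first.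
  by exists F; split=> // x Xx; apply: FX => //; exact: XU.
move=> x Ux; have [Xx|nXx] := pselect (X x); first exact: local_extension.
have [e e0 He] : exists2 e : R, 0 < e & forall y, `|y - x| < e -> ~ X y.
  apply: contrapT => H; apply: nXx; apply: X_closed_in => // e e0.
  apply: contrapT => H'; apply: H; exists e => // y yx Xy; apply: H'; by exists y.
exists e => //; exists (fun=> 0); split; first by apply: Cp_cst; exact: open_norm_lt.
by move=> y /He.
Qed.

End Main.

Theorem theorem4p24 (R : realType) (n p : nat) (U M X : set 'rV[R]_n)
    (f : 'rV[R]_n -> R) :
  open U ->
  Cp_submanifold p U M ->
  closed_in U M ->
  X `<=` M ->
  (forall x, X x <-> rel_closure M (rel_interior M X) x) ->
  @nabla_is_function R n p X f ->
  exists F : 'rV[R]_n -> R, Cp p U F /\ (forall x, X x -> F x = f x).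
Proof.
move=> oU subM clM XM XP nab.
(* For n = 0 the space is a single point and [f] itself is C^p; the bound r > p is available only
   for n > 0. *)
have [n0|] := ltnP 0 n; last first.
  rewrite leqn0 => /eqP n0.
  have I0 : 'I_n -> False by rewrite n0 => -[].
  exists f; split=> // -[_|i]; last by have := I0 i.
  split; last by move=> _ i; have := I0 i.
  move=> x _; apply/continuousE => e e0; exists 1 => // y _.
  have -> : y = x by apply/rowP => i; have := I0 i.
  by rewrite subrr normr0.
apply: (global_extension oU subM clM XM XP (N := 2 * (r n p).+1)); last first.
  by have := ltn_dim p n0; lia.
(* The zero functional belongs to every fibre of [tau] over X and has the value 0, so uniqueness
   forces [la = 0]. *)
move=> a la Hla; have Xa := level_base Hla.
have [|la0 [_ Hu]] := nab a (@Defs.dzero R n p).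
  rewrite /tau; case: (2 * r n p)%N => [|m].
    by split=> //; exists 0; apply/funext => al; rewrite /Defs.dscale mul0r.
  split=> //; exists 0%N, (fun=> 0), (fun=> @Defs.dzero R n p).
  by split=> [[]//|al]; rewrite big_ord0.
by rewrite -(Hu la Hla); apply: Hu; exact: (@level0 R n p X f (2 * (r n p).+1) a Xa).
Qed.
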